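(* Let $M$ be a compact connected smooth manifold without boundary, let $H$ be a Tonelli Hamiltonian on $T^*M$ and suppose that there exist $k$ independent $C^2$ integrals of motion of $H$. Then for each $c\in H^1(M;\mathbb{R})$ and all points $(x,p)\in\mathcal{M}^*_c(H)$ one has $$\operatorname{rank} T_{(x,p)}\mathcal{M}^*_c(H)\ge k.$$
   Context: $T^*M$ carries its canonical symplectic form $\omega$; $X_f$ denotes the Hamiltonian vector field of $f$ (so $df=\omega(X_f,\cdot)$), $\Phi_f^t$ its flow, and $\{f,g\}=\omega(X_f,X_g)$. A Tonelli Hamiltonian is a $C^2$ function $H:T^*M\to\mathbb{R}$ that is strictly convex in each fiber ($\partial^2H/\partial p^2$ positive definite) and uniformly superlinear in each fiber. An integral of motion of $H$ is a function $F:T^*M\to\mathbb{R}$ with $\{H,F\}\equiv0$; integrals of motion are independent if their differentials are linearly independent at each point of $T^*M$. The Lagrangian associated to $H$ is $L(x,v)=\sup_{p\in T^*_xM}(\langle p,v\rangle-H(x,p))$ on $TM$, and the Legendre transform $\mathcal{L}_L(x,v)=(x,\partial L/\partial v(x,v))$ conjugates the Euler–Lagrange flow of $L$ to $\Phi_H$. For $c\in H^1(M;\mathbb{R})$, fix a smooth closed 1-form $\eta$ with $[\eta]=c$. A $c$-action minimizing measure is a Borel probability measure on $TM$, invariant under the Euler–Lagrange flow, that minimizes $\int_{TM}(L(x,v)-\langle\eta(x),v\rangle)\,d\mu$ among all such measures (this does not depend on the choice of $\eta$ in $c$). The Mather set $\mathcal{M}^*_c(H)\subset T^*M$ is the image under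 $\mathcal{L}_L$ of the union of the supports of all $c$-action minimizing measures. The generalized tangent space $T_{(x,p)}\mathcal{M}^*_c(H)$ is the set of all vectors of $T_{(x,p)}(T^*M)$ that are tangent at $(x,p)$ to curves contained in $\mathcal{M}^*_c(H)$; its rank is the largest number of linearly independent vectors it contains. *)

(* Defs.v *)
From HB Require Import structures.
From mathcomp Require Import all_boot all_order all_algebra.
From mathcomp Require Import all_classical all_reals all_analysis.
Set Implicit Arguments.
Unset Strict Implicit.
Unset Printing Implicit Defensive.
Import Order.TTheory GRing.Theory Num.Theory.
Import numFieldNormedType.Exports.
Local Open Scope classical_set_scope.
Local Open Scope ring_scope.

Section calculus.
Context {R : realType}.

(* [U] is meant to be open and the domain finite-dimensional: then [f] is C^k
   on [U] iff all its iterated directional derivatives of order at most [k]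
   exist and are continuous there. *)
Fixpoint is_Ck {V W : normedModType R} (k : nat) (U : set V) (f : V -> W) : Prop :=
  match k with
  | 0 => forall x, U x -> {for x, continuous f}
  | k'.+1 => (forall x, U x -> differentiable f x) /\
             (forall v, is_Ck k' U (fun x => 'D_v f x))
  end.

Definition is_smooth {V W : normedModType R} (U : set V) (f : V -> W) : Prop :=
  forall k, is_Ck k U f.

Definition dotv {m : nat} (p v : 'rV[R]_m) : R := \sum_j p 0 j * v 0 j.

Definition grad {m : nat} (f : 'rV[R]_m -> R) (x : 'rV[R]_m) : 'rV[R]_m :=
  \row_j 'D_(delta_mx 0 j) f x.

(* The covector [v |-> <p, df_x(v)>]. *)
Definition pullback {m l : nat} (f : 'rV[R]_m -> 'rV[R]_l) (x : 'rV[R]_m)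
    (p : 'rV[R]_l) : 'rV[R]_m :=
  \row_j dotv p ('D_(delta_mx 0 j) f x).

(* The largest number of linearly independent vectors contained in [A]. *)
Definition set_rank {m : nat} (A : set 'rV[R]_m) : nat :=
  \max_(r < m.+1 |
        `[< exists2 X : 'M[R]_(r, m), row_free X & forall i, A (row i X) >]) r.

(* The canonical symplectic form dx /\ dp, on vectors written as
   (dx-component, dp-component). *)
Definition omega {m : nat} (u w : 'rV[R]_(m + m)) : R :=
  dotv (lsubmx u) (rsubmx w) - dotv (lsubmx w) (rsubmx u).

Definition symplectic_dual {m : nat} (a : 'rV[R]_(m + m)) : 'rV[R]_(m + m) :=
  row_mx (rsubmx a) (- lsubmx a).

Lemma dotv_delta m (p : 'rV[R]_m) j : dotv p (delta_mx 0 j) = p 0 j.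
Proof.
rewrite /dotv (bigD1 j) //= big1 => [|i ij]; first by rewrite mxE !eqxx mulr1 addr0.
by rewrite mxE eqxx (negbTE ij) mulr0.
Qed.

Lemma symplectic_dualP m (a X : 'rV[R]_(m + m)) :
  (forall w, dotv a w = omega X w) <-> X = symplectic_dual a.
Proof.
have dotvC (p v : 'rV[R]_m) : dotv p v = dotv v p.
  by apply: eq_bigr => j _; rewrite mulrC.
have dotvN (p v : 'rV[R]_m) : dotv p (- v) = - dotv p v.
  by rewrite /dotv -sumrN; apply: eq_bigr => j _; rewrite mxE mulrN.
have dotv0 (p : 'rV[R]_m) : dotv p 0 = 0.
  by rewrite /dotv big1 // => j _; rewrite mxE mulr0.
have dotvE (u w : 'rV[R]_(m + m)) :
    dotv u w = dotv (lsubmx u) (lsubmx w) + dotv (rsubmx u) (rsubmx w).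
  by rewrite /dotv big_split_ord; congr (_ + _); apply: eq_bigr => j _; rewrite !mxE.
split=> [aX|-> w]; last first.
  by rewrite /omega /symplectic_dual row_mxKl row_mxKr dotvE dotvN opprK
             [RHS]addrC [dotv (lsubmx w) _]dotvC.
rewrite -[X]hsubmxK; congr row_mx; apply/rowP => j.
  have := aX (row_mx 0 (delta_mx 0 j)).
  by rewrite dotvE /omega !row_mxKl !row_mxKr (dotvC 0) !dotv0 add0r subr0 !dotv_delta.
have := aX (row_mx (delta_mx 0 j) 0).
rewrite dotvE /omega !row_mxKl !row_mxKr !dotv0 addr0 sub0r (dotvC (delta_mx 0 j)).
by rewrite !dotv_delta => aXj; rewrite [RHS]mxE aXj opprK.
Qed.

End calculus.

(* A smooth manifold of dimension [n], given by a smooth atlas on a nonempty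
   topological space.  [chart_at] selects, for each point, one chart whose domain
   contains it; [phi i] is meaningful on [dom i] only, and [psi i] on
   [phi i @` dom i] only. *)
Record smoothManifold (R : realType) (n : nat) := SmoothManifold {
  carrier :> ptopologicalType;
  chart_ix : Type;
  dom : chart_ix -> set carrier;
  phi : chart_ix -> carrier -> 'rV[R]_n;
  psi : chart_ix -> 'rV[R]_n -> carrier;
  chart_at : carrier -> chart_ix;
  manifold_hausdorff : hausdorff_space carrier;
  manifold_second_countable : @second_countable carrier;
  chart_at_dom : forall x, dom (chart_at x) x;
  dom_open : forall i, open (dom i);
  cod_open : forall i, open (phi i @` dom i);
  phiK : forall i x, dom i x -> psi i (phi i x) = x;
  phi_continuous : forall i x, dom i x -> {for x, continuous (phi i)};
  psi_continuous : forall i q, (phi i @` dom i) q -> {for q, continuous (psi i)};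
  transition_smooth : forall i j,
    is_smooth (phi i @` (dom i `&` dom j)) (phi j \o psi i) }.

Section manifold.
Context {R : realType} {n : nat} (M : smoothManifold R n).

Definition cod (i : chart_ix M) : set 'rV[R]_n := phi i @` dom i.

Definition trans (i j : chart_ix M) : 'rV[R]_n -> 'rV[R]_n := phi j \o psi i.

(* [T_x M] is identified with R^n through the chart [chart_at x], and [T*_x M]
   is written in the dual basis, so that <p, v> = dotv p v.  The coordinates in
   another chart are obtained with the differential of the transition map. *)
Record tangent := Tan { tbase : M; tvec : 'rV[R]_n }.
Record cotangent := Cot { cbase : M; covec : 'rV[R]_n }.

HB.instance Definition _ := gen_eqMixin tangent.
HB.instance Definition _ := gen_choiceMixin tangent.
HB.instance Definition _ := isPointed.Build tangent (Tan point 0).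

Definition smooth_fun (f : M -> R) : Prop :=
  forall i, is_smooth (cod i) (f \o psi i).

(* The charts (x, v) |-> (phi i x, coordinates of v) of TM, and their inverses. *)
Definition tan_chart (i : chart_ix M) (z : tangent) : 'rV[R]_(n + n) :=
  let j := chart_at (tbase z) in
  row_mx (phi i (tbase z)) ('D_(tvec z) (trans j i) (phi j (tbase z))).

Definition tan_param (i : chart_ix M) (y : 'rV[R]_(n + n)) : tangent :=
  let x := psi i (lsubmx y) in
  Tan x ('D_(rsubmx y) (trans i (chart_at x)) (lsubmx y)).

(* The charts (x, p) |-> (phi i x, coordinates of p) of T*M, and their inverses. *)
Definition cot_chart (i : chart_ix M) (z : cotangent) : 'rV[R]_(n + n) :=
  let j := chart_at (cbase z) in
  row_mx (phi i (cbase z)) (pullback (trans i j) (phi i (cbase z)) (covec z)).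

Definition cot_param (i : chart_ix M) (y : 'rV[R]_(n + n)) : cotangent :=
  let x := psi i (lsubmx y) in let j := chart_at x in
  Cot x (pullback (trans j i) (phi j x) (rsubmx y)).

(* The common codomain of the charts of TM and of T*M induced by [i]. *)
Definition bundle_cod (i : chart_ix M) : set 'rV[R]_(n + n) :=
  [set y | cod i (lsubmx y)].

Definition tan_open : set (set tangent) :=
  [set U | forall i, open (bundle_cod i `&` tan_param i @^-1` U)].

Definition borelTM := g_sigma_algebraType tan_open.

Definition cot_Ck (k : nat) (f : cotangent -> R) : Prop :=
  forall i, is_Ck k (bundle_cod i) (f \o cot_param i).

(* The differential of f at z and the Hamiltonian vector field X_f at z, both in
   the coordinates of the chart of T*M induced by [chart_at (cbase z)]; by
   [symplectic_dualP], X_f is characterized by df = omega(X_f, .). *)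
Definition cot_diff (f : cotangent -> R) (z : cotangent) : 'rV[R]_(n + n) :=
  let i := chart_at (cbase z) in grad (f \o cot_param i) (cot_chart i z).

Definition ham_field (f : cotangent -> R) (z : cotangent) : 'rV[R]_(n + n) :=
  symplectic_dual (cot_diff f z).

Definition poisson (f g : cotangent -> R) (z : cotangent) : R :=
  omega (ham_field f z) (ham_field g z).

(* Continuous norms on the fibers of T*M; when M is compact any two of them are
   equivalent, so that uniform superlinearity does not depend on the choice. *)
Definition fiber_norm (N : cotangent -> R) : Prop :=
  [/\ cot_Ck 0 N,
      forall x p, p != 0 -> 0 < N (Cot x p),
      forall x a p, N (Cot x (a *: p)) = `|a| * N (Cot x p) &
      forall x p q, N (Cot x (p + q)) <= N (Cot x p) + N (Cot x q)].

Definition uniformly_superlinear (H : cotangent -> R) : Prop :=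
  exists2 N, fiber_norm N & forall A, exists B, forall z, A * N z - B <= H z.

Definition tonelli (H : cotangent -> R) : Prop :=
  [/\ cot_Ck 2 H,
      forall x p w, w != 0 ->
        0 < 'D_w (fun q => 'D_w (fun q' => H (Cot x q')) q) p &
      uniformly_superlinear H].

Definition integral_of_motion (H F : cotangent -> R) : Prop :=
  forall z, poisson H F z = 0.

Definition independent_functions (k : nat) (F : 'I_k -> cotangent -> R) : Prop :=
  forall z, row_free (\matrix_(i < k) cot_diff (F i) z).

Definition lagrangian (H : cotangent -> R) (z : tangent) : R :=
  sup [set dotv p (tvec z) - H (Cot (tbase z) p) | p in [set: 'rV[R]_n]].

Definition legendre (H : cotangent -> R) (z : tangent) : cotangent :=
  Cot (tbase z) (grad (fun v => lagrangian H (Tan (tbase z) v)) (tvec z)).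

(* Solutions t |-> (x(t), x'(t)) of d/dt (dL/dv) = dL/dx, in every chart. *)
Definition euler_lagrange (L : tangent -> R) (g : R -> tangent) : Prop :=
  continuous (fun t : R => tbase (g t) : M) /\
  forall i (t : R), dom i (tbase (g t)) ->
    let y := fun s : R => tan_chart i (g s) in
    let dL := grad (L \o tan_param i) in
    is_derive t (1 : R) (fun s => lsubmx (y s)) (rsubmx (y t)) /\
    is_derive t (1 : R) (fun s => rsubmx (dL (y s))) (lsubmx (dL (y t))).

Definition euler_lagrange_flow (L : tangent -> R) (Phi : R -> tangent -> tangent) :=
  forall z, Phi 0 z = z /\ euler_lagrange L (Phi ^~ z).

Definition flow_invariant (L : tangent -> R) (mu : probability borelTM R) : Prop :=
  exists2 Phi, euler_lagrange_flow L Phi &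
    forall t (A : set borelTM), measurable A -> mu (Phi t @^-1` A) = mu A.

Definition msupport (mu : probability borelTM R) : set tangent :=
  [set z | forall U, tan_open U -> U z -> (0 < mu U)%E].

(* A 1-form is a family of covectors, [eta x] being an element of [T*_x M];
   [form_loc eta i] lists its components in the chart [i]. *)
Definition form_loc (eta : M -> 'rV[R]_n) (i : chart_ix M) (q : 'rV[R]_n) : 'rV[R]_n :=
  rsubmx (cot_chart i (Cot (psi i q) (eta (psi i q)))).

Definition closed_form (eta : M -> 'rV[R]_n) : Prop :=
  forall i, is_smooth (cod i) (form_loc eta i) /\
    forall q, cod i q -> forall u v,
      dotv ('D_u (form_loc eta i) q) v = dotv ('D_v (form_loc eta i) q) u.

Definition exact_form (eta : M -> 'rV[R]_n) : Prop :=
  exists2 f, smooth_fun f & forall x,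
    eta x = grad (f \o psi (chart_at x)) (phi (chart_at x) x).

Definition cohomology_class (eta : M -> 'rV[R]_n) : set (M -> 'rV[R]_n) :=
  [set eta' | closed_form eta' /\ exact_form (fun x => eta' x - eta x)].

Record deRham_H1 := DeRhamH1 {
  H1_class : set (M -> 'rV[R]_n);
  H1_classP : exists2 eta, closed_form eta & H1_class = cohomology_class eta }.

Definition action (L : tangent -> R) (eta : M -> 'rV[R]_n)
    (mu : probability borelTM R) : \bar R :=
  (\int[mu]_z (L z - dotv (eta (tbase z)) (tvec z))%:E)%E.

Definition action_minimizing (L : tangent -> R) (eta : M -> 'rV[R]_n) :
    set (probability borelTM R) :=
  [set mu | flow_invariant L mu /\
    forall nu, flow_invariant L nu -> (action L eta mu <= action L eta nu)%E].

(* The Mather set of the cohomology class of [eta]. *)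
Definition mather_set (H : cotangent -> R) (eta : M -> 'rV[R]_n) : set cotangent :=
  legendre H @` \bigcup_(mu in action_minimizing (lagrangian H) eta) msupport mu.

(* Vectors tangent at [z] to C^1 curves contained in [A], in the coordinates of
   the chart of T*M induced by [chart_at (cbase z)]. *)
Definition generalized_tangent (A : set cotangent) (z : cotangent) :
    set 'rV[R]_(n + n) :=
  let i := chart_at (cbase z) in
  [set w | exists (g : R -> cotangent) (e : R),
    [/\ 0 < e, g 0 = z,
        forall t, `|t| < e -> A (g t) /\ dom i (cbase (g t)),
        is_Ck 1 [set t : R | `|t| < e] (cot_chart i \o g) &
        'D_(1 : R) (cot_chart i \o g) (0 : R) = w]].

End manifold.

(* Main.v *)
(* Let F be an integral of motion.  Its Hamiltonian flow preserves H, hence the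
   compact sublevels of H, where it exists for uniformly short times, and it
   commutes with the flow of H.  Conjugating it by the Legendre transform on
   {H o leg < h}, and extending it by the identity, gives Borel maps Theta_s of TM
   which carry Euler-Lagrange flows to Euler-Lagrange flows; so if mu is an
   invariant probability, then so is its image nu under Theta_s.

   Both have the same action.  Indeed L - <eta, v> = g_H o leg - H o leg, where
   g_G(x, p) = <p - eta(x), dG/dp>, and X_F g_H = X_H g_F because {H, F} = 0 and
   eta is closed.  Hence the derivative in s of the integral of g_H o leg o Theta_s
   is the derivative along the flow of H of an integral of g_F, which vanishes by
   the invariance of mu.

   If mu is minimizing then so is nu: the Mather set contains, for short times, the
   orbits of X_F issued from its points, and X_F(z) is a generalized tangent
   vector at z.  The symplectic duals X_{F_i}(z) of independent differentials are
   independent. *)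

Require Import Defs.
From HB Require Import structures.
From mathcomp Require Import all_boot all_order all_algebra.
From mathcomp Require Import all_classical all_reals all_analysis.
From mathcomp Require Import measurable_realfun ring lra.
Set Implicit Arguments.
Unset Strict Implicit.
Unset Printing Implicit Defensive.
Import Order.TTheory GRing.Theory Num.Theory.
Import numFieldNormedType.Exports.
Local Open Scope classical_set_scope.
Local Open Scope ring_scope.

(** Since [X_F] is only C^1, its flow is handled through Lipschitz estimates alone. Commutation of
    the flows comes from the pointwise identity [D X_H (X_F) = D X_F (X_H)] by a Gronwall estimate.
    The differentiability of the Lagrangian comes from an envelope argument that uses only the
    continuity of the inverse of [p |-> dH/dp]; second derivatives of the Lagrangian never appear.

    Euler-Lagrange flows enter as arbitrary families [Phi] of solutions, with no measurability in
    the initial point. Two facts get around this: the conjugate [Theta_s o Phi_t o Theta_(-s)] is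
    again such a family, hence a legitimate witness for the invariance of the image measure; and on
    a sublevel of [H] the maps [Phi_t] agree for short times with a continuous local flow, which
    replaces them under the integral.

    The action may be infinite. As [Theta_s] moves only points of [{H o leg < h}], where all
    functions involved are bounded, derivatives under the integral sign are taken on this set alone,
    and its complement contributes equally to both actions. *)

(** * Differential calculus in normed spaces *)

Section dot_product.
Context {R : realType}.

Lemma dotvC m (p v : 'rV[R]_m) : dotv p v = dotv v p.
Proof. by apply: eq_bigr => j _; rewrite mulrC. Qed.

Lemma dotvDr m (p u v : 'rV[R]_m) : dotv p (u + v) = dotv p u + dotv p v.
Proof. by rewrite /dotv -big_split; apply: eq_bigr => j _; rewrite mxE mulrDr. Qed.

Lemma dotvZr m a (p v : 'rV[R]_m) : dotv p (a *: v) = a * dotv p v.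
Proof. by rewrite /dotv mulr_sumr; apply: eq_bigr => j _; rewrite mxE mulrCA. Qed.

Lemma dotvNr m (p v : 'rV[R]_m) : dotv p (- v) = - dotv p v.
Proof. by rewrite -scaleN1r dotvZr mulN1r. Qed.

Lemma dotvBr m (p u v : 'rV[R]_m) : dotv p (u - v) = dotv p u - dotv p v.
Proof. by rewrite dotvDr dotvNr. Qed.

Lemma dotvDl m (p u v : 'rV[R]_m) : dotv (u + v) p = dotv u p + dotv v p.
Proof. by rewrite dotvC dotvDr !(dotvC p). Qed.

Lemma dotvZl m a (p v : 'rV[R]_m) : dotv (a *: v) p = a * dotv v p.
Proof. by rewrite dotvC dotvZr (dotvC p). Qed.

Lemma dotvNl m (p v : 'rV[R]_m) : dotv (- v) p = - dotv v p.
Proof. by rewrite dotvC dotvNr dotvC. Qed.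

Lemma dotvBl m (p u v : 'rV[R]_m) : dotv (u - v) p = dotv u p - dotv v p.
Proof. by rewrite dotvDl dotvNl. Qed.

Lemma dotv0 m (p : 'rV[R]_m) : dotv p 0 = 0.
Proof. by rewrite -(scale0r 0) dotvZr mul0r. Qed.

Lemma dot0v m (p : 'rV[R]_m) : dotv 0 p = 0.
Proof. by rewrite dotvC dotv0. Qed.

Lemma dotv_sub m l (u w : 'rV[R]_(m + l)) :
  dotv u w = dotv (lsubmx u) (lsubmx w) + dotv (rsubmx u) (rsubmx w).
Proof.
by rewrite /dotv big_split_ord; congr (_ + _); apply: eq_bigr => j _; rewrite !mxE.
Qed.

Lemma dotv_inj m (p q : 'rV[R]_m) : (forall v, dotv p v = dotv q v) -> p = q.
Proof. by move=> pq; apply/rowP => j; rewrite -!dotv_delta. Qed.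

Lemma coord_le_norm m (x : 'rV[R]_m) j : `|x 0 j| <= `|x|.
Proof. by rewrite [leRHS]mx_normrE; apply: (le_bigmax _ _ (0, j)). Qed.

Lemma norm_le_coord m (x : 'rV[R]_m) C :
  0 <= C -> (forall j, `|x 0 j| <= C) -> `|x| <= C.
Proof.
move=> C0 xC; rewrite [leLHS]mx_normrE; apply: bigmax_le => // -[i j] _ /=.
by rewrite (ord1 i).
Qed.

Lemma dotv_le m (p v : 'rV[R]_m) : `|dotv p v| <= m%:R * (`|p| * `|v|).
Proof.
apply: le_trans (ler_norm_sum _ _ _) _.
apply: (@le_trans _ _ (\sum_(j < m) (`|p| * `|v|))).
  by apply: ler_sum => j _; rewrite normrM ler_pM// coord_le_norm.
by rewrite sumr_const card_ord mulr_natl.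
Qed.

End dot_product.

Section derivative.
Context {R : realType}.
Implicit Types V W : normedModType R.

Lemma deriveDv V W (f : V -> W) x u v :
  differentiable f x -> 'D_(u + v) f x = 'D_u f x + 'D_v f x.
Proof. by move=> df; rewrite !deriveE// linearD. Qed.

Lemma deriveZv V W (f : V -> W) x a v :
  differentiable f x -> 'D_(a *: v) f x = a *: 'D_v f x.
Proof. by move=> df; rewrite !deriveE// linearZ. Qed.

Lemma deriveNv V W (f : V -> W) x v :
  differentiable f x -> 'D_(- v) f x = - 'D_v f x.
Proof. by move=> df; rewrite -scaleN1r deriveZv// scaleN1r. Qed.

Lemma deriveBv V W (f : V -> W) x u v :
  differentiable f x -> 'D_(u - v) f x = 'D_u f x - 'D_v f x.
Proof. by move=> df; rewrite deriveDv// deriveNv. Qed.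

Lemma derive_coordv m W (f : 'rV[R]_m -> W) x v :
  differentiable f x -> 'D_v f x = \sum_j v 0 j *: 'D_(delta_mx 0 j) f x.
Proof.
move=> df; rewrite deriveE// {1}(row_sum_delta v) linear_sum.
by apply: eq_bigr => j _; rewrite linearZ deriveE.
Qed.

(** A directional derivative only sees the restriction to a line, so it can be carried from one
    space to another: from a fiber to the bundle, or to a function of one real variable. *)
Lemma derive_eq_increment V V' W (f : V -> W) (g : V' -> W) a b v w :
  (forall h : R, f (h *: v + a) = g (h *: w + b)) -> 'D_v f a = 'D_w g b.
Proof.
move=> fg; have fg0 : f a = g b by have := fg 0; rewrite !scale0r !add0r.
rewrite /derive (_ : (fun h => h^-1 *: ((f \o shift a) (h *: v) - f a)) =
  (fun h => h^-1 *: ((g \o shift b) (h *: w) - g b)))//.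
by apply/funext => h /=; rewrite fg fg0.
Qed.

Lemma dotv_grad m (f : 'rV[R]_m -> R) x v :
  differentiable f x -> dotv (grad f x) v = 'D_v f x.
Proof.
move=> df; rewrite derive_coordv//; apply: eq_bigr => j _.
by rewrite mxE mulrC.
Qed.

Lemma dotv_pullback m l (f : 'rV[R]_m -> 'rV[R]_l) x p v :
  differentiable f x -> dotv (pullback f x p) v = dotv p ('D_v f x).
Proof.
move=> df; rewrite derive_coordv// /dotv.
under eq_bigr do rewrite mxE mulr_suml.
rewrite exchange_big; apply: eq_bigr => i _ /=.
by rewrite summxE mulr_sumr; apply: eq_bigr => j _; rewrite !mxE; ring.
Qed.

Lemma derive_comp V V' W (f : V -> V') (g : V' -> W) x v :
  differentiable f x -> differentiable g (f x) ->
  'D_v (g \o f) x = 'D_('D_v f x) g (f x).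
Proof.
move=> df dg; rewrite !deriveE//; last exact: differentiable_comp.
by rewrite diff_comp.
Qed.

Lemma differentiable_is_derive V W (f : V -> W) x v :
  differentiable f x -> is_derive x v f ('D_v f x).
Proof. by move=> df; apply/derivableP/diff_derivable. Qed.

Lemma is_derive_comp V W (c : R -> V) (g : V -> W) t dc :
  is_derive t (1 : R) c dc -> differentiable g (c t) ->
  is_derive t (1 : R) (g \o c) ('D_dc g (c t)).
Proof.
move=> [/derivable1_diffP dct cE] dg.
have dgc : differentiable (g \o c) t by exact: differentiable_comp.
by rewrite -cE -derive_comp//; exact: differentiable_is_derive.
Qed.

Lemma is_derive_continuous V (c : R -> V) t dc :
  is_derive t (1 : R) c dc -> {for t, continuous c}.
Proof. by move=> [/derivable1_diffP dct _]; exact: differentiable_continuous. Qed.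

Lemma is_derive_coordP V m n (f : V -> 'M[R]_(m, n)) t v df :
  is_derive t v f df <-> forall i j, is_derive t v (fun x => f x i j) (df i j).
Proof.
split=> [[dft <-] i j|dft].
  by split; [exact: (derivable_mxP _ _ _).1|rewrite derive_mx// mxE].
have dft' : derivable f t v by apply/derivable_mxP => i j; case: (dft i j).
by split=> //; rewrite derive_mx//; apply/matrixP => i j; rewrite mxE; case: (dft i j).
Qed.

Lemma differentiable_mx V m n (f : V -> 'M[R]_(m, n)) x :
  (forall i j, differentiable (fun x => f x i j) x) -> differentiable f x.
Proof.
move=> df.
have -> : f = \sum_i \sum_j (fun x => f x i j *: delta_mx i j).
  apply/funext => y; rewrite fct_sumE [LHS]matrix_sum_delta.
  by apply: eq_bigr => i _; rewrite fct_sumE.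
apply: differentiable_sum => i; apply: differentiable_sum => j.
exact: differentiableZl.
Qed.

Lemma differentiable_coordP V m n (f : V -> 'M[R]_(m, n)) x :
  differentiable f x <-> forall i j, differentiable (fun x => f x i j) x.
Proof.
split=> [df i j|]; last exact: differentiable_mx.
apply: (differentiable_comp (g := fun M : 'M[R]_(m, n) => M i j)) => //.
exact: differentiable_coord.
Qed.

Lemma cvg_rV (T : Type) (F : set_system T) {FF : Filter F} m (f : T -> 'rV[R]_m) (l : 'rV[R]_m) :
  (forall j, (f x 0 j) @[x --> F] --> l 0 j) -> f @ F --> l.
Proof.
move=> fl; apply/cvgrPdist_le => e e0; near=> x.
apply: norm_le_coord => [|j]; first exact: ltW.
rewrite !mxE; move: j; near: x; apply: filter_forall => j.
by move/cvgrPdist_le: (fl j); exact.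
Unshelve. all: by end_near. Qed.

Lemma cvg_dotv (T : Type) (F : set_system T) {FF : Filter F} m
    (f g : T -> 'rV[R]_m) (a b : 'rV[R]_m) :
  f @ F --> a -> g @ F --> b -> dotv (f x) (g x) @[x --> F] --> dotv a b.
Proof.
move=> fa gb; rewrite /dotv.
have coord (h : T -> 'rV[R]_m) (c : 'rV[R]_m) j : h @ F --> c -> (h x 0 j) @[x --> F] --> c 0 j.
  move=> hc; apply: (@cvg_comp _ _ _ h (fun M : 'rV[R]_m => M 0 j) _ _ _ hc).
  exact: coord_continuous.
elim: (index_enum _) => [|j r IH].
  by under eq_fun do rewrite big_nil; rewrite big_nil; exact: cvg_cst.
under eq_fun do rewrite big_cons; rewrite big_cons.
by apply: cvgD => //; apply: cvgM; exact: coord.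
Qed.

End derivative.

Section mean_value.
Context {R : realType}.

(** The norm of row vectors is the maximum norm, so the scalar mean value theorem, applied to each
    coordinate separately, loses no constant. *)
Lemma mean_value_le m (u du : R -> 'rV[R]_m) (a b C : R) : a <= b ->
  (forall t, a <= t <= b -> is_derive t (1 : R) u (du t)) ->
  (forall t, a <= t <= b -> `|du t| <= C) -> `|u b - u a| <= C * (b - a).
Proof.
move=> ab du_ duC.
have C0 : 0 <= C by apply: le_trans (duC a _); rewrite ?lexx.
apply: norm_le_coord => [|j]; first by rewrite mulr_ge0// subr_ge0.
have dj t : a <= t <= b -> is_derive t (1 : R) (fun t => u t 0 j) (du t 0 j).
  by move=> /du_/is_derive_coordP.
have [t tab] : exists2 t, t \in `[a, b]%R & u b 0 j - u a 0 j = du t 0 j * (b - a).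
  apply: (MVT_segment (f := fun t => u t 0 j)) => // [t|].
    by move=> tab; apply: dj; rewrite !ltW ?(itvP tab).
  apply: derivable_within_continuous => t tab.
  by have [] := dj t; rewrite ?(itvP tab).
rewrite !mxE => ->; rewrite normrM (ger0_norm (x := b - a)) ?subr_ge0//.
rewrite ler_wpM2r ?subr_ge0//; apply: le_trans (coord_le_norm _ _) (duC _ _).
by rewrite !(itvP tab).
Qed.

Lemma mean_value_norm m (u du : R -> 'rV[R]_m) (r t C : R) : `|t| <= r ->
  (forall s, `|s| <= r -> is_derive s (1 : R) u (du s)) ->
  (forall s, `|s| <= r -> `|du s| <= C) -> `|u t - u 0| <= C * `|t|.
Proof.
move=> tr du_ duC; have [t0|t0] := leP 0 t.
  rewrite -{2}(subr0 t) ger0_norm ?subr0//; rewrite -{2}(subr0 t).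
  have st s : 0 <= s <= t -> `|s| <= r.
    by move=> /andP[s0 st]; rewrite ger0_norm//; apply: le_trans st (le_trans (ler_norm _) tr).
  by apply: (mean_value_le (du := du)) => // s /st; [exact: du_|exact: duC].
have st s : t <= s <= 0 -> `|s| <= r.
  move=> /andP[st s0]; rewrite ler0_norm//; apply: le_trans tr.
  by rewrite ltr0_norm// lerN2.
rewrite distrC ltr0_norm// -(add0r (- t)).
by apply: (mean_value_le (du := du)) (ltW t0) _ _ => // s /st; [exact: du_|exact: duC].
Qed.

Lemma derive0_constant (f : R -> R) (d t : R) :
  (forall s, `|s| < d -> is_derive s (1 : R) f 0) -> `|t| < d -> f t = f 0.
Proof.
move=> df td.
have := @mean_value_norm 1 (fun s => \row__ f s) (fun _ => 0) `|t| t 0 (lexx _).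
rewrite mul0r => X; apply/subr0_eq/eqP; rewrite -normr_le0.
have -> : f t - f 0 = (\row__ f t - \row__ f 0) 0 (0 : 'I_1) by rewrite !mxE.
apply: le_trans (coord_le_norm _ _) (X _ _).
  move=> s st; apply/is_derive_coordP => i j; rewrite mxE.
  rewrite (_ : (fun _ => _) = f); last by apply/funext => u; rewrite mxE.
  exact/df/(le_lt_trans st).
by move=> s _; rewrite normr0.
Qed.

Lemma half_lt (x : R) : 0 < x -> x / 2 < x.
Proof. by move=> x0; rewrite ltr_pdivrMr// ltr_pMr// ltr1n. Qed.

Lemma near_norm_lt (t e : R) : `|t| < e -> \forall s \near t, `|s| < e.
Proof. by move=> te; exact: (@norm_continuous R R^o t [set r | r < e] (lt_nbhsl te)). Qed.

Lemma is_derive_scale (V : normedModType R) (v : V) (t : R) :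
  is_derive t (1 : R) (fun s => s *: v) v.
Proof.
have dv : differentiable (fun s : R => s *: v) t by exact: differentiableZl.
have {2}-> : v = 'D_1 (fun s : R => s *: v) t; last exact: differentiable_is_derive.
by rewrite deriveE// diffZl// diff_val scale1r.
Qed.

Lemma is_derive_segment (V W : normedModType R) (f : V -> W) a v (t : R) :
  differentiable f (a + t *: v) ->
  is_derive t (1 : R) (fun s => f (a + s *: v)) ('D_v f (a + t *: v)).
Proof.
move=> df; apply: (is_derive_comp (c := fun s => a + s *: v)) => //.
by rewrite -[X in is_derive _ _ _ X](add0r v); apply: is_deriveD; exact: is_derive_scale.
Qed.

(** Mean value inequality for [f] minus an affine map of increment [w]. It yields Lipschitz bounds
    with [w = 0], and uniform differentiability when [w] is the differential at [a]. *)
Lemma derivative_error m l (f : 'rV[R]_m -> 'rV[R]_l) a b w (C : R) :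
  (forall t : R, 0 <= t <= 1 -> differentiable f (a + t *: (b - a))) ->
  (forall t : R, 0 <= t <= 1 -> `|'D_(b - a) f (a + t *: (b - a)) - w| <= C) ->
  `|f b - f a - w| <= C.
Proof.
move=> df fC.
have := @mean_value_le _ (fun s => f (a + s *: (b - a)) - s *: w)
  (fun s => 'D_(b - a) f (a + s *: (b - a)) - w) 0 1 C ler01.
rewrite !scale1r !scale0r addr0 !subr0 mulr1 (subrKC a b).
rewrite [X in `|X|]addrAC; apply=> // t /df dft; apply: is_deriveB; first exact: is_derive_segment.
exact: is_derive_scale.
Qed.

End mean_value.

(** * Uniform constants on compact sets *)

Section compactness.
Context {R : realType}.

Lemma ball_compact m (a : 'rV[R]_m) r : compact [set y | `|y - a| <= r].
Proof.
apply: bounded_closed_compact.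
  exists (`|a| + r); split=> [|M aM y /= yr]; first exact: num_real.
  rewrite -(subrK a y) (le_trans (ler_normD _ _))// addrC (le_trans _ (ltW aM))//.
  by rewrite lerD2l.
rewrite (_ : [set y | _] = closed_ball_ (fun y => `|y|) a r); first exact: closed_closed_ball_.
by apply/funext => y; rewrite /closed_ball_ /= distrC.
Qed.

Lemma ball_convex m (a : 'rV[R]_m) r x y (t : R) :
  `|x - a| <= r -> `|y - a| <= r -> 0 <= t <= 1 -> `|x + t *: (y - x) - a| <= r.
Proof.
move=> xr yr /andP[t0 t1].
have -> : x + t *: (y - x) - a = (1 - t) *: (x - a) + t *: (y - a).
  by apply/matrixP => i j; rewrite !mxE; ring.
rewrite (le_trans (ler_normD _ _))// !normrZ !ger0_norm ?subr_ge0//.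
have -> : r = (1 - t) * r + t * r by ring.
by rewrite lerD// ler_wpM2l// subr_ge0.
Qed.

(** Finitely many of the local constants suffice, and the monotonicity of [P] allows passing to the
    smallest of them. *)
Lemma compact_uniform (T : topologicalType) (K : set T) (P : R -> T -> Prop) :
  compact K -> (forall e e' x, 0 < e -> e <= e' -> P e' x -> P e x) ->
  (forall x, K x -> exists2 e, 0 < e & \forall y \near x, K y -> P e y) ->
  exists2 e, 0 < e & forall x, K x -> P e x.
Proof.
move=> /compact_near_coveringP/near_covering_withinP K_cov Pmono Ploc.
have /K_cov : forall x, K x ->
    \forall y \near x & e \near (0 : R)^'+, K y -> P e y.
  move=> x /Ploc[e e0 xP]; exists ([set y | K y -> P e y], [set e' | 0 < e' <= e]).
    split=> //; have e'0 := nbhs_right_gt (0 : R); have e'e := nbhs_right_le e0.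
    by near=> e'; apply/andP; split; near: e'.
  move=> [y e'] /= [yP /andP[e'0 e'e]] Ky; apply: Pmono e'e _ => //; exact: yP.
move=> KP; near (0 : R)^'+ => e; exists e => //.
by near: e.
Unshelve. all: by end_near. Qed.

(** Heine's theorem in a form where only [x] has to lie in [K]. *)
Lemma compact_modulus m l (K : set 'rV[R]_m) (f : 'rV[R]_m -> 'rV[R]_l) e :
  compact K -> (forall x, K x -> {for x, continuous f}) -> 0 < e ->
  exists2 d, 0 < d & forall x y, K x -> `|x - y| < d -> `|f x - f y| <= e.
Proof.
move=> Kc fK e0.
have [||d d0 fd] := @compact_uniform _ K
    (fun d x => forall y, `|x - y| < d -> `|f x - f y| <= e) Kc.
- by move=> d d' x d0 dd' fd' y xy; apply: fd'; exact: lt_le_trans dd'.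
- move=> x Kx; have e20 : 0 < e / 2 by rewrite divr_gt0.
  have /cvgrPdist_le/(_ _ e20)/nbhs_ballP[r /= r0 xr] := fK x Kx.
  have r20 : 0 < r / 2 by rewrite divr_gt0.
  exists (r / 2) => //; apply/nbhs_ballP; exists (r / 2) => //= y + _ z yz.
  rewrite -ball_normE /= => xy.
  have -> : f y - f z = (f x - f z) - (f x - f y) by rewrite opprB [RHS]addrC addrA subrK.
  rewrite (le_trans (ler_normB _ _))// (splitr e) lerD// xr// -ball_normE/=.
    by rewrite -(subrK y x) -addrA (le_lt_trans (ler_normD _ _))// (splitr r) ltrD.
  by apply: lt_trans xy _; rewrite ltr_pdivrMr// ltr_pMr// ltr1n.
by exists d => // x y Kx; exact: fd.
Qed.

Lemma compact_norm_bounded (T : topologicalType) (W : normedModType R) (K : set T) (f : T -> W) :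
  compact K -> (forall x, K x -> {for x, continuous f}) ->
  exists2 C, 0 < C & forall x, K x -> `|f x| <= C.
Proof.
move=> Kc fK.
(* [compact_uniform] delivers small constants, so the bound is sought as an inverse. *)
have [||d d0 fd] := @compact_uniform _ K (fun d x => `|f x| <= d^-1) Kc.
- move=> d d' x d0 dd' fd'; apply: le_trans fd' _.
  by rewrite lef_pV2 ?posrE//; exact: lt_le_trans dd'.
- move=> x Kx; exists (`|f x| + 1)^-1; first by rewrite invr_gt0 ltr_pwDr.
  have /cvgrPdist_le/(_ _ ltr01) := fK x Kx.
  apply: filterS => y xy _; rewrite invrK -lerBlDl.
  by apply: le_trans xy; rewrite distrC (le_trans _ (lerB_dist _ _))// lexx.
by exists d^-1; rewrite ?invr_gt0.
Qed.

End compactness.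

(** * C^1 maps on a ball: Lipschitz bounds and uniform differentiability *)

Section C1_maps.
Context {R : realType} {m l : nat}.
Variables (U : set 'rV[R]_m) (a : 'rV[R]_m) (r : R) (V : 'rV[R]_m -> 'rV[R]_l).
Hypothesis V_C1 : is_Ck 1 U V.
Hypothesis rU : forall y, `|y - a| <= r -> U y.

Lemma derivative_bound :
  exists2 L, 0 < L & forall y v, `|y - a| <= r -> `|'D_v V y| <= L * `|v|.
Proof.
have [dV cV] := V_C1.
have /choice[C C_] j : exists C, 0 < C /\
    forall y, `|y - a| <= r -> `|'D_(delta_mx 0 j) V y| <= C.
  have [|C C0 C_] := compact_norm_bounded (f := 'D_(delta_mx 0 j) V) (@ball_compact _ _ a r).
    by move=> y /rU; exact: cV.
  by exists C.
(* The summand 1 keeps the constant positive when [m = 0]. *)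
exists (1 + \sum_j C j).
  by rewrite ltr_pwDl// sumr_ge0// => j _; case: (C_ j) => /ltW.
move=> y v yr; rewrite derive_coordv; last exact/dV/rU.
rewrite (le_trans (ler_norm_sum _ _ _))// mulrDl mul1r ler_wpDl// mulr_suml.
apply: ler_sum => j _; rewrite normrZ mulrC ler_pM// ?coord_le_norm//.
by have [_] := C_ j; exact.
Qed.

Lemma C1_lipschitz L : 0 <= L ->
  (forall y v, `|y - a| <= r -> `|'D_v V y| <= L * `|v|) ->
  forall x y, `|x - a| <= r -> `|y - a| <= r -> `|V x - V y| <= L * `|x - y|.
Proof.
move=> L0 VL x y xr yr; rewrite -[_ - V y]subr0.
have tr (t : R) : 0 <= t <= 1 -> `|y + t *: (x - y) - a| <= r by exact: ball_convex.
apply: derivative_error => t t01; first by apply/V_C1.1/rU/tr.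
by rewrite subr0; exact/VL/tr.
Qed.

Lemma derivative_modulus e : 0 < e -> exists2 d, 0 < d &
  forall x y, `|x - a| <= r -> `|y - a| <= r -> `|x - y| < d ->
    `|V y - V x - 'D_(y - x) V x| <= e * `|y - x|.
Proof.
move=> e0; have [dV cV] := V_C1.
(* With [m.+1] the quotient is positive also for [m = 0], and the sum of the [m] coordinate errors
   stays below [e]. *)
have e'0 : 0 < e / m.+1%:R by rewrite divr_gt0.
have /choice[d d_] j : exists d, 0 < d /\ forall x y, `|x - a| <= r -> `|x - y| < d ->
    `|'D_(delta_mx 0 j) V x - 'D_(delta_mx 0 j) V y| <= e / m.+1%:R.
  have [|d d0 d_] := compact_modulus (f := 'D_(delta_mx 0 j) V) (@ball_compact _ _ a r) _ e'0.
    by move=> y /rU; exact: cV.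
  by exists d.
exists (\big[Num.min/1]_j d j).
  by apply/bigmin_gtP; split=> // j _; case: (d_ j).
move=> x y xr yr xy.
have tr (t : R) : 0 <= t <= 1 -> `|x + t *: (y - x) - a| <= r by exact: ball_convex.
apply: derivative_error => t t01; first by apply/dV/rU/tr.
rewrite !derive_coordv; [|exact/dV/rU|exact/dV/rU/tr].
rewrite -sumrB (le_trans (ler_norm_sum _ _ _))//.
apply: (@le_trans _ _ (\sum_(j < m) (e / m.+1%:R * `|y - x|))).
  apply: ler_sum => j _; rewrite -scalerBr normrZ mulrC ler_pM// ?coord_le_norm//.
  rewrite distrC; have [_] := d_ j; apply=> //.
  have /bigmin_gtP[_ /(_ j isT)] := xy; apply: le_lt_trans.
  rewrite opprD addrA subrr add0r normrN normrZ -(distrC y) ler_piMl//.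
  by case/andP: t01 => t0 t1; rewrite ger0_norm.
rewrite sumr_const card_ord -[_ *+ m]mulr_natl mulrA ler_wpM2r// mulrCA.
by rewrite ler_piMr ?(ltW e0)// ler_pdivrMr// mul1r ler_nat.
Qed.

End C1_maps.

Section gronwall.
Context {R : realType}.

(* On intervals so short that [L * d <= 1 / 2], Gronwall's estimate follows from
   the mean value inequality applied at a maximum of [`|u|]. *)
Lemma gronwall_short m (u du : R -> 'rV[R]_m) (d L e t : R) :
  0 <= L -> 0 <= e -> L * d <= 1 / 2 -> `|t| < d ->
  (forall s, `|s| < d -> is_derive s (1 : R) u (du s)) ->
  (forall s, `|s| < d -> `|du s| <= L * `|u s| + e) ->
  `|u t| <= 2 * (`|u 0| + d * e).
Proof.
move=> L0 e0 Ld td u_der du_le.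
have d0 : 0 < d by exact: le_lt_trans td.
have st (s : R) : `|s| <= `|t| -> `|s| < d by move=> /le_lt_trans; exact.
pose A : set R := [set s | `|s| <= `|t|].
have cA : compact A.
  rewrite (_ : A = `[- `|t|, `|t|]%classic); first exact: segment_compact.
  by apply/funext => s; rewrite /A /= in_itv/= ler_norml.
have [s0 s0A s0max] : exists2 s, s \in A & forall s', s' \in A -> `|u s'| <= `|u s|.
  apply: (compact_EVT_max (f := fun s => `|u s|)) => //; first by exists 0; rewrite /A/= normr0.
  apply: continuous_in_subspaceT => s; rewrite inE => /st/u_der/is_derive_continuous.
  by move=> us; apply: cvg_norm.
rewrite inE in s0A.
have S_le : `|u s0 - u 0| <= (L * `|u s0| + e) * `|s0|.
  apply: (mean_value_norm (u := u) (du := du) s0A) => s sA; first exact/u_der/st.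
  rewrite (le_trans (du_le s (st _ sA)))// lerD2r ler_wpM2l// s0max// inE; exact: sA.
have : `|u s0| <= `|u 0| + (L * `|u s0| + e) * d.
  apply: (@le_trans _ _ (`|u s0 - u 0| + `|u 0|)).
    by rewrite -{1}(subrK (u 0) (u s0)) ler_normD.
  rewrite [leLHS]addrC lerD2l.
  apply: le_trans S_le _; rewrite ler_wpM2l//; first by rewrite addr_ge0// mulr_ge0.
  exact/ltW/st.
have : L * d * `|u s0| <= 1 / 2 * `|u s0| by rewrite ler_wpM2r.
have : `|u t| <= `|u s0| by apply: s0max; rewrite inE /A/=.
by move=> *; nra.
Qed.

End gronwall.

Section lipschitz.
Context {R : realType}.

Lemma lipschitz_continuous_at (V W : normedModType R) (f : V -> W) L x :
  (\forall y \near x, `|f x - f y| <= L * `|x - y|) -> {for x, continuous f}.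
Proof.
move=> fL; apply/cvgrPdist_le => e e0.
have L1 : 0 < `|L| + 1 by rewrite ltr_wpDl.
have e'0 : 0 < e / (`|L| + 1) by rewrite divr_gt0.
apply: filterS2 fL (nbhsx_ballx x _ e'0) => y fxy; rewrite -ball_normE/= => xy.
apply: (le_trans fxy); rewrite (@le_trans _ _ ((`|L| + 1) * `|x - y|))//.
  by rewrite ler_wpM2r// (le_trans (ler_norm L))// lerDl.
by rewrite mulrC -ler_pdivlMr// ltW.
Qed.

Lemma lipschitz_continuous (V W : normedModType R) (f : V -> W) L :
  (forall x y, `|f x - f y| <= L * `|x - y|) -> continuous f.
Proof. by move=> fL x; apply: (@lipschitz_continuous_at _ _ _ L); near=> y; exact: fL.
Unshelve. all: by end_near. Qed.

(** Retraction that makes local data global: it extends functions of time beyond [[- d, d]] and,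
    coordinatewise, vector fields beyond a cube. *)
Definition clamp (a b t : R) : R := Num.max a (Num.min b t).

Lemma clamp_lipschitz a b s t : a <= b -> `|clamp a b s - clamp a b t| <= `|s - t|.
Proof.
move=> ab; have := ler_norm (s - t); have := ler_norm (- (s - t)); rewrite normrN.
rewrite ler_norml /clamp /Num.max /Num.min => ? ?.
by do 4 case: ifPn; rewrite -?leNgt => *; apply/andP; split; lra.
Qed.

Lemma clamp_id a b t : a <= t <= b -> clamp a b t = t.
Proof. by move=> /andP[dt td]; rewrite /clamp min_r// max_r. Qed.

Lemma clamp_itv a b t : a <= b -> a <= clamp a b t <= b.
Proof. by move=> ab; rewrite /clamp le_max lexx/= ge_max ge_min lexx/= andbT. Qed.

End lipschitz.

(** * Ordinary differential equations *)

Section picard.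
Context {R : realType}.

Notation mu := (@lebesgue_measure R).

Lemma pow_half_small (K e : R) : 0 < e -> exists k, K / 2 ^+ k <= e.
Proof.
move=> e0; exists (Num.truncn `|K / e|).+1.
rewrite ler_pdivrMr ?exprn_gt0// mulrC -ler_pdivrMr//.
rewrite (le_trans (ler_norm _))// (le_trans (ltW (truncnS_gt _)))//.
by rewrite -natrX ler_nat ltnW// ltn_expl.
Qed.

Lemma le0_pow_half (x K : R) : (forall k, x <= K / 2 ^+ k) -> x <= 0.
Proof.
move=> xK; apply/ler_addgt0Pr => e /(pow_half_small K)[k Ke].
by rewrite add0r (le_trans (xK k)).
Qed.

Variables (m : nat) (d : R).
Hypothesis d0 : 0 < d.

(** The integral from 0 to [t]. The base point [- d - 1] makes every [t] of [[- d, d]] interior to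
    the interval on which the fundamental theorem of calculus is applied. *)
Definition primitive (f : R -> 'rV[R]_m) (t : R) : 'rV[R]_m :=
  \row_j (\int[mu]_(s in `[- d - 1, t]) f s 0 j - \int[mu]_(s in `[- d - 1, 0]) f s 0 j).

Lemma primitive0 f : primitive f 0 = 0.
Proof. by apply/rowP => j; rewrite !mxE subrr. Qed.

Lemma is_derive_primitive f (t : R) :
  continuous f -> `|t| <= d -> is_derive t (1 : R) (primitive f) (f t).
Proof.
move=> cf; rewrite ler_norml => /andP[dt td]; apply/is_derive_coordP => i j.
rewrite (ord1 i) -[X in is_derive _ _ _ X]subr0.
rewrite (_ : (fun _ => _) = (fun t => \int[mu]_(s in `[- d - 1, t]) f s 0 j -
  \int[mu]_(s in `[- d - 1, 0]) f s 0 j)); last by apply/funext => s; rewrite mxE.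
apply: is_deriveB.
have cfj : continuous (fun s => f s 0 j).
  move=> s; apply: (@continuous_comp _ _ _ f (fun M : 'rV[R]_m => M 0 j)); first exact: cf.
  exact: coord_continuous.
have [||||D E] := @continuous_FTC1_closed R (fun s => f s 0 j) (- d - 1) t (d + 1).
- by rewrite ltr_pwDr.
- apply: continuous_compact_integrable; first exact: segment_compact.
  exact: continuous_subspaceT.
- by rewrite ltrBlDr (le_lt_trans dt)// ltrDl.
- exact: cfj.
by apply: DeriveDef; [exact: D|rewrite -E derive1E].
Qed.

Variables (V : 'rV[R]_m -> 'rV[R]_m) (L C : R) (y : 'rV[R]_m).
Hypothesis L0 : 0 <= L.
Hypothesis V_lip : forall x x', `|V x - V x'| <= L * `|x - x'|.
Hypothesis V_le : forall x, `|V x| <= C.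
Hypothesis Ld : L * d <= 1 / 2.

Let clamp t := clamp (- d) d t.

Let Nd_le_d : - d <= d.
Proof. by rewrite ge0_cp// ltW. Qed.

Let clamp_le t : `|clamp t| <= d.
Proof. by rewrite ler_norml; exact: clamp_itv. Qed.

Let clamp_id t : `|t| <= d -> clamp t = t.
Proof. by rewrite ler_norml; exact: clamp_id. Qed.

Let clamp_continuous : continuous clamp.
Proof.
apply: (@lipschitz_continuous _ _ _ _ 1) => s t.
by rewrite mul1r; exact: clamp_lipschitz.
Qed.

(** The Picard operator. Clamping the time makes every iterate continuous and close to [y] on the
    whole line, so that bounds can be stated for all [t]. *)
Let step (g : R -> 'rV[R]_m) (t : R) := y + primitive (V \o g) (clamp t).

Let V_continuous : continuous V.
Proof. exact: lipschitz_continuous V_lip. Qed.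

Let comp_continuous (g : R -> 'rV[R]_m) : continuous g -> continuous (V \o g).
Proof. by move=> cg t; apply: continuous_comp; [exact: cg|exact: V_continuous]. Qed.

Let step_continuous (g : R -> 'rV[R]_m) : continuous g -> continuous (step g).
Proof.
move=> cg t; apply: cvgD; first exact: cvg_cst.
apply: (@continuous_comp _ _ _ clamp (primitive (V \o g))); first exact: clamp_continuous.
have := is_derive_primitive (comp_continuous cg) (clamp_le t).
exact: is_derive_continuous.
Qed.

Let step_bound (g : R -> 'rV[R]_m) t : continuous g -> `|step g t - y| <= C * d.
Proof.
move=> cg; rewrite /step addrAC subrr add0r -[primitive _ _]subr0 -(primitive0 (V \o g)).
have C0 : 0 <= C by exact: le_trans (V_le 0).
apply: le_trans (_ : C * `|clamp t| <= _); last exact: ler_wpM2l.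
apply: (mean_value_norm (du := V \o g) (clamp_le t)) => s sd; last exact: V_le.
by apply: is_derive_primitive => //; exact: comp_continuous.
Qed.

Let step_contract (g h : R -> 'rV[R]_m) K : continuous g -> continuous h ->
  (forall t, `|g t - h t| <= K) -> forall t, `|step g t - step h t| <= K / 2.
Proof.
move=> cg ch ghK t; rewrite /step opprD addrACA subrr add0r.
have K0 : 0 <= K by exact: le_trans (ghK 0).
have -> : primitive (V \o g) (clamp t) - primitive (V \o h) (clamp t) =
   (primitive (V \o g) (clamp t) - primitive (V \o h) (clamp t)) -
   (primitive (V \o g) 0 - primitive (V \o h) 0) by rewrite !primitive0 !subr0.
apply: le_trans (_ : L * K * `|clamp t| <= _).
  apply: (mean_value_norm (u := fun s => primitive (V \o g) s - primitive (V \o h) s)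
    (du := fun s => V (g s) - V (h s)) (clamp_le t)) => s sd.
    apply: is_deriveB; apply: is_derive_primitive => //; exact: comp_continuous.
  by rewrite (le_trans (V_lip _ _))// ler_wpM2l.
apply: (@le_trans _ _ (L * K * d)); first by rewrite ler_wpM2l// mulr_ge0.
have : L * d * K <= 1 / 2 * K by rewrite ler_wpM2r.
lra.
Qed.

Let g_ k := iter k step (cst y).

Let g_continuous k : continuous (g_ k).
Proof. by elim: k => [|k IH]; [exact: cst_continuous|exact: step_continuous]. Qed.

(** All iterates lie within [C * d] of the constant curve [y]; applying [step] once more on both
    sides halves the distance. *)
Let g_cauchy k p t : `|g_ (k + p) t - g_ k t| <= C * d / 2 ^+ k.
Proof.
elim: k t => [t|k IH t].
  rewrite add0n expr0 divr1; case: p => [|p]; last exact: step_bound.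
  rewrite subrr normr0 mulr_ge0 ?(ltW d0)//; exact: le_trans (V_le 0).
rewrite exprSr invfM mulrA; exact: step_contract.
Qed.

Let g_cvg t : cvg (g_ k t @[k --> \oo]).
Proof.
apply: cauchy_cvg; apply/cauchy_exP => e e0.
have e20 : 0 < e / 2 by rewrite divr_gt0.
have [k Ck] := pow_half_small (C * d) e20.
exists (g_ k t); exists k => // p /= kp; rewrite -ball_normE/= distrC -(subnKC kp).
rewrite (le_lt_trans (g_cauchy _ _ _))// (le_lt_trans Ck)//.
exact: half_lt.
Qed.

Let g t := lim (g_ k t @[k --> \oo]).

Let g_dist k t : `|g t - g_ k t| <= C * d / 2 ^+ k.
Proof.
apply/ler_addgt0Pr => e e0; have /cvgrPdist_le/(_ _ e0)[p _ gp] := @g_cvg t.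
have := gp (k + p)%N (leq_addl _ _); rewrite /= -/(g t) => gkp.
rewrite -(subrK (g_ (k + p)%N t) (g t)) -addrA (le_trans (ler_normD _ _))//.
by rewrite [leRHS]addrC lerD.
Qed.

Let g_cont : continuous g.
Proof.
move=> t; apply/cvgrPdist_le => e e0; have e30 : 0 < e / 3 by rewrite divr_gt0.
have [k Ck] := pow_half_small (C * d) e30.
have /cvgrPdist_le/(_ _ e30) := @g_continuous k t; apply: filterS => s gs.
have -> : g t - g s = (g t - g_ k t) + (g_ k t - g_ k s) - (g s - g_ k s).
  by apply/matrixP => i j; rewrite !mxE; ring.
rewrite (le_trans (ler_normB _ _))// (_ : e = e / 3 + e / 3 + e / 3); last by field.
rewrite lerD ?(le_trans (g_dist _ _))// (le_trans (ler_normD _ _))// lerD//.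
exact: le_trans (g_dist _ _) _.
Qed.

Let g_fix t : g t = step g t.
Proof.
apply/subr0_eq/eqP; rewrite -normr_le0; apply: (@le0_pow_half _ (2 * (C * d))) => k.
have := g_dist k.+1 t; have := step_contract (@g_cont) (@g_continuous k) (g_dist k) t.
have Cd0 : 0 <= C * d / 2 ^+ k.
  by rewrite divr_ge0 ?exprn_ge0// mulr_ge0 ?(ltW d0)//; exact: le_trans (V_le 0).
rewrite exprSr invfM -[g_ k.+1 t]/(step (g_ k) t) => s1 s2.
have -> : g t - step g t = (g t - step (g_ k) t) - (step g t - step (g_ k) t).
  by apply/matrixP => i j; rewrite !mxE; ring.
rewrite (le_trans (ler_normB _ _))// (le_trans (lerD s2 s1))//.
by rewrite !mulrA; lra.
Qed.

Lemma ode_solution : exists g : R -> 'rV[R]_m, g 0 = y /\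
  forall t, `|t| < d -> is_derive t (1 : R) g (V (g t)).
Proof.
exists g; split.
  by rewrite g_fix /step clamp_id ?normr0 ?ltW// primitive0 addr0.
move=> t td; have gE : \forall s \near t, y + primitive (V \o g) s = g s.
  have : \forall s \near t, `|s| < d.
    exact: near_norm_lt.
  by apply: filterS => s sd; rewrite [RHS]g_fix /step clamp_id// ltW.
apply: near_eq_is_derive gE _; rewrite -[X in is_derive _ _ _ X]add0r.
by apply: is_deriveD; apply: is_derive_primitive; [exact: comp_continuous|exact: ltW].
Qed.

End picard.

(** * Local flows and commuting vector fields *)

Section local_flow.
Context {R : realType} {m : nat}.

(** Trades the difference quotient for an estimate that makes sense at [h = 0] too; this is the form
    in which Gronwall's inequality delivers derivatives. *)
Lemma is_derive_errorP (V : normedModType R) (g : R -> V) t w :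
  is_derive t (1 : R) g w <->
  forall e, 0 < e -> \forall h \near (0 : R), `|g (h + t) - g t - h *: w| <= e * `|h|.
Proof.
split=> [[/cvg_ex[/= l gl] gw] e e0|gw].
  have lw : l = w by rewrite -gw; apply/esym/cvg_lim.
  rewrite {}lw in gl; move/cvgrPdist_le: gl => /(_ e e0).
  rewrite near_withinE; apply: filterS => h hw.
  have [->|h0] := eqVneq h 0; first by rewrite add0r subrr scale0r subr0 !normr0 mulr0.
  have := hw h0; rewrite scaler1 => whe.
  have -> : g (h + t) - g t - h *: w = - (h *: (w - h^-1 *: (g (h + t) - g t))).
    by rewrite scalerBr scalerA divff// scale1r opprB.
  by rewrite normrN normrZ mulrC ler_wpM2r.
have gl : h^-1 *: (g (h *: (1 : R) + t) - g t) @[h --> 0^'] --> w.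
  apply/cvgrPdist_le => e e0; rewrite near_withinE; apply: filterS (gw e e0) => h hw h0.
  rewrite scaler1 distrC.
  have -> : h^-1 *: (g (h + t) - g t) - w = h^-1 *: (g (h + t) - g t - h *: w).
    by rewrite [RHS]scalerBr scalerA mulVf// scale1r.
  by rewrite normrZ normfV ler_pdivrMl ?normr_gt0// mulrC.
by split; [apply/cvg_ex; exists w|exact/cvg_lim].
Qed.

(** Composing [V] with the coordinatewise retraction [rho] onto the cube of radius [2 r] gives a
    bounded Lipschitz field on the whole space. Its solutions starting within [r] of [a] are still
    in the cube until time [d], so they solve the original equation. The bound [dL.2] is returned
    with the time [dL.1] for later uses of Gronwall's estimate. *)
Lemma local_flow (U : set 'rV[R]_m) (a : 'rV[R]_m) r (V : 'rV[R]_m -> 'rV[R]_m) :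
  is_Ck 1 U V -> 0 < r -> (forall y, `|y - a| <= r *+ 2 -> U y) ->
  exists2 dL : R * R, [/\ 0 < dL.1, 0 <= dL.2, dL.2 * dL.1 <= 1 / 2 &
    forall y v, `|y - a| <= r *+ 2 -> `|'D_v V y| <= dL.2 * `|v|] &
    forall y, `|y - a| < r -> exists g : R -> 'rV[R]_m, g 0 = y /\
      forall t, `|t| < dL.1 -> is_derive t (1 : R) g (V (g t)) /\ `|g t - a| < r *+ 2.
Proof.
move=> V_C1 r0 rU; have r20 : 0 <= r *+ 2 by rewrite mulrn_wge0// ltW.
have [L L0 VL] := derivative_bound V_C1 rU.
have [C C0 VC] : exists2 C, 0 < C & forall y, `|y - a| <= r *+ 2 -> `|V y| <= C.
  apply: compact_norm_bounded; first exact: ball_compact.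
  by move=> y /rU/(V_C1.1)/differentiable_continuous.
pose rho (y : 'rV[R]_m) : 'rV[R]_m :=
  \row_j clamp (a 0 j - r *+ 2) (a 0 j + r *+ 2) (y 0 j).
have le2 j : a 0 j - r *+ 2 <= a 0 j + r *+ 2 by lra.
have rho_ball y : `|rho y - a| <= r *+ 2.
  apply: norm_le_coord => // j; rewrite !mxE ler_norml.
  by have /andP[] := clamp_itv (y 0 j) (le2 j); lra.
have rho_id y : `|y - a| <= r *+ 2 -> rho y = y.
  move=> yr; apply/rowP => j; rewrite mxE clamp_id//.
  have := le_trans (coord_le_norm (y - a) j) yr; rewrite !mxE ler_norml.
  by move=> /andP[]; lra.
have rho_lip y y' : `|rho y - rho y'| <= `|y - y'|.
  apply: norm_le_coord => // j; rewrite !mxE.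
  rewrite (le_trans (clamp_lipschitz _ _ (le2 j)))//.
  by apply: le_trans (coord_le_norm (y - y') j); rewrite !mxE.
(* [r / C] keeps the orbits inside the cube; up to [1 / (2 * L)] the Picard operator contracts and
   [gronwall_short] applies. *)
pose d := Num.min (r / C) (1 / (2 * L)).
have d0 : 0 < d by rewrite lt_min !divr_gt0// mulr_gt0.
have Ld : L * d <= 1 / 2.
  rewrite mulrC -ler_pdivlMr// ge_min; apply/orP; right.
  by rewrite le_eqVlt; apply/orP; left; apply/eqP; field; rewrite gt_eqF.
exists (d, L); first by split=> //; exact: ltW.
move=> y yr /=.
have [||||g [g0 gd]] := @ode_solution _ _ d d0 (V \o rho) L C y.
- exact: ltW.
- move=> x x'; rewrite (le_trans (C1_lipschitz V_C1 rU (ltW L0) VL _ _))//.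
  by rewrite ler_wpM2l// ltW.
- by move=> x; exact: VC.
- exact: Ld.
exists g; split=> // t td.
have gt : `|g t - a| < r *+ 2.
  have gty : `|g t - y| <= C * `|t|.
    rewrite -g0; apply: (mean_value_norm (du := V \o rho \o g) (lexx _)) => s st.
      exact/gd/(le_lt_trans st).
    exact: VC.
  have Cd : C * d <= r by rewrite mulrC -ler_pdivlMr// ge_min lexx.
  rewrite -(subrK y (g t)) -addrA (le_lt_trans (ler_normD _ _))// mulr2n ler_ltD//.
  by rewrite (le_trans gty)// (le_trans _ Cd)// ler_wpM2l ?(ltW C0)// ltW.
by split=> //; have := gd t td; rewrite /= rho_id// ltW.
Qed.

(** Here [sigma t] is the orbit of [Y] issued from [sigma t 0]. Commutation makes [X] along an orbit
    of [Y] a solution of the linearized equation of [Y]. Hence the first order error [sigma (t0 + h)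
    s - sigma t0 s - h X (sigma t0 s)] solves that equation up to [o(h)]; being [o(h)] for [s = 0],
    it is so for all [s] by Gronwall. *)
Lemma commuting_flow (U : set 'rV[R]_m) (a : 'rV[R]_m) r
    (X Y : 'rV[R]_m -> 'rV[R]_m) (L d : R) (sigma : R -> R -> 'rV[R]_m) (t0 : R) :
  (forall y, U y -> differentiable X y) -> is_Ck 1 U Y ->
  (forall y, `|y - a| <= r -> U y) ->
  (forall y, `|y - a| <= r -> 'D_(Y y) X y = 'D_(X y) Y y) ->
  0 <= L -> L * d <= 1 / 2 ->
  (forall y v, `|y - a| <= r -> `|'D_v Y y| <= L * `|v|) ->
  (\forall t \near t0, forall s, `|s| < d ->
     is_derive s (1 : R) (sigma t) (Y (sigma t s)) /\ `|sigma t s - a| <= r) ->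
  is_derive t0 (1 : R) (sigma ^~ 0) (X (sigma t0 0)) ->
  forall s, `|s| < d -> is_derive t0 (1 : R) (sigma ^~ s) (X (sigma t0 s)).
Proof.
move=> dX Y_C1 rU XY L0 Ld YL flow_near init s sd.
have flow0 : forall s, `|s| < d ->
  is_derive s (1 : R) (sigma t0) (Y (sigma t0 s)) /\ `|sigma t0 s - a| <= r.
  exact: nbhs_singleton flow_near.
have d0 : 0 < d by exact: le_lt_trans sd.
(* A Lipschitz constant at [t0] of the initial points; the 1 absorbs the first order error. *)
pose K := `|X (sigma t0 0)| + 1.
have K0 : 0 < K by rewrite ltr_wpDl.
apply/is_derive_errorP => e0 e00.
(* Gronwall will give [2 (e |h| + d e (2 K |h|))], which is [e0 |h|] for this [e]. *)
pose e := e0 / (2 + 4 * d * K).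
have c0 : 0 < 2 + 4 * d * K by rewrite addr_gt0// !mulr_gt0.
have e_gt0 : 0 < e by rewrite divr_gt0.
have [eta eta0 Yeta] := derivative_modulus Y_C1 rU e_gt0.
have /is_derive_errorP initP := init.
have near_flow : \forall h \near (0 : R), forall s, `|s| < d ->
    is_derive s (1 : R) (sigma (h + t0)) (Y (sigma (h + t0) s)) /\
    `|sigma (h + t0) s - a| <= r.
  have : (h + t0) @[h --> (0 : R)] --> 0 + t0 by apply: cvgD; [exact: cvg_id|exact: cvg_cst].
  rewrite add0r.
  by move=> /(_ _ flow_near).
have near_eta : \forall h \near (0 : R), 2 * K * `|h| < eta.
  have hK0 : 0 < eta / (2 * K) by rewrite divr_gt0// mulr_gt0.
  have hK : `|0 : R| < eta / (2 * K) by rewrite normr0.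
  by apply: filterS (near_norm_lt hK) => h; rewrite ltr_pdivlMr ?mulr_gt0// mulrC.
near=> h.
have flowh : forall s, `|s| < d ->
    is_derive s (1 : R) (sigma (h + t0)) (Y (sigma (h + t0) s)) /\
    `|sigma (h + t0) s - a| <= r by near: h.
have h_eta : 2 * K * `|h| < eta by near: h.
have h_e : `|sigma (h + t0) 0 - sigma t0 0 - h *: X (sigma t0 0)| <= e * `|h|.
  by near: h; exact: initP.
have h_K : `|sigma (h + t0) 0 - sigma t0 0| <= K * `|h|.
  have h_1 : `|sigma (h + t0) 0 - sigma t0 0 - h *: X (sigma t0 0)| <= 1 * `|h|.
    by near: h; exact: initP.
  rewrite -[_ - sigma t0 0](subrK (h *: X (sigma t0 0))) (le_trans (ler_normD _ _))//.
  by rewrite normrZ /K; lra.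
have dist s' : `|s'| < d -> `|sigma (h + t0) s' - sigma t0 s'| <= 2 * K * `|h|.
  move=> s'd.
  have := @gronwall_short _ _ (fun s => sigma (h + t0) s - sigma t0 s)
    (fun s => Y (sigma (h + t0) s) - Y (sigma t0 s)) d L 0 s' L0 (lexx _) Ld s'd.
  rewrite mulr0 addr0 -mulrA => w; apply: le_trans (w _ _) _.
  - by move=> q qd; apply: is_deriveB; [case: (flowh q qd)|case: (flow0 q qd)].
  - move=> q qd; rewrite addr0; apply: (C1_lipschitz Y_C1 rU L0 YL).
      by case: (flowh q qd).
    by case: (flow0 q qd).
  - by rewrite ler_pM2l.
have := @gronwall_short _ _ (fun s => sigma (h + t0) s - sigma t0 s - h *: X (sigma t0 s))
    (fun s => Y (sigma (h + t0) s) - Y (sigma t0 s) - h *: 'D_(Y (sigma t0 s)) X (sigma t0 s))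
    d L (e * (2 * K * `|h|)) s L0 _ Ld sd.
move=> w; apply: le_trans (w _ _ _) _.
- by rewrite mulr_ge0 ?(ltW e_gt0)// mulr_ge0// mulr_ge0// ltW.
- move=> q qd; have [dq rq] := flow0 q qd.
  apply: is_deriveB; first by apply: is_deriveB => //; case: (flowh q qd).
  apply: is_deriveZ; apply: (is_derive_comp (c := sigma t0)) => //; exact/dX/rU.
- move=> q qd; have [dq rq] := flow0 q qd; have [dh rh] := flowh q qd.
  set b := sigma (h + t0) q; set c := sigma t0 q.
  (* Commutation turns the derivative of [X] along [Y] into that of [Y] along [X], so that the
     linear part acts on the error itself and a Taylor remainder of [Y] is left. *)
  have -> : Y b - Y c - h *: 'D_(Y c) X c =
      'D_(b - c - h *: X c) Y c + (Y b - Y c - 'D_(b - c) Y c).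
    rewrite XY// [in RHS]deriveBv ?deriveZv; try exact/Y_C1.1/rU.
    by rewrite [RHS]addrC addrA subrK.
  rewrite (le_trans (ler_normD _ _))// lerD ?YL//.
  rewrite (le_trans (Yeta _ _ rq rh _))//.
    by rewrite distrC (le_lt_trans (dist q qd)).
  by rewrite ler_wpM2l ?(ltW e_gt0)// dist.
have -> : e0 = e * (2 + 4 * d * K) by rewrite divfK// gt_eqF.
by move: h_e; lra.
Unshelve. all: by end_near. Qed.

End local_flow.

(** * Symmetry of second derivatives *)

Section schwarz.
Context {R : realType}.

(** The mean value theorem twice: along [u] for the difference in the direction [v], then along [v]
    for ['D_u f]. *)
Lemma second_difference (V : normedModType R) (U : set V) (f : V -> R) x u v (h : R) :
  is_Ck 2 U f -> 0 < h ->
  (forall s t : R, 0 <= s <= h -> 0 <= t <= h -> U (x + s *: u + t *: v)) ->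
  exists st : R * R, [/\ 0 <= st.1 <= h, 0 <= st.2 <= h &
    f (x + h *: u + h *: v) - f (x + h *: u) - (f (x + h *: v) - f x) =
    h ^+ 2 * 'D_v ('D_u f) (x + st.1 *: u + st.2 *: v)].
Proof.
move=> [df d2f] h0 hU; have h00 : 0 <= h <= h by rewrite lexx ltW.
have h01 : 0 <= (0 : R) <= h by rewrite lexx ltW.
have U0 s : 0 <= s <= h -> U (x + s *: u).
  by move=> /hU/(_ h01); rewrite scale0r addr0.
have swap s t : x + s *: u + t *: v = x + t *: v + s *: u by rewrite addrAC.
have ders s t : 0 <= s <= h -> 0 <= t <= h -> is_derive s (1 : R)
    (fun s => f (x + s *: u + t *: v)) ('D_u f (x + s *: u + t *: v)).
  move=> sh th; rewrite swap; under eq_fun do rewrite swap.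
  by apply: is_derive_segment; rewrite -swap; exact/df/hU.
pose p s := f (x + s *: u + h *: v) - f (x + s *: u).
have dp s : 0 <= s <= h -> is_derive s (1 : R) p
    ('D_u f (x + s *: u + h *: v) - 'D_u f (x + s *: u)).
  move=> sh; apply: is_deriveB; first exact: ders.
  by have := ders s 0 sh h01; under eq_fun do rewrite scale0r addr0; rewrite scale0r addr0.
have [s sh ps] : exists2 s, s \in `[0, h]%R &
    p h - p 0 = ('D_u f (x + s *: u + h *: v) - 'D_u f (x + s *: u)) * (h - 0).
  apply: MVT_segment (ltW h0) _ _ => [s sh|]; first by apply: dp; rewrite !ltW ?(itvP sh).
  by apply: derivable_within_continuous => s sh; have [] := dp s; rewrite ?(itvP sh).
have {}sh : 0 <= s <= h by rewrite !(itvP sh).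
have dq t : 0 <= t <= h -> is_derive t (1 : R) (fun t => 'D_u f (x + s *: u + t *: v))
    ('D_v ('D_u f) (x + s *: u + t *: v)).
  by move=> th; apply: is_derive_segment; have [d2 _] := d2f u; exact/d2/hU.
have [t th qt] : exists2 t, t \in `[0, h]%R &
    'D_u f (x + s *: u + h *: v) - 'D_u f (x + s *: u + (0 : R) *: v) =
    'D_v ('D_u f) (x + s *: u + t *: v) * (h - 0).
  apply: (MVT_segment (f := fun t => 'D_u f (x + s *: u + t *: v)) (ltW h0)) => [t th|].
    by apply: dq; rewrite !ltW ?(itvP th).
  by apply: derivable_within_continuous => t th; have [] := dq t; rewrite ?(itvP th).
have {}th : 0 <= t <= h by rewrite !(itvP th).
exists (s, t); split=> //=.
move: ps; rewrite /p scale0r !addr0 => ->.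
by rewrite scale0r addr0 in qt; rewrite qt subr0; ring.
Qed.

(** The second difference is symmetric in [u] and [v]. So one mixed derivative at some point near
    [x] equals the other one at another point near [x], and continuity concludes. *)
Lemma schwarz (V : normedModType R) (U : set V) (f : V -> R) x u v :
  open U -> is_Ck 2 U f -> U x -> 'D_u ('D_v f) x = 'D_v ('D_u f) x.
Proof.
move=> oU fC2 Ux; apply/subr0_eq/eqP; rewrite -normr_le0; apply/ler_addgt0Pr => e e0.
have e20 : 0 < e / 2 by rewrite divr_gt0.
have cont w w' : \forall y \near x, `|'D_w' ('D_w f) x - 'D_w' ('D_w f) y| <= e / 2.
  have [_ /(_ w)[_ /(_ w') cw]] := fC2.
  by have /cvgrPdist_le := cw x Ux; exact.
have : \forall y \near x, [/\ U y, `|'D_u ('D_v f) x - 'D_u ('D_v f) y| <= e / 2 &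
    `|'D_v ('D_u f) x - 'D_v ('D_u f) y| <= e / 2].
  by apply: filterS3 (open_nbhs_nbhs (conj oU Ux)) (cont v u) (cont u v) => y; split.
move=> /nbhs_ballP[r /= r0 rP].
(* Small enough for the whole parallelogram of sides [h u] and [h v] to stay in the ball of radius
   [r]. *)
pose h := r / (`|u| + `|v| + 1) / 2.
have uv0 : 0 < `|u| + `|v| + 1 by rewrite ltr_wpDl// addr_ge0.
have h0 : 0 < h by rewrite !divr_gt0.
have hr s t : 0 <= s <= h -> 0 <= t <= h -> ball x r (x + s *: u + t *: v).
  move=> /andP[s0 sh] /andP[t0 th]; rewrite -ball_normE/= -addrA opprD addrA subrr add0r.
  rewrite normrN (le_lt_trans (ler_normD _ _))// !normrZ !ger0_norm//.
  apply: (@le_lt_trans _ _ (h * (`|u| + `|v| + 1))).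
    by rewrite !mulrDr mulr1 ler_wpDr ?(ltW h0)// lerD// ler_wpM2r.
  by rewrite /h mulrAC divfK ?gt_eqF// ltr_pdivrMr// ltr_pMr// ltr1n.
have hU s t sh th := let: And3 Uy _ _ := rP _ (hr s t sh th) in Uy.
have [[s t] /= [sh th E1]] := second_difference fC2 h0 hU.
have hU' s' t' : 0 <= s' <= h -> 0 <= t' <= h -> U (x + s' *: v + t' *: u).
  by move=> sh' th'; rewrite addrAC; exact: hU.
have [[t' s'] /= [th' sh' E2]] := second_difference fC2 h0 hU'.
have E : 'D_v ('D_u f) (x + s *: u + t *: v) = 'D_u ('D_v f) (x + t' *: v + s' *: u).
  apply: (@mulfI _ (h ^+ 2)); first by rewrite expf_neq0// gt_eqF.
  apply: etrans (esym E1) (etrans _ E2).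
  by rewrite (addrAC x (h *: u)) !opprD !opprK addrACA.
have [_ _ v1] := rP _ (hr s t sh th).
have [_ v2 _] := rP _ (hr s' t' sh' th'); rewrite (addrAC x (s' *: u)) in v2.
rewrite E in v1; rewrite add0r.
apply: le_trans (ler_distD ('D_u ('D_v f) (x + t' *: v + s' *: u)) _ _) _.
rewrite (splitr e); apply: lerD; first exact: v2.
rewrite distrC; exact: v1.
Unshelve. all: by end_near. Qed.

End schwarz.

(** * Stability properties of C^k maps *)

Section Ck_closure.
Context {R : realType}.

Lemma near_eq_differentiable (V W : normedModType R) (f g : V -> W) x :
  (\near x, f x = g x) -> differentiable f x -> differentiable g x.
Proof.
move=> fg df.
have [df1 df2] := (diff_locallyP _ _).1 df.
have E : g \o shift x = cst (g x) + 'd f x +o_ (0 : V) id.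
  apply/eqaddoP => e e0; move/eqaddoP: df2 => /(_ e e0).
  have : \forall h \near (0 : V), f (h + x) = g (h + x).
    have : (h + x) @[h --> (0 : V)] --> 0 + x by apply: cvgD; [exact: cvg_id|exact: cvg_cst].
    by rewrite add0r => /(_ _ fg).
  apply: filterS2 => h; rewrite /= !fctE /= => ->.
  by rewrite (nbhs_singleton fg).
apply/diff_locallyP; rewrite (diff_unique df1 E); split=> //.
Qed.

Lemma is_Ck_ext (V W : normedModType R) k (U : set V) (f g : V -> W) :
  open U -> (forall x, U x -> f x = g x) -> is_Ck k U f -> is_Ck k U g.
Proof.
elim: k f g => [|k IH] f g oU fg.
  move=> cf x Ux; rewrite /prop_for /continuous_at -fg//.
  apply: cvg_trans (cf x Ux); apply: near_eq_cvg.
  by apply: filterS (open_nbhs_nbhs (conj oU Ux)) => y /fg.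
have near_fg x : U x -> \near x, f x = g x.
  by move=> Ux; apply: filterS (open_nbhs_nbhs (conj oU Ux)) => y /fg.
move=> [df Df]; split=> [x Ux|v].
  exact: near_eq_differentiable (near_fg x Ux) (df x Ux).
by apply: (IH ('D_v f) _ oU _ (Df v)) => x Ux; exact: near_eq_derive (near_fg x Ux).
Qed.

Lemma is_Ck_differentiable (V W : normedModType R) k (U : set V) (f : V -> W) x :
  is_Ck k.+1 U f -> U x -> differentiable f x.
Proof. by case=> df _; exact: df. Qed.

Lemma is_Ck_continuous (V W : normedModType R) k (U : set V) (f : V -> W) x :
  is_Ck k U f -> U x -> {for x, continuous f}.
Proof.
case: k => [|k] fC Ux; first exact: fC.
exact/differentiable_continuous/(is_Ck_differentiable fC).
Qed.

Lemma is_CkS (V W : normedModType R) k (U : set V) (f : V -> W) :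
  is_Ck k.+1 U f -> is_Ck k U f.
Proof.
elim: k f => [|k IH] f fC; first by move=> x; exact: is_Ck_continuous fC.
by have [df Df] := fC; split=> // v; exact: IH.
Qed.

Lemma is_Ck_coord (V : normedModType R) k m l (U : set V) (f : V -> 'M[R]_(m, l)) i j :
  open U -> is_Ck k U f -> is_Ck k U (fun x => f x i j).
Proof.
move=> oU; elim: k f => [|k IH] f fC.
  move=> x Ux; apply: (@continuous_comp _ _ _ f (fun M : 'M[R]_(m, l) => M i j)).
    exact: fC.
  exact: coord_continuous.
have [df Df] := fC; split=> [x Ux|v].
  by have /differentiable_coordP := df x Ux; exact.
apply: is_Ck_ext (IH _ (Df v)) => // x Ux.
by rewrite derive_mx ?mxE//; exact/diff_derivable/df.
Qed.

Lemma is_Ck_mx (V : normedModType R) k l (U : set V) (f : V -> 'rV[R]_l) :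
  open U -> (forall j, is_Ck k U (fun x => f x 0 j)) -> is_Ck k U f.
Proof.
move=> oU; elim: k f => [|k IH] f fC.
  by move=> x Ux; apply: cvg_rV => j; exact: fC.
have df x : U x -> differentiable f x.
  by move=> Ux; apply/differentiable_mx => i j; rewrite (ord1 i); exact: (fC j).1.
split=> // v; apply: IH => j.
apply: is_Ck_ext ((fC j).2 v) => // x Ux.
by rewrite derive_mx ?mxE//; exact/diff_derivable/df.
Qed.

Lemma is_CkD (V W : normedModType R) k (U : set V) (f g : V -> W) :
  open U -> is_Ck k U f -> is_Ck k U g -> is_Ck k U (fun x => f x + g x).
Proof.
move=> oU; elim: k f g => [|k IH] f g fC gC.
  by move=> x Ux; apply: cvgD; [exact: fC|exact: gC].
have [df Df] := fC; have [dg Dg] := gC; split=> [x Ux|v].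
  by apply: differentiableD; [exact: df|exact: dg].
apply: is_Ck_ext (IH _ _ (Df v) (Dg v)) => // x Ux.
by rewrite deriveD//; apply: diff_derivable; [exact: df|exact: dg].
Qed.

Lemma is_CkM (V : normedModType R) k (U : set V) (f g : V -> R) :
  open U -> is_Ck k U f -> is_Ck k U g -> is_Ck k U (fun x => f x * g x).
Proof.
move=> oU; elim: k f g => [|k IH] f g fC gC.
  by move=> x Ux; apply: cvgM; [exact: fC|exact: gC].
have [df Df] := fC; have [dg Dg] := gC; split=> [x Ux|v].
  by apply: differentiableM; [exact: df|exact: dg].
apply: (@is_Ck_ext _ _ _ _ (fun x => f x * 'D_v g x + 'D_v f x * g x)) => //.
  move=> x Ux; rewrite deriveM; [|exact/diff_derivable/df|exact/diff_derivable/dg].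
  by rewrite [X in _ = _ + X]mulrC.
by apply: is_CkD => //; [exact: IH (is_CkS fC) (Dg v)|exact: IH (Df v) (is_CkS gC)].
Qed.

Lemma is_Ck_cst (V W : normedModType R) k (U : set V) (a : W) :
  is_Ck k U (fun _ : V => a).
Proof.
elim: k a => [|k IH] a; first by move=> x _; exact: cst_continuous.
split=> [x _|v]; first exact: differentiable_cst.
have -> : 'D_v (fun _ : V => a) = fun _ => 0 by apply/funext => x; exact: derive_cst.
exact: IH.
Qed.

Lemma is_Ck_sum (V W : normedModType R) k (U : set V) I (r : seq I) (f : I -> V -> W) :
  open U -> (forall i, is_Ck k U (f i)) -> is_Ck k U (fun x => \sum_(i <- r) f i x).
Proof.
move=> oU fC; elim: r => [|i r IH].
  by under eq_fun do rewrite big_nil; exact: is_Ck_cst.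
by under eq_fun do rewrite big_cons; exact: is_CkD.
Qed.

Lemma is_Ck_dotv (V : normedModType R) k m (U : set V) (f g : V -> 'rV[R]_m) :
  open U -> is_Ck k U f -> is_Ck k U g -> is_Ck k U (fun x => dotv (f x) (g x)).
Proof.
by move=> oU fC gC; apply: is_Ck_sum => // j; apply: is_CkM => //; exact: is_Ck_coord.
Qed.

Lemma is_CkN (V W : normedModType R) k (U : set V) (f : V -> W) :
  open U -> is_Ck k U f -> is_Ck k U (fun x => - f x).
Proof.
move=> oU; elim: k f => [|k IH] f fC; first by move=> x Ux; apply: cvgN; exact: fC.
have [df Df] := fC; split=> [x Ux|v]; first by apply: differentiableN; exact: df.
apply: is_Ck_ext (IH _ (Df v)) => // x Ux.
by rewrite deriveN//; apply: diff_derivable; exact: df.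
Qed.

(** The derivative of [f \o A] along [v] is again a composition with [A], namely of the derivative
    of [f] along [A v], so the induction closes. *)
Lemma is_Ck_lin (V W Z : normedModType R) k (U : set W) (A : {linear V -> W}) (f : W -> Z) :
  continuous A -> open U -> is_Ck k U f -> is_Ck k (A @^-1` U) (f \o A).
Proof.
move=> cA oU; have oAU : open (A @^-1` U) by apply: open_comp => // x _; exact: cA.
elim: k f => [|k IH] f fC.
  by move=> x Ux; apply: continuous_comp; [exact: cA|exact: fC].
have [df Df] := fC; have dA x : differentiable A x by exact: linear_differentiable.
split=> [x Ux|v]; first by apply: differentiable_comp => //; exact: df.
apply: is_Ck_ext (IH _ (Df (A v))) => // x Ux.
have DA : 'D_v A x = A v by rewrite deriveE// diff_lin.
by rewrite derive_comp ?DA//; exact: df.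
Qed.

Lemma schwarz_rV m l (U : set 'rV[R]_m) (f : 'rV[R]_m -> 'rV[R]_l) x u v :
  open U -> is_Ck 2 U f -> U x -> 'D_u ('D_v f) x = 'D_v ('D_u f) x.
Proof.
move=> oU fC Ux; apply/rowP => j.
have [df Df] := fC; have D w y : U y -> 'D_w f y 0 j = 'D_w (fun y => f y 0 j) y.
  by move=> Uy; rewrite derive_mx ?mxE//; exact/diff_derivable/df.
have D2 w w' : 'D_w' ('D_w f) x 0 j = 'D_w' ('D_w (fun y => f y 0 j)) x.
  have [dw _] := Df w; rewrite derive_mx ?mxE; last exact/diff_derivable/dw.
  apply: near_eq_derive.
  by apply: filterS (open_nbhs_nbhs (conj oU Ux)) => y; exact: D.
apply: etrans (D2 v u) (etrans _ (esym (D2 u v))).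
by apply: (schwarz u v oU) Ux; exact: is_Ck_coord.
Qed.

End Ck_closure.

(** * The topologies of the tangent and cotangent bundles *)

Section atlas_topology.
Context {V : topologicalType} {B I : Type}.
Variables (bdom : I -> set B) (bcod : I -> set V).
Variables (chart : I -> B -> V) (param : I -> V -> B).

(** The topology making all parametrizations continuous on their domains, stated abstractly because
    both bundles carry it; [tan_open] is an instance. *)
Definition atlas_open : set (set B) :=
  [set U | forall i, open (bcod i `&` param i @^-1` U)].

Hypothesis bcod_open : forall i, open (bcod i).
Hypothesis chartK : forall i z, bdom i z -> bcod i (chart i z) /\ param i (chart i z) = z.
Hypothesis transition : forall i j y, bcod i y -> bdom j (param i y) ->
  {for y, continuous (chart j \o param i)} /\ \forall y' \near y, bdom j (param i y').

Lemma atlas_openT : atlas_open setT.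
Proof. by move=> i; rewrite preimage_setT setIT. Qed.

Lemma atlas_openI : setI_closed atlas_open.
Proof.
move=> U W oU oW i.
rewrite (_ : _ `&` _ = (bcod i `&` param i @^-1` U) `&` (bcod i `&` param i @^-1` W)).
  exact: openI.
by rewrite setIACA setIid.
Qed.

Lemma atlas_open_bigU (J : Type) (f : J -> set B) :
  (forall j, atlas_open (f j)) -> atlas_open (\bigcup_j f j).
Proof.
move=> of_ i; rewrite preimage_bigcup setI_bigcupr.
by apply: bigcup_open => j _; exact: of_.
Qed.

Lemma atlas_open_patch i (W : set V) :
  open W -> W `<=` bcod i -> atlas_open [set z | bdom i z /\ W (chart i z)].
Proof.
move=> oW Wi j; rewrite openE => y [yj [yi Wy]].
have [cont near_i] := transition yj yi.
have nW : \forall y' \near y, W (chart i (param j y')).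
  by apply: cont; exact: open_nbhs_nbhs.
by apply: filterS3 (open_nbhs_nbhs (conj (bcod_open j) yj)) near_i nW => y'; split.
Qed.

(** A single chart decides which sets are neighborhoods of [z]: open sets of the chart are open in
    the space, since the transitions are continuous. *)
Lemma atlas_nbhs i z (A : set B) : bdom i z ->
  (exists U, [/\ atlas_open U, U z & U `<=` A]) <-> nbhs (chart i z) (param i @^-1` A).
Proof.
move=> zi; have [czi czK] := chartK zi; split.
  move=> [U [oU Uz UA]].
  have : nbhs (chart i z) (bcod i `&` param i @^-1` U).
    by apply: open_nbhs_nbhs; split; [exact: oU|split=> //; rewrite /= czK].
  by apply: filterS => y [_ /UA].
rewrite nbhsE => -[W [oW Wz] WA].
exists [set z | bdom i z /\ (W `&` bcod i) (chart i z)]; split.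
- by apply: atlas_open_patch; [exact: openI|move=> y []].
- by [].
- by move=> z' [/chartK[_ z'K] [/WA]]; rewrite /= z'K.
Qed.

End atlas_topology.

(** * Transition maps and the induced charts of the two bundles *)

Section transitions.
Context {R : realType} {n : nat} (M : smoothManifold R n).
Implicit Types (i j k : chart_ix M) (q v p : 'rV[R]_n) (x : M).

Lemma phi_cod i x : dom i x -> cod i (phi i x).
Proof. by exists x. Qed.

Lemma psi_dom i q : cod i q -> dom i (psi i q).
Proof. by move=> [x xi <-]; rewrite phiK. Qed.

Lemma psiK i q : cod i q -> phi i (psi i q) = q.
Proof. by move=> [x xi <-]; rewrite phiK. Qed.

Definition overlap i j : set 'rV[R]_n := cod i `&` psi i @^-1` dom j.

Lemma overlap_imageE i j : phi i @` (dom i `&` dom j) = overlap i j.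
Proof.
apply/seteqP; split=> [_ [x [xi xj] <-]|q [qi qj]].
  by split; [exact: phi_cod|rewrite /= phiK].
by exists (psi i q); [split=> //; exact: psi_dom|rewrite psiK].
Qed.

Lemma overlap_near i j q : overlap i j q -> \forall q' \near q, overlap i j q'.
Proof.
move=> [qi qj].
have near_j : \forall q' \near q, dom j (psi i q').
  exact: (@psi_continuous _ _ M i q qi (dom j) (open_nbhs_nbhs (conj (dom_open j) qj))).
have near_i : nbhs q (cod i) by apply: open_nbhs_nbhs; split=> //; exact: cod_open.
exact: filterI near_i near_j.
Qed.

Lemma overlap_open i j : open (overlap i j).
Proof. by rewrite openE => q; exact: overlap_near. Qed.

Lemma overlapxx i q : cod i q -> overlap i i q.
Proof. by move=> qi; split=> //; exact: psi_dom. Qed.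

Lemma trans_smooth i j : is_smooth (overlap i j) (trans i j).
Proof. by rewrite -overlap_imageE; exact: transition_smooth. Qed.

Lemma trans_differentiable i j q : overlap i j q -> differentiable (trans i j) q.
Proof. exact/is_Ck_differentiable/(trans_smooth i j 1). Qed.

Lemma trans_cod i j q : overlap i j q -> cod j (trans i j q).
Proof. by move=> [_ qj]; exact: phi_cod. Qed.

Lemma psi_trans i j q : overlap i j q -> psi j (trans i j q) = psi i q.
Proof. by move=> [_ qj]; rewrite /trans/= phiK. Qed.

Lemma trans_overlap i j k q : overlap i j q -> overlap i k q -> overlap j k (trans i j q).
Proof.
by move=> qij [_ qk]; split; [exact: trans_cod|rewrite /= psi_trans].
Qed.

Lemma transK i j k q : overlap i j q -> trans j k (trans i j q) = trans i k q.
Proof. by move=> qij; rewrite /trans /= -/(trans i j q) psi_trans. Qed.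

Lemma trans_id i q : cod i q -> trans i i q = q.
Proof. exact: psiK. Qed.

Lemma derive_trans_id i q v : cod i q -> 'D_v (trans i i) q = v.
Proof.
move=> qi; rewrite (near_eq_derive (g := id)) ?derive_id//.
by apply: filterS (overlap_near (overlapxx qi)) => q' [/trans_id].
Qed.

Lemma derive_transK i j k q v : overlap i j q -> overlap i k q ->
  'D_('D_v (trans i j) q) (trans j k) (trans i j q) = 'D_v (trans i k) q.
Proof.
move=> qij qik; rewrite -derive_comp; [|exact: trans_differentiable|].
  apply: near_eq_derive; apply: filterS (overlap_near qij) => q' q'ij.
  by rewrite /= -/(trans j k (trans i j q')) transK.
exact/trans_differentiable/trans_overlap.
Qed.

Lemma pullback_transK i j k q p : overlap i j q -> overlap i k q ->
  pullback (trans i j) q (pullback (trans j k) (trans i j q) p) =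
  pullback (trans i k) q p.
Proof.
move=> qij qik; apply: dotv_inj => v.
apply: etrans (dotv_pullback _ v (trans_differentiable qij)) _.
apply: etrans (dotv_pullback _ _ (trans_differentiable (trans_overlap qij qik))) _.
by rewrite derive_transK//; apply/esym/dotv_pullback/trans_differentiable.
Qed.

Lemma pullback_trans_id i q p : cod i q -> pullback (trans i i) q p = p.
Proof.
move=> qi; apply: dotv_inj => v; rewrite dotv_pullback ?derive_trans_id//.
exact/trans_differentiable/overlapxx.
Qed.

Lemma overlap_phi i j x : dom i x -> dom j x -> overlap i j (phi i x).
Proof. by move=> xi xj; split; [exact: phi_cod|rewrite /= phiK]. Qed.

Lemma trans_phi i j x : dom i x -> trans i j (phi i x) = phi j x.
Proof. by move=> xi; rewrite /trans/= phiK. Qed.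

Lemma derive_trans_phi i j k x v : dom i x -> dom j x -> dom k x ->
  'D_('D_v (trans i j) (phi i x)) (trans j k) (phi j x) = 'D_v (trans i k) (phi i x).
Proof.
move=> xi xj xk; have := derive_transK v (overlap_phi xi xj) (overlap_phi xi xk).
by rewrite (trans_phi j xi).
Qed.

Lemma pullback_trans_phi i j k x p : dom i x -> dom j x -> dom k x ->
  pullback (trans i j) (phi i x) (pullback (trans j k) (phi j x) p) =
  pullback (trans i k) (phi i x) p.
Proof.
move=> xi xj xk; have := pullback_transK p (overlap_phi xi xj) (overlap_phi xi xk).
by rewrite (trans_phi j xi).
Qed.

Lemma tan_chart_param i j y : overlap i j (lsubmx y) ->
  tan_chart j (tan_param i y) =
  row_mx (trans i j (lsubmx y)) ('D_(rsubmx y) (trans i j) (lsubmx y)).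
Proof.
move=> [yi yj]; rewrite /tan_chart /tan_param; congr row_mx.
have := derive_trans_phi (rsubmx y) (psi_dom yi) (chart_at_dom (psi i (lsubmx y))) yj.
by rewrite (psiK yi).
Qed.

Lemma cot_chart_param i j y : overlap i j (lsubmx y) ->
  cot_chart j (cot_param i y) =
  row_mx (trans i j (lsubmx y))
    (pullback (trans j i) (trans i j (lsubmx y)) (rsubmx y)).
Proof.
move=> [yi yj]; rewrite /cot_chart /cot_param; congr row_mx.
exact: (pullback_trans_phi (rsubmx y) yj (chart_at_dom (psi i (lsubmx y))) (psi_dom yi)).
Qed.

Lemma bundle_cod_open i : open (bundle_cod (M := M) i).
Proof.
have -> : bundle_cod i = lsubmx @^-1` cod i by [].
apply: open_comp; last exact: cod_open.
by move=> y _; exact/differentiable_continuous/differentiable_lsubmx.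
Qed.

Lemma bundle_cod_near i y : bundle_cod (M := M) i y -> \forall y' \near y, bundle_cod (M := M) i y'.
Proof. by move=> yi; exact: open_nbhs_nbhs (conj (@bundle_cod_open i) yi). Qed.

Lemma cot_paramK i y : bundle_cod i y ->
  dom i (cbase (cot_param i y)) /\ cot_chart i (cot_param i y) = y.
Proof.
move=> yi; split; first exact: psi_dom.
rewrite cot_chart_param; last exact: overlapxx.
by rewrite trans_id// pullback_trans_id// hsubmxK.
Qed.

Lemma cot_chartK i (z : cotangent M) : dom i (cbase z) ->
  bundle_cod i (cot_chart i z) /\ cot_param i (cot_chart i z) = z.
Proof.
case: z => x p /= xi; split; first by rewrite /bundle_cod/= row_mxKl; exact: phi_cod.
rewrite /cot_chart /cot_param /= row_mxKl row_mxKr phiK//; congr Cot.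
rewrite (pullback_trans_phi _ (chart_at_dom x) xi (chart_at_dom x)).
by rewrite pullback_trans_id//; exact/phi_cod/chart_at_dom.
Qed.

Lemma tan_paramK i y : bundle_cod i y ->
  dom i (tbase (tan_param i y)) /\ tan_chart i (tan_param i y) = y.
Proof.
move=> yi; split; first exact: psi_dom.
rewrite tan_chart_param; last exact: overlapxx.
by rewrite trans_id// derive_trans_id// hsubmxK.
Qed.

Lemma tan_chartK i (z : tangent M) : dom i (tbase z) ->
  bundle_cod i (tan_chart i z) /\ tan_param i (tan_chart i z) = z.
Proof.
case: z => x p /= xi; split; first by rewrite /bundle_cod/= row_mxKl; exact: phi_cod.
rewrite /tan_chart /tan_param /= row_mxKl row_mxKr phiK//; congr Tan.
rewrite (derive_trans_phi _ (chart_at_dom x) xi (chart_at_dom x)).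
by rewrite derive_trans_id//; exact/phi_cod/chart_at_dom.
Qed.

End transitions.

Lemma near_eq_continuous (T U : topologicalType) (f g : T -> U) x :
  (\near x, f x = g x) -> {for x, continuous f} -> {for x, continuous g}.
Proof.
rewrite /prop_for /continuous_at => fg cf; rewrite -(nbhs_singleton fg).
by apply: cvg_trans cf; exact: near_eq_cvg.
Qed.

Lemma eq_continuous_at (T U : topologicalType) (f g : T -> U) x :
  f =1 g -> {for x, continuous f} -> {for x, continuous g}.
Proof. by move=> /funext ->. Qed.

Lemma continuous_rV (R : realType) (T : topologicalType) m (f : T -> 'rV[R]_m) x :
  (forall j, {for x, continuous (fun y => f y 0 j)}) -> {for x, continuous f}.
Proof. by move=> fj; apply: cvg_rV => j; exact: fj. Qed.

Lemma continuous_sum (R : realType) (T : topologicalType) (W : normedModType R) m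
    (f : 'I_m -> T -> W) x :
  (forall b, {for x, continuous (f b)}) -> {for x, continuous (fun y => \sum_b f b y)}.
Proof.
move=> cf; rewrite /prop_for /continuous_at.
by apply: (@cvg_big _ _ _ _ _ (@add_continuous W) _ _ _ _ _ _) => b _; exact: cf.
Qed.

Lemma continuous_dotv (R : realType) (T : topologicalType) m (f g : T -> 'rV[R]_m) x :
  {for x, continuous f} -> {for x, continuous g} ->
  {for x, continuous (fun y => dotv (f y) (g y))}.
Proof. by move=> cf cg; exact: cvg_dotv. Qed.

Lemma continuous_coord (R : realType) (T : topologicalType) m (f : T -> 'rV[R]_m) x j :
  {for x, continuous f} -> {for x, continuous (fun y => f y 0 j)}.
Proof.
move=> cf; apply: (@continuous_comp _ _ _ f (fun q : 'rV[R]_m => q 0 j)) => //.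
exact: coord_continuous.
Qed.

Lemma continuous_row_mx (R : realType) (T : topologicalType) m l (f : T -> 'rV[R]_m)
    (g : T -> 'rV[R]_l) x :
  {for x, continuous f} -> {for x, continuous g} ->
  {for x, continuous (fun y => row_mx (f y) (g y))}.
Proof.
move=> cf cg; apply: continuous_rV => j; case: (split_ordP j) => k ->.
  apply: eq_continuous_at (continuous_coord (j := k) cf) => y.
  by rewrite row_mxEl.
apply: eq_continuous_at (continuous_coord (j := k) cg) => y.
by rewrite row_mxEr.
Qed.

Section row_derivative.
Context {R : realType}.

Lemma derive_lsubmx m l (y w : 'rV[R]_(m + l)) : 'D_w lsubmx y = lsubmx w.
Proof.
rewrite deriveE; last exact: differentiable_lsubmx.
rewrite diff_lin//; move=> x; exact/differentiable_continuous/differentiable_lsubmx.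
Qed.

Lemma derive_rsubmx m l (y w : 'rV[R]_(m + l)) : 'D_w rsubmx y = rsubmx w.
Proof.
rewrite deriveE; last exact: differentiable_rsubmx.
rewrite diff_lin//; move=> x; exact/differentiable_continuous/differentiable_rsubmx.
Qed.

Lemma differentiable_row_mx (V : normedModType R) m l (f : V -> 'rV[R]_m)
    (g : V -> 'rV[R]_l) x :
  differentiable f x -> differentiable g x -> differentiable (fun y => row_mx (f y) (g y)) x.
Proof.
move=> /differentiable_coordP df /differentiable_coordP dg.
apply: differentiable_mx => i j; case: (split_ordP j) => k ->.
  by under eq_fun do rewrite row_mxEl.
by under eq_fun do rewrite row_mxEr.
Qed.

Lemma derive_row_mx (V : normedModType R) m l (f : V -> 'rV[R]_m)
    (g : V -> 'rV[R]_l) x v :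
  differentiable f x -> differentiable g x ->
  'D_v (fun y => row_mx (f y) (g y)) x = row_mx ('D_v f x) ('D_v g x).
Proof.
move=> df dg; have dfg := differentiable_row_mx df dg.
rewrite derive_mx; last exact: diff_derivable.
apply/rowP => j; rewrite mxE; case: (split_ordP j) => k ->.
  rewrite row_mxEl derive_mx ?mxE; last exact: diff_derivable.
  by under eq_fun do rewrite row_mxEl.
rewrite row_mxEr derive_mx ?mxE; last exact: diff_derivable.
by under eq_fun do rewrite row_mxEr.
Qed.

Lemma is_derive_row_mx (V : normedModType R) m l (f : V -> 'rV[R]_m)
    (g : V -> 'rV[R]_l) t v df dg :
  is_derive t v f df -> is_derive t v g dg ->
  is_derive t v (fun y => row_mx (f y) (g y)) (row_mx df dg).
Proof.
move=> /is_derive_coordP f_ /is_derive_coordP g_; apply/is_derive_coordP => i j.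
case: (split_ordP j) => k ->.
  by rewrite row_mxEl; under eq_fun do rewrite row_mxEl.
by rewrite row_mxEr; under eq_fun do rewrite row_mxEr.
Qed.

Lemma differentiable_dotv (V : normedModType R) m (f g : V -> 'rV[R]_m) x :
  differentiable f x -> differentiable g x -> differentiable (fun y => dotv (f y) (g y)) x.
Proof.
move=> /differentiable_coordP df /differentiable_coordP dg.
rewrite (_ : (fun _ => _) = \sum_j (fun y => f y 0 j * g y 0 j)).
  by apply: differentiable_sum => j; exact: differentiableM.
by apply/funext => y; rewrite fct_sumE.
Qed.

Lemma derive_dotv (V : normedModType R) m (f g : V -> 'rV[R]_m) x v :
  differentiable f x -> differentiable g x ->
  'D_v (fun y => dotv (f y) (g y)) x = dotv ('D_v f x) (g x) + dotv (f x) ('D_v g x).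
Proof.
move=> df dg.
have /differentiable_coordP dfc := df; have /differentiable_coordP dgc := dg.
rewrite (_ : (fun _ => _) = \sum_j (fun y => f y 0 j * g y 0 j)); last first.
  by apply/funext => y; rewrite fct_sumE.
rewrite derive_sum; last first.
  by move=> j; apply: diff_derivable; exact: differentiableM.
rewrite /dotv -big_split; apply: eq_bigr => j _ /=.
rewrite deriveM; [|exact: diff_derivable|exact: diff_derivable].
rewrite !derive_mx ?mxE; [|exact: diff_derivable|exact: diff_derivable].
by rewrite addrC; congr (_ + _); exact: mulrC.
Qed.

End row_derivative.

#[local] Opaque derive trans.

Section cotangent_topology.
Context {R : realType} {n : nat} (M : smoothManifold R n).
Implicit Types (i j k : chart_ix M) (q v p : 'rV[R]_n) (x : M).

Definition cot_trans i j (y : 'rV[R]_(n + n)) : 'rV[R]_(n + n) :=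
  row_mx (trans i j (lsubmx y)) (pullback (trans j i) (trans i j (lsubmx y)) (rsubmx y)).

Definition tan_trans i j (y : 'rV[R]_(n + n)) : 'rV[R]_(n + n) :=
  row_mx (trans i j (lsubmx y)) ('D_(rsubmx y) (trans i j) (lsubmx y)).

Lemma bundle_overlap_open i j : open (lsubmx @^-1` overlap i j : set 'rV[R]_(n + n)).
Proof.
apply: open_comp; last exact: overlap_open.
by move=> y _; exact/differentiable_continuous/differentiable_lsubmx.
Qed.

Lemma overlap_sym i j q : overlap i j q -> overlap j i (trans i j q).
Proof. by move=> qij; apply: trans_overlap => //; case: qij => qi _; exact: overlapxx. Qed.

Lemma differentiable_trans_lsubmx i j y : overlap i j (lsubmx y) ->
  differentiable (fun y : 'rV[R]_(n + n) => trans i j (lsubmx y)) y.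
Proof.
move=> yij; apply: (differentiable_comp (f := lsubmx) (g := trans i j)).
  exact: differentiable_lsubmx.
exact: trans_differentiable.
Qed.

Lemma derive_trans_lsubmx i j y w : overlap i j (lsubmx y) ->
  'D_w (fun y : 'rV[R]_(n + n) => trans i j (lsubmx y)) y =
  'D_(lsubmx w) (trans i j) (lsubmx y).
Proof.
move=> yij; apply: etrans (derive_comp (f := lsubmx) (g := trans i j) w _ _) _.
- exact: differentiable_lsubmx.
- exact: trans_differentiable.
- by rewrite derive_lsubmx.
Qed.

(** The fiber coordinate of a lifted transition is the covector composed with the differential of
    the inverse transition. Its derivative along the base therefore contains a second derivative,
    the term that must cancel in [ham_cov]. *)
Lemma differentiable_pullback_trans i j y : overlap i j (lsubmx y) ->
  differentiable (fun y : 'rV[R]_(n + n) =>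
    pullback (trans j i) (trans i j (lsubmx y)) (rsubmx y)) y /\
  forall w, 'D_w (fun y : 'rV[R]_(n + n) =>
    pullback (trans j i) (trans i j (lsubmx y)) (rsubmx y)) y =
    \row_b (dotv (rsubmx w) ('D_(delta_mx 0 b) (trans j i) (trans i j (lsubmx y))) +
      dotv (rsubmx y) ('D_('D_(lsubmx w) (trans i j) (lsubmx y))
        ('D_(delta_mx 0 b) (trans j i)) (trans i j (lsubmx y)))).
Proof.
move=> yij.
pose h b (y : 'rV[R]_(n + n)) := 'D_(delta_mx 0 b) (trans j i) (trans i j (lsubmx y)).
have [_ s2] := trans_smooth (M := M) j i 2.
have dh b : differentiable (h b) y.
  apply: (differentiable_comp (f := fun y : 'rV[R]_(n + n) => trans i j (lsubmx y))
    (g := 'D_(delta_mx 0 b) (trans j i))).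
    exact: differentiable_trans_lsubmx.
  by have [d2 _] := s2 (delta_mx 0 b); exact/d2/overlap_sym.
have dP : differentiable (fun y : 'rV[R]_(n + n) =>
    pullback (trans j i) (trans i j (lsubmx y)) (rsubmx y)) y.
  apply: differentiable_mx => a b; rewrite (ord1 a).
  under eq_fun do rewrite mxE; apply: differentiable_dotv (dh b).
  exact: differentiable_rsubmx.
have Dh b w : 'D_w (h b) y = 'D_('D_(lsubmx w) (trans i j) (lsubmx y))
    ('D_(delta_mx 0 b) (trans j i)) (trans i j (lsubmx y)).
  rewrite -(derive_trans_lsubmx w yij).
  apply: (derive_comp (f := fun y : 'rV[R]_(n + n) => trans i j (lsubmx y))
    (g := 'D_(delta_mx 0 b) (trans j i))).
    exact: differentiable_trans_lsubmx.
  by have [d2 _] := s2 (delta_mx 0 b); exact/d2/overlap_sym.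
split=> [//|w]; have dPw : derivable _ y w := diff_derivable dP; rewrite (derive_mx dPw).
apply/rowP => b; rewrite !mxE.
under eq_fun do rewrite mxE.
apply: etrans (derive_dotv w (differentiable_rsubmx y) (dh b)) _.
by rewrite derive_rsubmx Dh.
Qed.

Lemma cot_trans_differentiable i j y : overlap i j (lsubmx y) ->
  differentiable (cot_trans i j) y.
Proof.
move=> yij; apply: differentiable_row_mx; first exact: differentiable_trans_lsubmx.
by have [] := differentiable_pullback_trans yij.
Qed.

Lemma near_cot_trans i j y : overlap i j (lsubmx y) ->
  \forall y' \near y, overlap i j (lsubmx y') /\ cot_trans i j y' = cot_chart j (cot_param i y').
Proof.
move=> yij; apply: filterS (open_nbhs_nbhs (conj (@bundle_overlap_open i j) yij)) => y' y'ij.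
by split; [exact: y'ij|exact/esym/cot_chart_param].
Qed.

Lemma cot_transition i j y : bundle_cod i y -> dom j (cbase (cot_param i y)) ->
  {for y, continuous (cot_chart j \o cot_param i)} /\
  \forall y' \near y, dom j (cbase (cot_param i y')).
Proof.
move=> yi yj; have yij : overlap i j (lsubmx y) by [].
split; last by apply: filterS (near_cot_trans yij) => y' [[]].
apply: near_eq_continuous (differentiable_continuous (cot_trans_differentiable yij)).
by apply: filterS (near_cot_trans yij) => y' [].
Qed.

Lemma tan_transition i j y : bundle_cod i y -> dom j (tbase (tan_param i y)) ->
  {for y, continuous (tan_chart j \o tan_param i)} /\
  \forall y' \near y, dom j (tbase (tan_param i y')).
Proof.
move=> yi yj; have yij : overlap i j (lsubmx y) by [].
have nij := open_nbhs_nbhs (conj (@bundle_overlap_open i j) yij).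
split; last by apply: filterS nij => y' [].
have [_ s2] := trans_smooth (M := M) i j 2.
have dT : {for y, continuous (tan_trans i j)}.
  apply: continuous_row_mx; first exact/differentiable_continuous/differentiable_trans_lsubmx.
  (* The direction [rsubmx y] varies with [y]; expanding it in the basis leaves derivatives in fixed
     directions, which are continuous. *)
  apply: (@near_eq_continuous _ _ (fun y : 'rV[R]_(n + n) =>
      \sum_b rsubmx y 0 b *: 'D_(delta_mx 0 b) (trans i j) (lsubmx y))).
    by apply: filterS nij => y' y'ij; apply/esym/derive_coordv; exact: trans_differentiable.
  apply: (@continuous_sum _ _ _ _ (fun b (y : 'rV[R]_(n + n)) =>
    rsubmx y 0 b *: 'D_(delta_mx 0 b) (trans i j) (lsubmx y))) => b.
  apply: continuousZ.
    by apply: continuous_coord; exact/differentiable_continuous/differentiable_rsubmx.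
  apply: (@continuous_comp _ _ _ lsubmx ('D_(delta_mx 0 b) (trans i j))).
    exact/differentiable_continuous/differentiable_lsubmx.
  by have [d2 _] := s2 (delta_mx 0 b); exact/differentiable_continuous/d2.
apply: near_eq_continuous dT.
by apply: filterS nij => y' y'ij; exact/esym/tan_chart_param.
Qed.

End cotangent_topology.

Section charted_space.
Context {V B : topologicalType} {I : Type}.
Variables (bdom : I -> set B) (bcod : I -> set V).
Variables (chart : I -> B -> V) (param : I -> V -> B).
Hypothesis bcod_open : forall i, open (bcod i).
Hypothesis chartK : forall i z, bdom i z -> bcod i (chart i z) /\ param i (chart i z) = z.
Hypothesis paramK : forall i y, bcod i y -> bdom i (param i y) /\ chart i (param i y) = y.
Hypothesis nbhsP : forall i z (A : set B),
  bdom i z -> nbhs z A <-> nbhs (chart i z) (param i @^-1` A).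

Lemma charted_dom_near i z : bdom i z -> \forall z' \near z, bdom i z'.
Proof.
move=> zi; apply/(nbhsP _ zi); have [ci _] := chartK zi.
by apply: filterS (open_nbhs_nbhs (conj (bcod_open i) ci)) => y /paramK[].
Qed.

Lemma charted_chart_continuous i z : bdom i z -> {for z, continuous (chart i)}.
Proof.
move=> zi W Wz; apply/(nbhsP _ zi); have [ci _] := chartK zi.
by apply: filterS2 Wz (open_nbhs_nbhs (conj (bcod_open i) ci)) => y Wy /paramK[_] /= ->.
Qed.

Lemma charted_param_continuous i y : bcod i y -> {for y, continuous (param i)}.
Proof.
by move=> yi W; have [pi cK] := paramK yi; move=> /(nbhsP _ pi); rewrite cK.
Qed.

Lemma charted_continuous_at (U : topologicalType) (f : B -> U) i z :
  bdom i z -> {for chart i z, continuous (f \o param i)} -> {for z, continuous f}.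
Proof.
move=> zi cf W Wz; apply/(nbhsP _ zi); apply: cf.
by have [_ zK] := chartK zi; rewrite /= zK.
Qed.

End charted_space.

HB.instance Definition _ (R : realType) (n : nat) (M : smoothManifold R n) :=
  gen_eqMixin (cotangent M).
HB.instance Definition _ (R : realType) (n : nat) (M : smoothManifold R n) :=
  gen_choiceMixin (cotangent M).

HB.instance Definition _ (R : realType) (n : nat) (M : smoothManifold R n) :=
  isOpenTopological.Build (cotangent M)
    (@atlas_openT _ _ _ (@bundle_cod R n M) (@cot_param R n M) (@bundle_cod_open R n M))
    (@atlas_openI _ _ _ (@bundle_cod R n M) (@cot_param R n M))
    (@atlas_open_bigU _ _ _ (@bundle_cod R n M) (@cot_param R n M)).

HB.instance Definition _ (R : realType) (n : nat) (M : smoothManifold R n) :=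
  isOpenTopological.Build (tangent M)
    (@atlas_openT _ _ _ (@bundle_cod R n M) (@tan_param R n M) (@bundle_cod_open R n M))
    (@atlas_openI _ _ _ (@bundle_cod R n M) (@tan_param R n M))
    (@atlas_open_bigU _ _ _ (@bundle_cod R n M) (@tan_param R n M)).

Section bundle_topology.
Context {R : realType} {n : nat} (M : smoothManifold R n).
Implicit Types (i j k : chart_ix M) (y : 'rV[R]_(n + n)).

Definition cot_dom i : set (cotangent M) := [set z | dom i (cbase z)].
Definition tan_dom i : set (tangent M) := [set z | dom i (tbase z)].

Lemma cot_nbhsP i (z : cotangent M) (A : set (cotangent M)) : cot_dom i z ->
  nbhs z A <-> nbhs (cot_chart i z) (cot_param i @^-1` A).
Proof.
move=> zi; rewrite -(atlas_nbhs (bdom := cot_dom) (@bundle_cod_open _ _ M) (@cot_chartK _ _ M)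
  (@cot_transition _ _ M) A zi).
by [].
Qed.

Lemma tan_nbhsP i (z : tangent M) (A : set (tangent M)) : tan_dom i z ->
  nbhs z A <-> nbhs (tan_chart i z) (tan_param i @^-1` A).
Proof.
move=> zi; rewrite -(atlas_nbhs (bdom := tan_dom) (@bundle_cod_open _ _ M) (@tan_chartK _ _ M)
  (@tan_transition _ _ M) A zi).
by [].
Qed.

Definition cot_dom_near := charted_dom_near (@bundle_cod_open _ _ M) (@cot_chartK _ _ M)
  (@cot_paramK _ _ M) cot_nbhsP.
Definition cot_chart_continuous := charted_chart_continuous (@bundle_cod_open _ _ M)
  (@cot_chartK _ _ M) (@cot_paramK _ _ M) cot_nbhsP.
Definition cot_param_continuous :=
  charted_param_continuous (bdom := cot_dom) (@cot_paramK _ _ M) cot_nbhsP.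
Definition tan_param_continuous :=
  charted_param_continuous (bdom := tan_dom) (@tan_paramK _ _ M) tan_nbhsP.
Definition cot_continuous_at (U : topologicalType) (f : cotangent M -> U) :=
  charted_continuous_at (bdom := cot_dom) (@cot_chartK _ _ M) cot_nbhsP (f := f).
Definition tan_continuous_at (U : topologicalType) (f : tangent M -> U) :=
  charted_continuous_at (bdom := tan_dom) (@tan_chartK _ _ M) tan_nbhsP (f := f).

Lemma tan_openP (U : set (tangent M)) : tan_open U <-> open U.
Proof.
split=> oU; first by rewrite openE => z Uz; exists U; split.
move=> i; rewrite openE => y [yi Uy].
apply: filterI (bundle_cod_near yi) _.
exact: tan_param_continuous yi _ (open_nbhs_nbhs (conj oU Uy)).
Qed.

Lemma cbase_continuous : continuous (@cbase R n M).
Proof.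
move=> z; apply: (cot_continuous_at (chart_at_dom (cbase z))).
have /psi_continuous : cod (chart_at (cbase z)) (lsubmx (cot_chart (chart_at (cbase z)) z)).
  by have [] := cot_chartK (chart_at_dom (cbase z)).
apply: (@continuous_comp _ _ _ lsubmx (psi (chart_at (cbase z)))).
exact/differentiable_continuous/differentiable_lsubmx.
Qed.

End bundle_topology.

(** * Hamiltonian fields *)

Section hamiltonian_field.
Context {R : realType} {n : nat} (M : smoothManifold R n).
Implicit Types (i j k : chart_ix M) (y : 'rV[R]_(n + n)) (G : cotangent M -> R).

Definition ham i G y : 'rV[R]_(n + n) := symplectic_dual (grad (G \o cot_param i) y).

Lemma cot_param_trans i j y : overlap i j (lsubmx y) ->
  cot_param j (cot_trans i j y) = cot_param i y.
Proof.
move=> yij; rewrite /cot_trans -(cot_chart_param yij).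
by have [] : bundle_cod j (cot_chart j (cot_param i y)) /\
    cot_param j (cot_chart j (cot_param i y)) = cot_param i y by apply: cot_chartK; case: yij.
Qed.

Lemma near_cot_param i j y G : overlap i j (lsubmx y) ->
  \near y, ((G \o cot_param j) \o cot_trans i j) y = (G \o cot_param i) y.
Proof.
move=> yij; apply: filterS (near_cot_trans yij) => y' [y'ij _].
by rewrite /comp cot_param_trans.
Qed.

Lemma dotv_row_mx m l (a : 'rV[R]_(m + l)) u r :
  dotv a (row_mx u r) = dotv (lsubmx a) u + dotv (rsubmx a) r.
Proof. by rewrite dotv_sub row_mxKl row_mxKr. Qed.

Lemma derive_cot_trans i j y u r : overlap i j (lsubmx y) ->
  'D_(row_mx u r) (cot_trans i j) y = row_mx ('D_u (trans i j) (lsubmx y))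
    (\row_b (dotv r ('D_(delta_mx 0 b) (trans j i) (trans i j (lsubmx y))) +
      dotv (rsubmx y) ('D_('D_u (trans i j) (lsubmx y))
        ('D_(delta_mx 0 b) (trans j i)) (trans i j (lsubmx y))))).
Proof.
move=> yij; have [dP DP] := differentiable_pullback_trans yij.
have E := derive_row_mx (row_mx u r) (differentiable_trans_lsubmx yij) dP.
have := etrans E (congr2 _ (derive_trans_lsubmx (row_mx u r) yij) (DP (row_mx u r))).
by rewrite row_mxKl row_mxKr; exact.
Qed.

(** The linear algebra of [ham_cov]. [DT] and [DS] are the differentials of a transition and of its
    inverse, [B] is the second derivative of the inverse, and [a] is the pullback of [A] by the
    lift. The fiber component contains [B] twice with opposite signs and exchanged arguments, so
    that symmetry cancels it. *)
Lemma symplectic_dual_lift (a A : 'rV[R]_(n + n)) (p : 'rV[R]_n)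
    (DT DS : 'rV[R]_n -> 'rV[R]_n) (B : 'rV[R]_n -> 'rV[R]_n -> 'rV[R]_n) :
  (forall u r, dotv (lsubmx a) u + dotv (rsubmx a) r = dotv (lsubmx A) (DT u) +
    (dotv r (DS (rsubmx A)) + dotv p (B (DT u) (rsubmx A)))) ->
  (forall v, DT (DS v) = v) -> (forall u v, B u v = B v u) ->
  DT 0 = 0 -> B 0 (rsubmx A) = 0 ->
  row_mx (DT (rsubmx a)) (\row_b (dotv (- lsubmx a) (DS (delta_mx 0 b)) +
    dotv p (B (DT (rsubmx a)) (delta_mx 0 b)))) = symplectic_dual A.
Proof.
move=> aE DTS Bsym DT0 B0.
have arE : rsubmx a = DS (rsubmx A).
  apply: dotv_inj => r; have := aE 0 r.
  by rewrite DT0 B0 !dotv0 add0r addr0 add0r => ->; rewrite dotvC.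
have al u : dotv (lsubmx a) u = dotv (lsubmx A) (DT u) + dotv p (B (DT u) (rsubmx A)).
  by have := aE u 0; rewrite dotv0 dot0v add0r addr0.
rewrite /symplectic_dual arE DTS; congr row_mx; apply/rowP => b; rewrite !mxE.
by rewrite dotvNl al DTS dotv_delta (Bsym (rsubmx A)) opprD -addrA addNr addr0 mxE.
Qed.

(* The cotangent lift of a transition map is symplectic: this reduces to the symmetry
   of the second derivative of the inverse transition. *)
Lemma ham_cov i j y G : overlap i j (lsubmx y) ->
  differentiable (G \o cot_param j) (cot_trans i j y) ->
  'D_(ham i G y) (cot_trans i j) y = ham j G (cot_trans i j y).
Proof.
move=> yij dG; set T := cot_trans i j.
set q := lsubmx y; set p := rsubmx y; set q' := trans i j q.
set A := grad (G \o cot_param j) (T y); set a := grad (G \o cot_param i) y.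
set tau := trans i j; set sigma := trans j i.
have [ds Ds] := trans_smooth (M := M) j i 2.
have q'ji : overlap j i q' := overlap_sym yij.
have dsigma := ds _ q'ji.
have dT := cot_trans_differentiable yij.
have dtau := trans_differentiable yij.
have dGi : differentiable (G \o cot_param i) y.
  by apply: near_eq_differentiable (near_cot_param G yij) _; exact: differentiable_comp.
have aE w : dotv a w = dotv A ('D_w T y).
  apply: etrans (dotv_grad w dGi) _.
  apply: etrans (near_eq_derive w (filterS (fun y => @esym _ _ _) (near_cot_param G yij))) _.
  apply: etrans (derive_comp w dT dG) _.
  exact/esym/dotv_grad.
have tausigma v : 'D_('D_v sigma q') tau q = v.
  have qq : q = trans j i q' by rewrite (transK i yij) trans_id//; case: yij.
  have q'jj : overlap j j q' by case: q'ji => ? _; exact: overlapxx.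
  rewrite [X in 'D_ _ _ X]qq; apply: etrans (derive_transK v q'ji q'jj) _.
  by apply: derive_trans_id; case: q'ji.
pose B u v := 'D_u ('D_v sigma) q'.
have dsig2 v : differentiable ('D_v sigma) q' by have [d2 _] := Ds v; exact: d2.
(* Linearity of [B] in its second argument has to be known near [q'], since that expression is
   differentiated once more. *)
have Bsum u b : B u b = \sum_c b 0 c *: B u (delta_mx 0 c).
  have near_sum : \near q', 'D_b sigma q' = (\sum_c (b 0 c \*: 'D_(delta_mx 0 c) sigma)) q'.
    apply: filterS (overlap_near q'ji) => x xji; rewrite fct_sumE.
    by apply: derive_coordv; exact: trans_differentiable.
  apply: etrans (near_eq_derive u near_sum) _.
  have dc c : derivable (b 0 c \*: 'D_(delta_mx 0 c) sigma) q' u.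
    by apply: derivableZ; apply: diff_derivable; exact: dsig2.
  rewrite (derive_sum dc); apply: eq_bigr => c _.
  by apply: deriveZ; apply: diff_derivable; exact: dsig2.
have Bsym u v : B u v = B v u.
  by apply: (schwarz_rV u v (@overlap_open _ _ M j i) _ q'ji); exact: trans_smooth.
have rowE u r : dotv (rsubmx A) (\row_b (dotv r ('D_(delta_mx 0 b) sigma q') +
      dotv p (B ('D_u tau q) (delta_mx 0 b)))) =
    dotv r ('D_(rsubmx A) sigma q') + dotv p (B ('D_u tau q) (rsubmx A)).
  have dsum (r' : 'rV[R]_n) (f : 'I_n -> 'rV[R]_n) :
      dotv r' (\sum_b rsubmx A 0 b *: f b) = \sum_b rsubmx A 0 b * dotv r' (f b).
    elim: (index_enum _) => [|b s IH]; first by rewrite !big_nil dotv0.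
    by rewrite !big_cons dotvDr dotvZr IH.
  rewrite (Bsum _ (rsubmx A)) dsum (derive_coordv (rsubmx A) dsigma) dsum -big_split.
  by apply: eq_bigr => b _ /=; rewrite mxE mulrDr.
have aE2 u r : dotv (lsubmx a) u + dotv (rsubmx a) r = dotv (lsubmx A) ('D_u tau q) +
    (dotv r ('D_(rsubmx A) sigma q') + dotv p (B ('D_u tau q) (rsubmx A))).
  apply: etrans (esym (dotv_row_mx a u r)) _.
  apply: etrans (aE _) _; apply: etrans (congr1 (dotv A) (derive_cot_trans u r yij)) _.
  apply: etrans (dotv_row_mx _ _ _) _; congr (_ + _); exact: rowE.
apply: etrans (derive_cot_trans (rsubmx a) (- lsubmx a) yij) _.
rewrite /ham -/A.
exact: (symplectic_dual_lift (DT := fun u => 'D_u tau q) (DS := fun v => 'D_v sigma q')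
  aE2 tausigma Bsym (derive0 _ _) (derive0 _ _)).
Qed.

End hamiltonian_field.

Section hamiltonian_curves.
Context {R : realType} {n : nat} (M : smoothManifold R n).
Implicit Types (i j k : chart_ix M) (y : 'rV[R]_(n + n)) (F G H : cotangent M -> R).
Implicit Types (c : R -> cotangent M).

Lemma grad_C1 i G : cot_Ck 2 G -> is_Ck 1 (bundle_cod i) (grad (G \o cot_param i)).
Proof.
move=> GC; have [_ dG] := GC i; apply: is_Ck_mx; first exact: bundle_cod_open.
move=> j; rewrite (_ : (fun _ => _) = 'D_(delta_mx 0 j) (G \o cot_param i)).
  exact: dG.
by apply/funext => y; rewrite mxE.
Qed.

Lemma ham_C1 i G : cot_Ck 2 G -> is_Ck 1 (bundle_cod i) (ham i G).
Proof.
move=> /(grad_C1 i) GC; have oU := @bundle_cod_open _ _ M i.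
apply: is_Ck_mx => // j; case: (split_ordP j) => k ->.
  rewrite (_ : (fun _ => _) = fun y => grad (G \o cot_param i) y 0 (rshift n k)).
    exact: is_Ck_coord.
  by apply/funext => y; rewrite /ham /symplectic_dual row_mxEl mxE.
rewrite (_ : (fun _ => _) = fun y => - grad (G \o cot_param i) y 0 (lshift n k)).
  by apply: is_CkN => //; exact: is_Ck_coord.
by apply/funext => y; rewrite /ham /symplectic_dual row_mxEr !mxE.
Qed.

Lemma ham_differentiable i G y : cot_Ck 2 G -> bundle_cod i y -> differentiable (ham i G) y.
Proof. by move=> GC yi; exact: is_Ck_differentiable (ham_C1 i GC) yi. Qed.

Lemma cot_Ck_differentiable i G l y : cot_Ck l.+1 G -> bundle_cod i y ->
  differentiable (G \o cot_param i) y.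
Proof. by move=> GC yi; exact: is_Ck_differentiable (GC i) yi. Qed.

(** Continuity is part of the definition because a derivative read in a chart is meaningful only if
    the curve stays in its domain near [t]. *)
Definition ham_curve_at G c (t : R) := {for t, continuous c} /\
  forall i, cot_dom i (c t) ->
    is_derive t (1 : R) (cot_chart i \o c) (ham i G (cot_chart i (c t))).

Lemma cot_trans_chart i j (z : cotangent M) : cot_dom i z -> cot_dom j z ->
  overlap i j (lsubmx (cot_chart i z)) /\ cot_trans i j (cot_chart i z) = cot_chart j z.
Proof.
move=> zi zj; have [ci cK] := cot_chartK zi.
have zij : overlap i j (lsubmx (cot_chart i z)).
  by rewrite /cot_chart row_mxKl; exact: overlap_phi.
by split=> [//|]; have := cot_chart_param zij; rewrite cK => ->.
Qed.

(** One chart suffices: [ham_cov] carries the equation to the others, and continuity is recovered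
    through the parametrization. *)
Lemma chart_curve_at G c t i : cot_Ck 2 G ->
  (\forall s \near t, cot_dom i (c s)) ->
  is_derive t (1 : R) (cot_chart i \o c) (ham i G (cot_chart i (c t))) ->
  ham_curve_at G c t.
Proof.
move=> GC near_i dc; have ti := nbhs_singleton near_i.
have [ci cK] := cot_chartK ti.
have cc : {for t, continuous c}.
  apply: (@near_eq_continuous _ _ (cot_param i \o (cot_chart i \o c))).
    by apply: filterS near_i => s /cot_chartK[].
  apply: continuous_comp; first exact: is_derive_continuous dc.
  exact: cot_param_continuous.
split=> [|j tj]; first exact: cc.
have [tij Tj] := cot_trans_chart ti tj.
have near_j : \forall s \near t, cot_dom j (c s) by apply: cc; exact: cot_dom_near.
have E : \near t, (cot_trans i j \o (cot_chart i \o c)) t = (cot_chart j \o c) t.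
  by apply: filterS2 near_i near_j => s si sj; have [] := cot_trans_chart si sj.
have dT := cot_trans_differentiable tij.
have dG : differentiable (G \o cot_param j) (cot_trans i j (cot_chart i (c t))).
  by rewrite Tj; apply: cot_Ck_differentiable GC _; have [] := cot_chartK tj.
have D := is_derive_comp dc dT; rewrite (ham_cov tij dG) Tj in D.
exact: near_eq_is_derive E D.
Qed.

Lemma ham_curve_fun G c t F i : ham_curve_at G c t -> cot_dom i (c t) ->
  differentiable (F \o cot_param i) (cot_chart i (c t)) ->
  is_derive t (1 : R) (F \o c)
    (dotv (grad (F \o cot_param i) (cot_chart i (c t))) (ham i G (cot_chart i (c t)))).
Proof.
move=> [cc hc] ti dF; rewrite (dotv_grad _ dF).
have near_i : \forall s \near t, cot_dom i (c s) by apply: cc; exact: cot_dom_near.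
have E : \near t, ((F \o cot_param i) \o (cot_chart i \o c)) t = (F \o c) t.
  by apply: filterS near_i => s /cot_chartK[_] /= ->.
exact: near_eq_is_derive E (is_derive_comp (hc i ti) dF).
Qed.

Lemma ham_curve_conserved G F c (d t : R) : cot_Ck 1 F ->
  (forall i y, bundle_cod i y -> dotv (grad (F \o cot_param i) y) (ham i G y) = 0) ->
  (forall s, `|s| < d -> ham_curve_at G c s) -> `|t| < d -> F (c t) = F (c 0).
Proof.
move=> FC FG Gc; apply: (derive0_constant (f := F \o c)) => s sd; have sc := Gc s sd.
have si : cot_dom (chart_at (cbase (c s))) (c s) := chart_at_dom _; have [ci _] := cot_chartK si.
rewrite -(FG _ _ ci); exact: ham_curve_fun sc si (cot_Ck_differentiable FC ci).
Qed.

Lemma omega_dual m (a b : 'rV[R]_(m + m)) :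
  omega (symplectic_dual a) (symplectic_dual b) = dotv a (symplectic_dual b).
Proof. by apply/esym; exact: (symplectic_dualP _ _).2. Qed.

Lemma dotv_dualC m (a b : 'rV[R]_(m + m)) :
  dotv a (symplectic_dual b) = - dotv b (symplectic_dual a).
Proof.
rewrite !dotv_sub /symplectic_dual !row_mxKl !row_mxKr !dotvNr opprD opprK.
by rewrite addrC (dotvC (lsubmx a)) (dotvC (rsubmx a)).
Qed.

(** [integral_of_motion] speaks of one chart per point only; covariance of the Hamiltonian field
    extends it to all charts. *)
Lemma poisson_chart H F : cot_Ck 2 H -> cot_Ck 2 F -> integral_of_motion H F ->
  forall i y, bundle_cod i y -> dotv (grad (H \o cot_param i) y) (ham i F y) = 0.
Proof.
move=> HC FC HF i y yi; have [pi cK] := cot_paramK yi.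
set z := cot_param i y; pose k := chart_at (cbase z).
have zk : cot_dom k z := chart_at_dom (cbase z).
have [ziy Tz] := cot_trans_chart pi zk; rewrite cK in ziy Tz.
have [ck _] := cot_chartK zk.
have dH := cot_Ck_differentiable HC ck; have dF := cot_Ck_differentiable FC ck.
have dT := cot_trans_differentiable ziy.
have dHi := cot_Ck_differentiable HC yi.
have /= := HF z; rewrite /poisson /ham_field omega_dual /cot_diff -/k -/(ham k F _) => P0.
apply: etrans (dotv_grad _ dHi) _.
apply: etrans (near_eq_derive _ (filterS (fun y => @esym _ _ _) (near_cot_param H ziy))) _.
rewrite -Tz in dH dF P0.
apply: etrans (derive_comp _ dT dH) _.
rewrite (ham_cov ziy dF); apply: etrans _ P0; exact/esym/dotv_grad.
Qed.

Lemma derive_ham i G y w : cot_Ck 2 G -> bundle_cod i y ->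
  'D_w (ham i G) y = symplectic_dual ('D_w (grad (G \o cot_param i)) y).
Proof.
move=> GC yi; have dg := is_Ck_differentiable (grad_C1 i GC) yi.
have dl : differentiable (fun y => lsubmx (grad (G \o cot_param i) y)) y.
  by apply: differentiable_comp => //; exact: differentiable_lsubmx.
have dr : differentiable (fun y => rsubmx (grad (G \o cot_param i) y)) y.
  by apply: differentiable_comp => //; exact: differentiable_rsubmx.
apply: etrans (derive_row_mx w dr (differentiableN dl)) _; congr row_mx.
  apply: etrans (derive_comp w dg (differentiable_rsubmx _)) _; exact: derive_rsubmx.
apply: etrans (deriveN (diff_derivable dl)) _; congr (- _).
apply: etrans (derive_comp w dg (differentiable_lsubmx _)) _; exact: derive_lsubmx.
Qed.

Lemma hessian_sym i G y u v : cot_Ck 2 G -> bundle_cod i y ->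
  dotv ('D_u (grad (G \o cot_param i)) y) v = dotv ('D_v (grad (G \o cot_param i)) y) u.
Proof.
move=> GC yi; have dg := is_Ck_differentiable (grad_C1 i GC) yi.
have oU := @bundle_cod_open _ _ M i.
have E u' v' : dotv ('D_u' (grad (G \o cot_param i)) y) v' = 'D_u' ('D_v' (G \o cot_param i)) y.
  have D := derive_dotv u' dg (differentiable_cst v' y).
  have D0 : dotv (grad (G \o cot_param i) y) ('D_u' (cst v') y) = 0.
    exact: etrans (congr1 _ (derive_cst _ _ _)) (dotv0 _).
  apply: etrans (etrans (esym (addr0 _)) (etrans (congr1 _ (esym D0)) (esym D))) _.
  apply: near_eq_derive; apply: filterS (bundle_cod_near yi) => y' y'i.
  exact/dotv_grad/(cot_Ck_differentiable GC y'i).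
exact: etrans (E u v) (etrans (schwarz u v oU (GC i) yi) (esym (E v u))).
Qed.

(** Differentiate [{H, F} = 0] along [w]: by symmetry of the Hessians, the result says that the
    derivative of [grad H] along [X_F] is that of [grad F] along [X_H]. Now take symplectic
    duals. *)
Lemma ham_commute i H F y : cot_Ck 2 H -> cot_Ck 2 F -> integral_of_motion H F ->
  bundle_cod i y -> 'D_(ham i F y) (ham i H) y = 'D_(ham i H y) (ham i F) y.
Proof.
move=> HC FC HF yi; have oU := @bundle_cod_open _ _ M i.
apply: etrans (derive_ham _ HC yi) (etrans _ (esym (derive_ham _ FC yi))).
apply: (congr1 symplectic_dual).
have dgH := is_Ck_differentiable (grad_C1 i HC) yi.
have dhF := ham_differentiable FC yi.
apply: dotv_inj => w.
have H1 := hessian_sym (ham i F y) w HC yi.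
have F1 := hessian_sym (ham i H y) w FC yi.
apply: (etrans H1); apply: etrans (esym F1).
have P0 : 'D_w (fun y => dotv (grad (H \o cot_param i) y) (ham i F y)) y = 0.
  apply: etrans (near_eq_derive (g := fun _ => 0) w _) (derive_cst _ _ _).
  apply: filterS (bundle_cod_near yi) => y'; exact: poisson_chart.
have := etrans (esym (derive_dotv w dgH dhF)) P0.
have D := etrans (congr1 (dotv (grad (H \o cot_param i) y)) (derive_ham w FC yi))
  (dotv_dualC _ _).
rewrite D => /eqP; rewrite subr_eq0 => /eqP; exact.
Qed.

End hamiltonian_curves.

(** * The Legendre transform *)

Section fibers.
Context {R : realType} {n : nat} (M : smoothManifold R n).
Implicit Types (i j k : chart_ix M) (q p v w : 'rV[R]_n) (x : M).
Variable H : cotangent M -> R.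
Hypothesis H_C2 : cot_Ck 2 H.
Hypothesis H_convex : forall x p w, w != 0 ->
  0 < 'D_w (fun q => 'D_w (fun q' => H (Cot x q')) q) p.

Definition velocity i (y : 'rV[R]_(n + n)) : 'rV[R]_n := rsubmx (grad (H \o cot_param i) y).

Lemma bundle_cod_row i q p : cod i q -> bundle_cod (M := M) i (row_mx q p).
Proof. by move=> qi; rewrite /bundle_cod/= row_mxKl. Qed.

Lemma derive_vertical (V : normedModType R) (g : 'rV[R]_(n + n) -> V) q p w :
  'D_w (fun p => g (row_mx q p)) p = 'D_(row_mx 0 w) g (row_mx q p).
Proof.
apply: derive_eq_increment => h.
by rewrite scale_row_mx scaler0 add_row_mx add0r.
Qed.

Lemma row_segment q p w (t : R) : row_mx q (p + t *: w) = row_mx q p + t *: row_mx 0 w.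
Proof. by rewrite scale_row_mx scaler0 add_row_mx addr0. Qed.

Lemma is_derive_vertical i q p w (t : R) : cod i q ->
  is_derive t (1 : R) (fun t => H (cot_param i (row_mx q (p + t *: w))))
    (dotv (velocity i (row_mx q (p + t *: w))) w).
Proof.
move=> qi; have yi := bundle_cod_row (p + t *: w) qi.
have dH := cot_Ck_differentiable H_C2 yi.
have -> : dotv (velocity i (row_mx q (p + t *: w))) w =
    'D_(row_mx 0 w) (H \o cot_param i) (row_mx q p + t *: row_mx 0 w).
  rewrite -row_segment; apply: etrans (dotv_grad _ dH).
  by rewrite dotv_row_mx dotv0 add0r.
rewrite row_segment in dH; have D := is_derive_segment dH.
have E : (fun t => H (cot_param i (row_mx q (p + t *: w)))) =
    fun s => (H \o cot_param i) (row_mx q p + s *: row_mx 0 w).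
  by apply/funext => s; rewrite -row_segment.
by rewrite E; exact: D.
Qed.

Lemma cot_param_row i q p : cod i q -> cot_param i (row_mx q p) =
  Cot (psi i q) (pullback (trans (chart_at (psi i q)) i) (phi (chart_at (psi i q)) (psi i q)) p).
Proof. by move=> qi; rewrite /cot_param row_mxKl row_mxKr. Qed.

Lemma pullbackD m l (f : 'rV[R]_m -> 'rV[R]_l) (a : 'rV[R]_m) (p w : 'rV[R]_l) :
  pullback f a (p + w) = pullback f a p + pullback f a w.
Proof. by apply/rowP => b; rewrite !mxE dotvDl. Qed.

Lemma pullbackZ m l (f : 'rV[R]_m -> 'rV[R]_l) (a : 'rV[R]_m) (t : R) (p : 'rV[R]_l) :
  pullback f a (t *: p) = t *: pullback f a p.
Proof. by apply/rowP => b; rewrite !mxE dotvZl. Qed.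

Lemma pullback0 m l (f : 'rV[R]_m -> 'rV[R]_l) (a : 'rV[R]_m) : pullback f a 0 = 0.
Proof. by apply/rowP => b; rewrite !mxE dot0v. Qed.

(** Convexity is assumed in the coordinates of [chart_at x]; positivity of the second derivative
    gives strict monotonicity by the mean value theorem. *)
Lemma fiber_line_lt x p w (s t : R) : w != 0 -> s < t ->
  'D_w (fun q => H (Cot x q)) (p + s *: w) < 'D_w (fun q => H (Cot x q)) (p + t *: w).
Proof.
move=> w0 st; set k := chart_at x; have xk : dom k x := chart_at_dom x.
have ki := phi_cod xk; set q := phi k x.
have HE : (fun p => H (Cot x p)) = fun p => (H \o cot_param k) (row_mx q p).
  apply/funext => p'; rewrite /= (cot_param_row p' ki) phiK//.
  by rewrite pullback_trans_id.
set phi1 := 'D_(row_mx 0 w) (H \o cot_param k).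
have D1 p' : 'D_w (fun p => H (Cot x p)) p' = phi1 (row_mx q p').
  by rewrite HE; exact: derive_vertical.
have D1E : (fun p => 'D_w (fun p => H (Cot x p)) p) = fun p => phi1 (row_mx q p).
  by apply/funext => p'; exact: D1.
have D2 r : 0 < 'D_(row_mx 0 w) phi1 (row_mx q p + r *: row_mx 0 w).
  have := H_convex x (p + r *: w) w0; rewrite D1E.
  by rewrite (derive_vertical phi1) row_segment.
have dphi r : is_derive r (1 : R) (fun r => phi1 (row_mx q p + r *: row_mx 0 w))
    ('D_(row_mx 0 w) phi1 (row_mx q p + r *: row_mx 0 w)).
  apply: is_derive_segment; rewrite -row_segment.
  have d2 : is_Ck 1 (bundle_cod k) phi1 := (H_C2 k).2 (row_mx 0 w).
  exact: is_Ck_differentiable d2 (bundle_cod_row _ ki).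
have [r rst] := MVT (f := fun r => phi1 (row_mx q p + r *: row_mx 0 w)) st
  (fun r _ => dphi r) (derivable_within_continuous (fun r _ => @ex_derive _ _ _ _ _ _ _ (dphi r))).
rewrite !D1 !row_segment -subr_gt0 => ->.
by rewrite mulr_gt0// subr_gt0.
Qed.

(** Changing chart acts on the fiber by the linear isomorphism [P], which preserves lines and
    nonzero directions. *)
Lemma velocity_lt i q p w (s t : R) : cod i q -> w != 0 -> s < t ->
  dotv (velocity i (row_mx q (p + s *: w))) w < dotv (velocity i (row_mx q (p + t *: w))) w.
Proof.
move=> qi w0 st; set x := psi i q; set k := chart_at x.
have xi := psi_dom qi; have xk : dom k x := chart_at_dom x.
pose P := pullback (trans k i) (phi k x).
have Pw0 : P w != 0.
  apply: contra_neq w0 => Pw0.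
  have := pullback_trans_phi w xi xk xi; rewrite -/(P w) Pw0 pullback0.
  by rewrite pullback_trans_id//; exact: phi_cod.
have E r : dotv (velocity i (row_mx q (p + r *: w))) w =
    'D_(P w) (fun q => H (Cot x q)) (P p + r *: P w).
  have [_ <-] := is_derive_vertical p w r qi.
  apply: derive_eq_increment => h.
  by rewrite (cot_param_row _ qi) -/x -/k pullbackD pullbackZ scaler1 scalerDl addrCA.
have := fiber_line_lt x (P p) Pw0 st; rewrite -(E s) -(E t); exact.
Qed.

Let real_ineq (a b c d : R) : 0 < a - (c - d) - b -> c - a < d - b.
Proof. lra. Qed.

(** A critical point of a strictly concave function is its only maximum: on the segment from [p] to
    [p'], the derivative of [f] vanishes at 0 and is positive afterwards. *)
Lemma velocity_max i q p p' v : cod i q -> velocity i (row_mx q p) = v -> p' != p ->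
  dotv p' v - H (cot_param i (row_mx q p')) < dotv p v - H (cot_param i (row_mx q p)).
Proof.
move=> qi pv p'p; set w := p' - p; have w0 : w != 0 by rewrite subr_eq0.
pose f (t : R) := H (cot_param i (row_mx q (p + t *: w))) - t * dotv v w.
have df (t : R) : is_derive t (1 : R) f (dotv (velocity i (row_mx q (p + t *: w))) w - dotv v w).
  apply: is_deriveB; first exact: is_derive_vertical.
  rewrite (_ : (fun _ => _) = fun t : R => t *: dotv v w)//; exact: is_derive_scale.
have [r r01] := MVT ltr01 (fun r _ => df r)
  (derivable_within_continuous (fun r _ => @ex_derive _ _ _ _ _ _ _ (df r))).
have r0 : 0 < r by rewrite (itvP r01).
have := velocity_lt p qi w0 r0; rewrite scale0r addr0 pv -subr_gt0 => lt.
have f1 : f 1 = H (cot_param i (row_mx q p')) - (dotv p' v - dotv p v).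
  by rewrite /f scale1r subrKC mul1r /w dotvBr (dotvC v p') (dotvC v p).
have f0 : f 0 = H (cot_param i (row_mx q p)) by rewrite /f scale0r addr0 mul0r subr0.
rewrite f1 f0 subr0 mulr1 => E; rewrite -{}E in lt.
exact: real_ineq lt.
Qed.

Lemma velocity_inj i q p p' : cod i q ->
  velocity i (row_mx q p) = velocity i (row_mx q p') -> p = p'.
Proof.
move=> qi pp'; apply/eqP; apply: contraPT isT => pp.
have p'p : p' != p by rewrite eq_sym.
have := lt_trans (velocity_max qi pp' p'p) (velocity_max qi erefl pp).
by rewrite ltxx.
Qed.

Lemma vertical_continuous q (U : topologicalType) (f : 'rV[R]_(n + n) -> U) p :
  {for row_mx q p, continuous f} -> {for p, continuous (fun p => f (row_mx q p))}.
Proof.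
move=> cf; apply: (@continuous_comp _ _ _ (row_mx q) f) => //.
by apply: continuous_row_mx; [exact: cst_continuous|exact: cvg_id].
Qed.

Section superlinear.
Variable N : cotangent M -> R.
Hypothesis N_norm : fiber_norm N.
Hypothesis H_superlinear : forall a, exists b, forall z, a * N z - b <= H z.

(** [N] is bounded below on the compact product of [K] and the unit sphere, and homogeneity extends
    the bound to all covectors. *)
Lemma fiber_norm_lower i (K : set 'rV[R]_n) : compact K -> K `<=` cod i ->
  exists2 c, 0 < c & forall q p, K q -> c * `|p| <= N (cot_param i (row_mx q p)).
Proof.
move=> Kc Ki; have [NC N0 NZ _] := N_norm.
pose S : set 'rV[R]_n := [set p | `|p| = 1].
have cS : compact S.
  apply: subclosed_compact (@ball_compact R n 0 1) _; last by move=> p /= p1; rewrite subr0 p1.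
  apply: (@closed_comp _ _ (fun p : 'rV[R]_n => `|p|) [set r | r = 1]).
    by move=> p _; exact: norm_continuous.
  exact: closed_eq.
pose f (z : 'rV[R]_n * 'rV[R]_n) := N (cot_param i (row_mx z.1 z.2)).
have [|||c c0 cf] := @compact_uniform _ _ (K `*` S) (fun e z => e <= f z).
- exact: compact_setX.
- by move=> e e' z e0 ee' e'f; exact: le_trans e'f.
- move=> z [/= qK p1]; have fz0 : 0 < f z.
    rewrite /f (cot_param_row _ (Ki _ qK)); apply: N0.
    apply/eqP => P0; have xi := psi_dom (Ki _ qK).
    have := pullback_trans_phi z.2 xi (chart_at_dom (psi i z.1)) xi; rewrite P0 pullback0.
    rewrite (pullback_trans_id _ (phi_cod xi)) => z20.
    by move: p1; rewrite /S/= -z20 normr0 => /eqP; rewrite eq_sym oner_eq0.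
  have cf : {for z, continuous f}.
    apply: (@continuous_comp _ _ _ (fun z : 'rV[R]_n * 'rV[R]_n => row_mx z.1 z.2)
      (N \o cot_param i)).
      by apply: continuous_row_mx; [exact: cvg_fst|exact: cvg_snd].
    exact/NC/bundle_cod_row/Ki.
  exists (f z / 2); first by rewrite divr_gt0.
  have fz2 := half_lt fz0; have near_z : \forall z' \near z, f z / 2 < f z'.
    exact: (cf [set r | f z / 2 < r] (lt_nbhsr fz2)).
  apply: (@filterS _ _ _ _ _ _ near_z) => z' z'f _; exact: ltW.
exists c => // q p qK; have [->|p0] := eqVneq p 0.
  rewrite normr0 mulr0 (cot_param_row _ (Ki _ qK)) pullback0.
  by have := NZ (psi i q) 0 0; rewrite scale0r normr0 mul0r => ->.
have pn0 : 0 < `|p| by rewrite normr_gt0.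
have := cf (q, `|p|^-1 *: p); rewrite /f /= !(cot_param_row _ (Ki _ qK)) pullbackZ NZ.
rewrite normfV normr_id ler_pdivlMl// mulrC; apply.
by split=> //=; rewrite /S /= normrZ normfV normr_id mulVf ?gt_eqF.
Qed.

(** Superlinearity with slope 1 bounds [N], hence [|p|], on the sublevel. *)
Lemma sublevel_bound i (K : set 'rV[R]_n) h : compact K -> K `<=` cod i ->
  exists C, forall q p, K q -> H (cot_param i (row_mx q p)) <= h -> `|p| <= C.
Proof.
move=> Kc Ki; have [c c0 cN] := fiber_norm_lower Kc Ki.
have [b bH] := H_superlinear 1; exists ((h + b) / c) => q p qK pH.
rewrite ler_pdivlMr// mulrC; apply: le_trans (cN q p qK) _.
have := bH (cot_param i (row_mx q p)); rewrite mul1r lerBlDr => /le_trans; apply.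
by rewrite lerD2r.
Qed.

(** Superlinearity makes [p |-> <p, v> - H] attain its maximum, where the derivative in every
    direction vanishes. *)
Lemma velocity_surj i q v : cod i q -> exists p, velocity i (row_mx q p) = v.
Proof.
move=> qi.
have [|c c0 cN] := @fiber_norm_lower i [set q] (@compact_set1 _ q); first by move=> _ ->.
(* With this slope [H] exceeds the bound [n |v| |p|] on the pairing by a further [|p|], up to the
   constant [b]; whence [f_le]. *)
have [b bH] := H_superlinear ((n%:R * `|v| + 1) / c).
pose f p := dotv p v - H (cot_param i (row_mx q p)).
have f_le p : f p <= b - `|p|.
  have := bH (cot_param i (row_mx q p)).
  have := cN q p erefl; have := dotv_le p v; have := ler_norm (dotv p v).
  rewrite /f; move: (H _) (N _) (dotv _ _) => h m d d1 d2 m1 hm.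
  have : (n%:R * `|v| + 1) / c * (c * `|p|) <= (n%:R * `|v| + 1) / c * m.
    by rewrite ler_wpM2l// divr_ge0 ?ltW// addr_ge0// mulr_ge0.
  rewrite mulrA divfK ?gt_eqF// mulrDl mul1r => m2.
  have d3 : d <= n%:R * `|v| * `|p| by rewrite (le_trans d1)// -mulrA (mulrC `|v|).
  by move: d3 m2 hm; move: (n%:R * `|v| * `|p|) (_ / c * m) => X Y; lra.
(* Beyond this radius [b - |p|] is below [f 0], so the maximum over the ball is global. *)
pose r := `|b - f 0| + 1.
have cfp p : {for p, continuous f}.
  apply: continuousB.
    apply: (@continuous_dotv _ _ _ id (fun _ => v)); first exact: cvg_id.
    exact: cst_continuous.
  apply: (@vertical_continuous q _ (H \o cot_param i)).
  exact/differentiable_continuous/(cot_Ck_differentiable H_C2)/bundle_cod_row.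
have r0 : 0 <= r by rewrite addr_ge0.
have [p pr pmax] : exists2 p, p \in [set p : 'rV[R]_n | `|p - 0| <= r] &
    forall p', p' \in [set p : 'rV[R]_n | `|p - 0| <= r] -> f p' <= f p.
  apply: EVT_max_rV.
  - by exists 0; rewrite /= subr0 normr0.
  - exact: ball_compact.
  - by apply: continuous_in_subspaceT => p' _; exact: cfp.
have fmax p' : f p' <= f p.
  have [p'r|p'r] := leP `|p' - 0| r; first by apply: pmax; rewrite inE.
  apply: le_trans (_ : f 0 <= _); last by apply: pmax; rewrite inE/= subrr normr0.
  have := f_le p'; rewrite subr0 /r in p'r; have := ler_norm (b - f 0).
  by move: p'r; move: (f 0) (f p') => ? ? ? ? ?; lra.
exists p; apply: dotv_inj => w.
pose g (t : R) := f (p + t *: w).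
have dg (t : R) : is_derive t (1 : R) g (dotv w v - dotv (velocity i (row_mx q (p + t *: w))) w).
  apply: is_deriveB; last exact: is_derive_vertical.
  have E : (fun t : R => dotv (p + t *: w) v) = fun t : R => dotv p v + t *: dotv w v.
    by apply/funext => s; rewrite dotvDl dotvZl.
  rewrite E -[X in is_derive _ _ _ X]add0r.
  by apply: is_deriveD; exact: is_derive_scale.
have g0 : is_derive (0 : R) (1 : R) g 0.
  have N11 : - 1 < (1 : R) by lra.
  apply: (@derive1_at_max R g (-1) 1 0 (ltW N11)) => [t _| |t _].
  - by have [] := dg t.
  - by rewrite in_itv/=; apply/andP; split; lra.
  - by rewrite /g scale0r addr0; exact: fmax.
have := etrans (esym (@derive_val _ _ _ _ _ _ _ (dg 0))) (@derive_val _ _ _ _ _ _ _ g0).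
by rewrite scale0r addr0 dotvC => /eqP; rewrite subr_eq0 => /eqP.
Qed.

End superlinear.

Lemma velocity_continuous i (y : 'rV[R]_(n + n)) : bundle_cod i y -> {for y, continuous (velocity i)}.
Proof.
move=> yi; have cg := is_Ck_continuous (grad_C1 i H_C2) yi.
exact: (@continuous_comp _ _ _ (grad (H \o cot_param i)) rsubmx _ cg (@continuous_rsubmx _ _ _ _ _)).
Qed.

(* The monotonicity of the velocity along rays makes positivity on a small sphere
   around [p] propagate to its exterior. *)
Lemma velocity_inverse_continuous i q p e : cod i q -> 0 < e ->
  \forall y \near row_mx q (velocity i (row_mx q p)), forall p',
    cod i (lsubmx y) -> velocity i (row_mx (lsubmx y) p') = rsubmx y -> `|p' - p| <= e.
Proof.
move=> qi e0; set v := velocity i (row_mx q p).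
pose S : set 'rV[R]_n := [set p' | `|p' - p| = e].
have cS : compact S.
  apply: subclosed_compact (@ball_compact R n p e) _; last by move=> p' /= ->.
  apply: (@closed_comp _ _ (fun p' : 'rV[R]_n => `|p' - p|) [set r | r = e]).
    move=> p' _; apply: continuous_comp; last exact: norm_continuous.
    by apply: continuousB; [exact: cvg_id|exact: cst_continuous].
  exact: closed_eq.
pose g (z : 'rV[R]_n * 'rV[R]_(n + n)) :=
  dotv (velocity i (row_mx (lsubmx z.2) z.1) - rsubmx z.2) (z.1 - p).
have /compact_near_coveringP S_cov := cS.
have near_S : \forall y \near row_mx q v, forall p', S p' -> 0 < g (p', y).
  apply: (S_cov _ (nbhs (row_mx q v)) (fun y p' => 0 < g (p', y)) _) => p1 p1S.
  have p1p : p1 - p != 0 by rewrite -normr_gt0 p1S.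
  have g0 : 0 < g (p1, row_mx q v).
    rewrite /g/= row_mxKl row_mxKr dotvBl subr_gt0.
    have := velocity_lt p qi p1p ltr01.
    by rewrite scale0r addr0 scale1r subrKC.
  have cg : {for (p1, row_mx q v), continuous g}.
    have c1 : {for (p1, row_mx q v), continuous (fst : 'rV[R]_n * 'rV[R]_(n + n) -> _)}.
      exact: cvg_fst.
    have c2 : {for (p1, row_mx q v), continuous (snd : 'rV[R]_n * 'rV[R]_(n + n) -> _)}.
      exact: cvg_snd.
    have cl : {for (p1, row_mx q v), continuous (fun z : 'rV[R]_n * 'rV[R]_(n + n) => lsubmx z.2)}.
      apply: (@continuous_comp _ _ _ snd lsubmx); [exact: c2|exact: continuous_lsubmx].
    have cr : {for (p1, row_mx q v), continuous (fun z : 'rV[R]_n * 'rV[R]_(n + n) => rsubmx z.2)}.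
      apply: (@continuous_comp _ _ _ snd rsubmx); [exact: c2|exact: continuous_rsubmx].
    apply: continuous_dotv; last by apply: continuousB; [exact: c1|exact: cst_continuous].
    apply: continuousB; last exact: cr.
    have crow := continuous_row_mx cl c1.
    have cvel : {for row_mx (lsubmx (p1, row_mx q v).2) (p1, row_mx q v).1, continuous (velocity i)}.
      by apply: velocity_continuous; rewrite /= row_mxKl; exact: bundle_cod_row.
    exact: continuous_comp crow cvel.
  exact: (cg [set r | 0 < r] (lt_nbhsr g0)).
apply: filterS near_S => y ySg p' yi p'v; rewrite leNgt; apply/negP => ep'.
have p'p0 : 0 < `|p' - p| by exact: lt_trans ep'.
pose w := `|p' - p|^-1 *: (p' - p).
have nw : `|w| = 1 by rewrite normrZ normfV normr_id mulVf ?gt_eqF.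
have w0 : w != 0 by rewrite -normr_gt0 nw.
have Sw : S (p + e *: w) by rewrite /S/= addrAC subrr add0r normrZ nw mulr1 gtr0_norm.
have := velocity_lt p yi w0 ep'.
have wE : p + `|p' - p| *: w = p' by rewrite scalerA divff ?gt_eqF// scale1r subrKC.
rewrite wE p'v.
have := ySg _ Sw; rewrite /g/= addrAC subrr add0r dotvZr pmulr_rgt0// dotvBl subr_gt0.
by move=> /ltW; rewrite leNgt => /negP.
Qed.

End fibers.

(** * The Lagrangian and its gradient *)

Section envelope.
Context {R : realType}.

Lemma derivative_error_scalar m (f : 'rV[R]_m -> R) a b w (C : R) :
  (forall t : R, 0 <= t <= 1 -> differentiable f (a + t *: (b - a))) ->
  (forall t : R, 0 <= t <= 1 -> `|'D_(b - a) f (a + t *: (b - a)) - w| <= C) ->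
  `|f b - f a - w| <= C.
Proof.
move=> df fC; have dg (t : R) : 0 <= t <= 1 -> is_derive t (1 : R) (fun t => f (a + t *: (b - a)))
    ('D_(b - a) f (a + t *: (b - a))) by move=> /df; exact: is_derive_segment.
have [t t01] : exists2 t, t \in `[0, 1]%R & f (a + (1 : R) *: (b - a)) - f (a + (0 : R) *: (b - a)) =
    'D_(b - a) f (a + t *: (b - a)) * (1 - 0).
  apply: (MVT_segment (f := fun t => f (a + t *: (b - a))) ler01) => [t t01|].
    by apply: dg; rewrite !ltW ?(itvP t01).
  by apply: derivable_within_continuous => t t01; have [] := dg t; rewrite ?(itvP t01).
rewrite scale1r scale0r addr0 subrKC subr0 mulr1 => ->.
by apply: fC; rewrite !(itvP t01).
Qed.

Lemma continuous_distP (T : topologicalType) (W : normedModType R) (f : T -> W) x :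
  (forall e, 0 < e -> \forall y \near x, `|f x - f y| <= e) -> {for x, continuous f}.
Proof. by move=> fx; apply/cvgrPdist_le. Qed.

Context {n : nat} (M : smoothManifold R n).
Implicit Types (i j k : chart_ix M) (q p v w : 'rV[R]_n) (x : M) (y : 'rV[R]_(n + n)).
Variable H : cotangent M -> R.
Hypothesis H_tonelli : tonelli H.

Let H_C2 : cot_Ck 2 H. Proof. by case: H_tonelli. Qed.

Let H_convex x p w : w != 0 ->
  0 < 'D_w (fun q => 'D_w (fun q' => H (Cot x q')) q) p.
Proof. by case: H_tonelli => _ h _; exact: h. Qed.

Definition momentum i y : 'rV[R]_n :=
  xget 0 [set p | velocity H i (row_mx (lsubmx y) p) = rsubmx y].

Lemma momentumP i y : bundle_cod i y ->
  velocity H i (row_mx (lsubmx y) (momentum i y)) = rsubmx y.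
Proof.
move=> yi; have [N N_norm H_sup] : uniformly_superlinear H by case: H_tonelli.
have [p pv] := velocity_surj H_C2 N_norm H_sup (rsubmx y) yi.
exact: (@xgetPex _ 0 [set p | velocity H i (row_mx (lsubmx y) p) = rsubmx y] (ex_intro _ p pv)).
Qed.

Lemma momentum_eq i y p : bundle_cod i y ->
  velocity H i (row_mx (lsubmx y) p) = rsubmx y -> momentum i y = p.
Proof.
move=> yi pv; apply: (velocity_inj H_C2 H_convex yi).
by rewrite momentumP.
Qed.

Lemma momentum_continuous i y : bundle_cod i y -> {for y, continuous (momentum i)}.
Proof.
move=> yi; apply: continuous_distP => e e0.
have near1 := velocity_inverse_continuous H_C2 H_convex (momentum i y) yi e0.
rewrite (momentumP yi) hsubmxK in near1.
apply: filterS (filterI near1 (bundle_cod_near yi)) => y' [near_y' y'i].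
rewrite distrC; exact: near_y' y'i (momentumP y'i).
Qed.

(** The supremum in [lagrangian] runs over components in the chart [chart_at x]; [pulled] converts
    them to the chart [i]. Being onto, it does not change the supremum. *)
Let pulled i y (P : 'rV[R]_n) :=
  pullback (trans i (chart_at (psi i (lsubmx y)))) (lsubmx y) P.

Let pulled_dotv i y P : bundle_cod i y ->
  dotv P (tvec (tan_param i y)) = dotv (pulled i y P) (rsubmx y).
Proof.
move=> yi; apply/esym/dotv_pullback/trans_differentiable.
by split; [exact: yi|exact: chart_at_dom].
Qed.

Let pulled_param i y P : bundle_cod i y ->
  Cot (tbase (tan_param i y)) P = cot_param i (row_mx (lsubmx y) (pulled i y P)).
Proof.
move=> yi; rewrite (cot_param_row _ yi); apply: (congr1 (Cot _)).
have xi := psi_dom yi; have xk := chart_at_dom (psi i (lsubmx y)).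
have := pullback_trans_phi P xk xi xk; rewrite (pullback_trans_id _ (phi_cod xk)).
by rewrite (psiK yi).
Qed.

Let pulled_surj i y p : bundle_cod i y -> exists P, pulled i y P = p.
Proof.
move=> yi; have xi := psi_dom yi; have xk := chart_at_dom (psi i (lsubmx y)).
exists (pullback (trans (chart_at (psi i (lsubmx y))) i) (phi (chart_at (psi i (lsubmx y))) (psi i (lsubmx y))) p).
have := pullback_trans_phi p xi xk xi; rewrite (pullback_trans_id _ (phi_cod xi)).
by rewrite (psiK yi).
Qed.

Let chart_term i y p := dotv p (rsubmx y) - H (cot_param i (row_mx (lsubmx y) p)).

Let chart_term_le i y p : bundle_cod i y -> chart_term i y p <= chart_term i y (momentum i y).
Proof.
move=> yi; have [->|pm] := eqVneq p (momentum i y); first exact: lexx.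
exact/ltW/(velocity_max H_C2 H_convex yi (momentumP yi) pm).
Qed.

Lemma lagrangianE i y : bundle_cod i y -> lagrangian H (tan_param i y) =
  dotv (momentum i y) (rsubmx y) - H (cot_param i (row_mx (lsubmx y) (momentum i y))).
Proof.
move=> yi; rewrite /lagrangian -/(chart_term i y (momentum i y)).
set S := image _ _.
have S_le : ubound S (chart_term i y (momentum i y)).
  move=> _ [P _ <-]; rewrite (pulled_dotv P yi) (pulled_param P yi).
  exact: chart_term_le.
have S_in : S (chart_term i y (momentum i y)).
  have [P PE] := pulled_surj (momentum i y) yi.
  by exists P => //; rewrite (pulled_dotv P yi) (pulled_param P yi) PE.
apply/eqP; rewrite eq_le; apply/andP; split.
  by apply: ge_sup => //; exists (chart_term i y (momentum i y)).
by apply: ub_le_sup => //; exists (chart_term i y (momentum i y)).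
Qed.

Lemma lagrangian_ge i y p : bundle_cod i y ->
  dotv p (rsubmx y) - H (cot_param i (row_mx (lsubmx y) p)) <= lagrangian H (tan_param i y).
Proof. by move=> yi; rewrite (lagrangianE yi); exact: chart_term_le. Qed.

(** The expansion in the base direction must be uniform in [p'], because the maximizing momentum
    moves with the base point. *)
Lemma horizontal_error i y p u e : bundle_cod i y -> 0 < e ->
  exists2 d, 0 < d & forall p' (h : R), `|p' - p| < d -> `|h| < d ->
   `|H (cot_param i (row_mx (lsubmx y + h *: u) p')) - H (cot_param i (row_mx (lsubmx y) p'))
     - h * 'D_(row_mx u 0) (H \o cot_param i) (row_mx (lsubmx y) p)| <= e * `|h|.
Proof.
move=> yi e0; set q := lsubmx y; set a := row_mx q p.
have ai : bundle_cod i a := bundle_cod_row p yi.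
set E := 'D_(row_mx u 0) (H \o cot_param i) a.
have dH := (H_C2 i).1.
have D2 (w : 'rV[R]_(n + n)) : is_Ck 1 (bundle_cod i) ('D_w (H \o cot_param i)) := (H_C2 i).2 w.
have cD : {for a, continuous ('D_(row_mx u 0) (H \o cot_param i))}.
  exact: is_Ck_continuous (D2 (row_mx u 0)) ai.
have near1 : \forall b \near a, bundle_cod i b /\ `|E - 'D_(row_mx u 0) (H \o cot_param i) b| <= e.
  have n1 : \forall b \near a, `|E - 'D_(row_mx u 0) (H \o cot_param i) b| <= e.
    by have /cvgrPdist_le := cD; apply.
  exact: filterI (bundle_cod_near ai) n1.
have [r /= r0 rP] := (nbhs_ballP _ _).1 near1.
(* Dividing by [|u| + 1] puts both the displacement [h u] and the covector increment below [r]. *)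
exists (r / (`|u| + 1)) => [|p' h p'd hd]; first by rewrite divr_gt0// ltr_wpDl.
have u1 : 0 < `|u| + 1 by rewrite ltr_wpDl.
have inr (t : R) : 0 <= t <= 1 -> ball a r (row_mx q p' + t *: (h *: row_mx u 0)).
  move=> /andP[t0 t1]; rewrite -ball_normE/= distrC.
  have -> : row_mx q p' + t *: (h *: row_mx u 0) - a = row_mx ((t * h) *: u) (p' - p).
    rewrite /a scalerA scale_row_mx scaler0 add_row_mx addr0 opp_row_mx add_row_mx.
    by rewrite addrAC subrr add0r.
  have ru : r / (`|u| + 1) <= r.
    by rewrite ler_pdivrMr// ler_peMr// ?(ltW r0)// lerDr.
  have th : `|(t * h) *: u| < r.
    rewrite normrZ normrM (ger0_norm t0).
    apply: (@le_lt_trans _ _ (`|h| * (`|u| + 1))); last by rewrite -ltr_pdivlMr.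
    by rewrite ler_pM// ?mulr_ge0// ?lerDl// ler_piMl.
  rewrite [ltLHS]mx_normrE; apply/bigmax_ltP; split=> [//|[c j] _ /=]; rewrite (ord1 c).
  case: (split_ordP j) => k ->; rewrite ?row_mxEl ?row_mxEr.
    exact: le_lt_trans (coord_le_norm _ _) th.
  exact: le_lt_trans (coord_le_norm _ _) (lt_le_trans p'd ru).
have bE : row_mx (q + h *: u) p' - row_mx q p' = h *: row_mx u 0.
  by rewrite opp_row_mx add_row_mx addrAC subrr add0r subrr scale_row_mx scaler0.
apply: (@derivative_error_scalar _ (H \o cot_param i) (row_mx q p') (row_mx (q + h *: u) p')).
  by move=> t /inr/rP[bi _]; rewrite bE; exact: dH.
move=> t /inr/rP[bi bE']; rewrite bE.
have := deriveZv h (row_mx u 0) (dH _ bi) => ->.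
move: bE'; set D := 'D_(row_mx u 0) _ _ => bE'.
rewrite -[h *: D]/(h * D) -mulrBr normrM mulrC.
by apply: ler_wpM2r; [exact: normr_ge0|rewrite distrC; exact: bE'].
Qed.

(** [l0] and [lh] are the values of the Lagrangian at a point and at the displaced one. Each is
    bounded below with the maximizer of the other, which squeezes the increment; [h1] to [h4] are
    the values of [H] at the four combinations of base point and momentum. *)
Let envelope_bound (l0 lh a b c d h1 h2 h3 h4 h E e x : R) :
  lh = a + h * b - h1 -> a - h2 <= l0 -> l0 = c - h4 -> c + h * d - h3 <= lh ->
  `|h1 - h2 - h * E| <= e / 2 * x -> `|h3 - h4 - h * E| <= e / 2 * x ->
  `|h * (b - d)| <= e / 2 * x -> `|lh - l0 - h * (d - E)| <= e * x.
Proof.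
rewrite !ler_norml => ? ? ? ? /andP[? ?] /andP[? ?] /andP[? ?].
by apply/andP; split; lra.
Qed.

(** Envelope theorem: to first order the motion of the maximizer does not contribute, so only the
    continuity of [momentum] is used. *)
Lemma derive_lagrangian i y (w : 'rV[R]_(n + n)) : bundle_cod i y ->
  'D_w (lagrangian H \o tan_param i) y =
  dotv (row_mx (- lsubmx (grad (H \o cot_param i) (row_mx (lsubmx y) (momentum i y))))
     (momentum i y)) w.
Proof.
move=> yi; set q := lsubmx y; set v := rsubmx y; set p := momentum i y.
set u := lsubmx w; set r := rsubmx w.
have ai : bundle_cod i (row_mx q p) := bundle_cod_row p yi.
set E := 'D_(row_mx u 0) (H \o cot_param i) (row_mx q p).
have -> : dotv (row_mx (- lsubmx (grad (H \o cot_param i) (row_mx q p))) p) w = dotv p r - E.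
  rewrite /E -(dotv_grad _ (cot_Ck_differentiable H_C2 ai)) dotv_row_mx dotv0 addr0.
  rewrite (dotvC (row_mx _ _) w) dotv_row_mx dotvNr addrC (dotvC (rsubmx w)).
  by rewrite (dotvC (lsubmx w)).
pose l (t : R) := lagrangian H (tan_param i (y + t *: w)).
have -> : 'D_w (lagrangian H \o tan_param i) y = 'D_1 l 0.
  by apply: derive_eq_increment => h; rewrite /l /= scaler1 addr0 addrC.
suff D : is_derive (0 : R) (1 : R) l (dotv p r - E) by case: D.
apply/is_derive_errorP => e e0.
have e20 : 0 < e / 2 by rewrite divr_gt0.
have [d d0 dP] := horizontal_error p u yi e20.
(* [K] bounds the pairing with [r], so momenta within [e / 2 / K] of each other change it by at most
   [e / 2]. *)
pose K := n%:R * `|r| + 1.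
have K0 : 0 < K by rewrite ltr_wpDl// mulr_ge0.
have eK : 0 < Num.min (e / 2 / K) (d / 2) by rewrite lt_min !divr_gt0.
have cy : (y + h *: w) @[h --> (0 : R)] --> y.
  rewrite -[X in _ --> X]addr0 -(scale0r w); apply: cvgD; first exact: cvg_cst.
  by apply: cvgZr_tmp; exact: cvg_id.
have near_i : \forall h \near (0 : R), bundle_cod i (y + h *: w).
  exact: cy (bundle_cod_near yi).
have near_p : \forall h \near (0 : R),
    `|p - momentum i (y + h *: w)| <= Num.min (e / 2 / K) (d / 2).
  have /cvgrPdist_le/(_ _ eK) := @momentum_continuous i y yi.
  by move=> /cy.
have near_d : \forall h \near (0 : R), `|h| < d by apply: near_norm_lt; rewrite normr0.
apply: filterS3 near_i near_p near_d => h yhi ph hd.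
set ph_ := momentum i (y + h *: w) in ph.
have lE : lsubmx (y + h *: w) = q + h *: u by rewrite linearD linearZ.
have rE : rsubmx (y + h *: w) = v + h *: r by rewrite linearD linearZ.
rewrite addr0 /l scale0r addr0 -[h *: (_ - E)]/(h * (_ - E)).
have up := lagrangian_ge ph_ yi; have := lagrangianE yhi; rewrite -/ph_ lE rE => upE.
have lo := lagrangian_ge p yhi; rewrite lE rE in lo; have loE := lagrangianE yi.
rewrite -/p -/q -/v in up loE.
have ph2 : `|ph_ - p| <= e / 2 / K by rewrite distrC (le_trans ph)// ge_min lexx.
have phd : `|ph_ - p| < d.
  by rewrite distrC (le_lt_trans ph)// gt_min half_lt ?orbT.
have pd : `|p - p| < d by rewrite subrr normr0.
have A1 := dP _ _ phd hd; have A2 := dP _ _ pd hd; rewrite -/q in A1 A2.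
have rp : `|h * dotv (ph_ - p) r| <= e / 2 * `|h|.
  rewrite normrM mulrC ler_wpM2r//; apply: le_trans (dotv_le _ _) _.
  apply: (@le_trans _ _ (`|ph_ - p| * K)).
    by rewrite mulrCA ler_wpM2l// /K lerDl.
  by rewrite -ler_pdivlMr.
rewrite (dotvBl r) in rp.
rewrite dotvDr dotvZr in upE; rewrite dotvDr dotvZr in lo.
exact: (envelope_bound upE up loE lo A1 A2 rp).
Qed.

Lemma grad_lagrangian i y : bundle_cod i y -> grad (lagrangian H \o tan_param i) y =
  row_mx (- lsubmx (grad (H \o cot_param i) (row_mx (lsubmx y) (momentum i y)))) (momentum i y).
Proof.
by move=> yi; apply/rowP => j; rewrite mxE (derive_lagrangian _ yi) dotv_delta.
Qed.

End envelope.

(** * The Legendre transform conjugates the Euler-Lagrange and Hamilton equations *)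

Section legendre_transform.
Context {R : realType} {n : nat} (M : smoothManifold R n).
Implicit Types (i j k : chart_ix M) (q p v : 'rV[R]_n) (x : M) (y : 'rV[R]_(n + n)).
Implicit Types (z : tangent M) (w : cotangent M).

Lemma tan_chart_at x v :
  tan_chart (chart_at x) (Tan x v) = row_mx (phi (chart_at x) x) v.
Proof.
by rewrite /tan_chart; apply: congr2 => //; exact/derive_trans_id/phi_cod/chart_at_dom.
Qed.

Lemma cot_chart_at x p :
  cot_chart (chart_at x) (Cot x p) = row_mx (phi (chart_at x) x) p.
Proof.
by rewrite /cot_chart; apply: congr2 => //; exact/pullback_trans_id/phi_cod/chart_at_dom.
Qed.

Lemma cot_chart_inj i w w' : cot_dom i w -> cot_dom i w' ->
  cot_chart i w = cot_chart i w' -> w = w'.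
Proof.
move=> wi w'i ww'; have [_ <-] := cot_chartK wi; have [_ <-] := cot_chartK w'i.
by rewrite ww'.
Qed.

Lemma cot_chart_row i w : cot_chart i w = row_mx (phi i (cbase w)) (rsubmx (cot_chart i w)).
Proof. by rewrite /cot_chart row_mxKr. Qed.

Lemma tan_chart_lsubmx i z : lsubmx (tan_chart i z) = phi i (tbase z).
Proof. by rewrite /tan_chart row_mxKl. Qed.

(** The velocity is the base component of the Hamiltonian field, so this is the first half of
    [ham_cov]. *)
Lemma velocity_cov (H : cotangent M -> R) i j y : cot_Ck 2 H -> overlap i j (lsubmx y) ->
  velocity H j (cot_trans i j y) = 'D_(velocity H i y) (trans i j) (lsubmx y).
Proof.
move=> H_C2 yij; have dH : differentiable (H \o cot_param j) (cot_trans i j y).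
  apply: (cot_Ck_differentiable H_C2); rewrite /bundle_cod/= /cot_trans row_mxKl.
  exact: trans_cod.
have E := etrans (esym (derive_cot_trans (velocity H i y) (- lsubmx (grad (H \o cot_param i) y)) yij))
  (ham_cov yij dH).
have := congr1 lsubmx E; rewrite row_mxKl => ->.
by rewrite /ham /symplectic_dual row_mxKl.
Qed.

Variable H : cotangent M -> R.
Hypothesis H_tonelli : tonelli H.

Let H_C2 : cot_Ck 2 H. Proof. by case: H_tonelli. Qed.

Lemma legendre_fiber x v : legendre H (Tan x v) =
  Cot x (momentum H (chart_at x) (row_mx (phi (chart_at x) x) v)).
Proof.
set k := chart_at x; set q := phi k x; have xk : dom k x := chart_at_dom x.
have qk : cod k q := phi_cod xk.
have TE : (fun v' => lagrangian H (Tan x v')) = fun v' => (lagrangian H \o tan_param k) (row_mx q v').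
  apply/funext => v'; rewrite /= -{1}(tan_chartK (z := Tan x v') xk).2.
  by rewrite tan_chart_at.
rewrite /legendre; apply: (congr1 (Cot x)); apply/rowP => j; rewrite mxE [X in 'D__ X _]TE.
apply: etrans (derive_vertical _ _ _ _) _.
have yk : bundle_cod k (row_mx q v) := bundle_cod_row v qk.
apply: etrans (derive_lagrangian H_tonelli _ yk) _.
by rewrite dotv_row_mx dotv0 add0r row_mxKr dotv_delta.
Qed.

Lemma legendre_velocity i z : tan_dom i z ->
  velocity H i (cot_chart i (legendre H z)) = rsubmx (tan_chart i z).
Proof.
case: z => x v xi; set k := chart_at x; have xk : dom k x := chart_at_dom x.
set w := legendre H (Tan x v).
have qk : cod k (phi k x) := phi_cod xk.
have vk : velocity H k (cot_chart k w) = v.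
  rewrite /w legendre_fiber cot_chart_at.
  have yk : bundle_cod k (row_mx (phi k x) v) := bundle_cod_row v qk.
  by have := momentumP H_tonelli yk; rewrite row_mxKl row_mxKr.
have [wki Tw] := cot_trans_chart (xk : cot_dom k w) (xi : cot_dom i w).
rewrite -Tw; apply: etrans (velocity_cov H_C2 wki) _.
by rewrite vk (cot_chart_row k w) row_mxKl /tan_chart row_mxKr.
Qed.

Lemma legendre_chart i z : tan_dom i z -> cot_chart i (legendre H z) =
  row_mx (lsubmx (tan_chart i z)) (momentum H i (tan_chart i z)).
Proof.
move=> zi; have [ci _] := tan_chartK zi.
have E : cot_chart i (legendre H z) =
    row_mx (lsubmx (tan_chart i z)) (rsubmx (cot_chart i (legendre H z))).
  by rewrite tan_chart_lsubmx; exact: cot_chart_row.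
rewrite E; apply: (congr1 (row_mx _)); apply/esym/(momentum_eq H_tonelli ci).
by rewrite -E; exact: legendre_velocity.
Qed.

Definition inv_legendre w : tangent M :=
  Tan (cbase w) (velocity H (chart_at (cbase w)) (cot_chart (chart_at (cbase w)) w)).

Lemma inv_legendreK w : legendre H (inv_legendre w) = w.
Proof.
have wk : cot_dom (chart_at (cbase w)) w := chart_at_dom (cbase w).
apply: (cot_chart_inj (i := chart_at (cbase w))) => //.
have zk : tan_dom (chart_at (cbase w)) (inv_legendre w) := wk.
rewrite (legendre_chart zk) (cot_chart_row _ w) tan_chart_lsubmx; apply: (congr1 (row_mx _)).
have [ci _] := tan_chartK zk; apply: (momentum_eq H_tonelli ci).
by rewrite tan_chart_lsubmx /inv_legendre tan_chart_at row_mxKr -cot_chart_row.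
Qed.

Lemma legendreK z : inv_legendre (legendre H z) = z.
Proof.
case: z => x v; rewrite /inv_legendre; apply: (congr1 (Tan x)).
have zk : tan_dom (chart_at x) (Tan x v) := chart_at_dom x.
by rewrite (legendre_velocity zk) tan_chart_at row_mxKr.
Qed.

Lemma inv_legendre_chart i w : cot_dom i w ->
  tan_chart i (inv_legendre w) = row_mx (lsubmx (cot_chart i w)) (velocity H i (cot_chart i w)).
Proof.
move=> wi; have zi : tan_dom i (inv_legendre w) := wi.
have := legendre_velocity zi; rewrite inv_legendreK => ->.
by rewrite -[LHS]hsubmxK tan_chart_lsubmx (cot_chart_row i w) row_mxKl.
Qed.

Lemma legendre_continuous : continuous (legendre H).
Proof.
move=> z; have zi : tan_dom (chart_at (tbase z)) z := chart_at_dom (tbase z).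
set i := chart_at (tbase z) in zi *.
have [ci cK] := tan_chartK zi.
apply: (tan_continuous_at zi).
apply: (@near_eq_continuous _ _ (cot_param i \o (fun y => row_mx (lsubmx y) (momentum H i y)))).
  apply: filterS (bundle_cod_near ci) => y yi.
  have [pi pK] := tan_paramK yi.
  have := legendre_chart (pi : tan_dom i (tan_param i y)); rewrite pK /= => <-.
  exact: (cot_chartK (z := legendre H (tan_param i y)) pi).2.
apply: continuous_comp.
  apply: continuous_row_mx; first exact: continuous_lsubmx.
  exact: momentum_continuous.
by apply: cot_param_continuous; rewrite /bundle_cod/= row_mxKl.
Qed.

Lemma inv_legendre_continuous : continuous inv_legendre.
Proof.
move=> w; have wi : cot_dom (chart_at (cbase w)) w := chart_at_dom (cbase w).
set i := chart_at (cbase w) in wi *.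
have [ci cK] := cot_chartK wi.
apply: (cot_continuous_at wi).
apply: (@near_eq_continuous _ _ (tan_param i \o (fun y => row_mx (lsubmx y) (velocity H i y)))).
  apply: filterS (bundle_cod_near ci) => y yi.
  have [pi pK] := cot_paramK yi.
  have := inv_legendre_chart (pi : cot_dom i (cot_param i y)); rewrite pK /= => <-.
  exact: (tan_chartK (z := inv_legendre (cot_param i y)) pi).2.
apply: continuous_comp.
  apply: continuous_row_mx; first exact: continuous_lsubmx.
  exact: velocity_continuous.
by apply: tan_param_continuous; rewrite /bundle_cod/= row_mxKl.
Qed.

Lemma grad_lagrangian_chart i z : tan_dom i z ->
  grad (lagrangian H \o tan_param i) (tan_chart i z) =
  row_mx (- lsubmx (grad (H \o cot_param i) (cot_chart i (legendre H z))))
    (rsubmx (cot_chart i (legendre H z))).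
Proof.
move=> zi; have [ci _] := tan_chartK zi.
rewrite (legendre_chart zi) row_mxKr; exact: grad_lagrangian.
Qed.

Lemma is_derive_lsubmx m l (c : R -> 'rV[R]_(m + l)) (t : R) d :
  is_derive t (1 : R) c d -> is_derive t (1 : R) (fun s => lsubmx (c s)) (lsubmx d).
Proof.
move=> /is_derive_coordP dc; apply/is_derive_coordP => a b; rewrite mxE.
by under eq_fun do rewrite mxE; exact: dc.
Qed.

Lemma is_derive_rsubmx m l (c : R -> 'rV[R]_(m + l)) (t : R) d :
  is_derive t (1 : R) c d -> is_derive t (1 : R) (fun s => rsubmx (c s)) (rsubmx d).
Proof.
move=> /is_derive_coordP dc; apply/is_derive_coordP => a b; rewrite mxE.
by under eq_fun do rewrite mxE; exact: dc.
Qed.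

Lemma ham_legendre i z : tan_dom i z -> ham i H (cot_chart i (legendre H z)) =
  row_mx (rsubmx (tan_chart i z)) (lsubmx (grad (lagrangian H \o tan_param i) (tan_chart i z))).
Proof.
move=> zi; rewrite (grad_lagrangian_chart zi) row_mxKl -(legendre_velocity zi).
by [].
Qed.

(** In a chart the transformed curve is [(q, dL/dv)] and the Hamiltonian field at it is
    [(v, dL/dq)]. Both sides therefore assert the same two derivatives, and nothing is
    differentiated twice. *)
Lemma euler_lagrange_ham (g : R -> tangent M) :
  euler_lagrange (lagrangian H) g <-> forall t, ham_curve_at H (legendre H \o g) t.
Proof.
split=> [[cg EL] t|Hg].
  set i := chart_at (tbase (g t)); have ti : dom i (tbase (g t)) := chart_at_dom _.
  have near_i : \forall s \near t, cot_dom i ((legendre H \o g) s).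
    have := cg t _ (open_nbhs_nbhs (conj (@dom_open _ _ M i) ti)); exact.
  apply: (chart_curve_at H_C2 near_i).
  have [d1 d2] := EL i t ti.
  have E : \near t, row_mx (lsubmx (tan_chart i (g t)))
      (rsubmx (grad (lagrangian H \o tan_param i) (tan_chart i (g t)))) =
      (cot_chart i \o (legendre H \o g)) t.
    apply: filterS near_i => s si; rewrite (grad_lagrangian_chart si) row_mxKr.
    by rewrite tan_chart_lsubmx; exact/esym/cot_chart_row.
  have D := is_derive_row_mx d1 d2.
  have -> : ham i H (cot_chart i ((legendre H \o g) t)) = _ := ham_legendre ti.
  exact: near_eq_is_derive E D.
have cb : continuous (fun t : R => tbase (g t) : M).
  move=> t; have [cc _] := Hg t.
  exact: (continuous_comp cc (@cbase_continuous _ _ M _)).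
split; first exact: cb.
move=> i t ti y dL.
have near_i : \forall s \near t, tan_dom i (g s).
  have := cb t _ (open_nbhs_nbhs (conj (@dom_open _ _ M i) ti)); exact.
have [_ /(_ i ti) D] := Hg t.
have DE : ham i H (cot_chart i ((legendre H \o g) t)) = _ := ham_legendre ti.
rewrite DE in D.
have Dl := is_derive_lsubmx D; have Dr := is_derive_rsubmx D.
rewrite row_mxKl in Dl; rewrite row_mxKr in Dr; split.
  have E : \near t, lsubmx ((cot_chart i \o (legendre H \o g)) t) = lsubmx (y t).
    by apply: filterS near_i => s si; rewrite /y tan_chart_lsubmx /= cot_chart_row row_mxKl.
  exact: near_eq_is_derive E Dl.
have E : \near t, rsubmx ((cot_chart i \o (legendre H \o g)) t) = rsubmx (dL (y t)).
  apply: filterS near_i => s si.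
  exact: esym (etrans (congr1 rsubmx (grad_lagrangian_chart si)) (row_mxKr _ _)).
exact: near_eq_is_derive E Dr.
Qed.

End legendre_transform.

(** * Local Hamiltonian flows on sublevels *)

Section sublevel.
Context {R : realType} {n : nat} (M : smoothManifold R n).
Implicit Types (i j k : chart_ix M) (q p v : 'rV[R]_n) (x : M) (y : 'rV[R]_(n + n)).
Implicit Types (w : cotangent M) (G : cotangent M -> R).
Hypothesis M_compact : compact [set: M].
Variable H : cotangent M -> R.
Hypothesis H_tonelli : tonelli H.

Let H_C2 : cot_Ck 2 H. Proof. by case: H_tonelli. Qed.

Lemma cot_Ck_continuous l G : cot_Ck l G -> continuous G.
Proof.
move=> GC w; apply: (cot_continuous_at (chart_at_dom (cbase w))).
have [ci _] := cot_chartK (chart_at_dom (cbase w)).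
exact: is_Ck_continuous (GC _) ci.
Qed.

(** Compactness of [{H <= h}] in the form of [compact_uniform]. That lemma is used twice: on [M]
    and, over a compact ball of a chart, on the product with a ball of covectors, which contains the
    sublevel by [sublevel_bound]. *)
Lemma sublevel_uniform h (P : R -> cotangent M -> Prop) :
  (forall e e' w, 0 < e -> e <= e' -> P e' w -> P e w) ->
  (forall w, H w <= h -> exists2 e, 0 < e & \forall w' \near w, P e w') ->
  exists2 e, 0 < e & forall w, H w <= h -> P e w.
Proof.
move=> Pmono Ploc.
have [||e e0 Pe] := @compact_uniform _ _ _
    (fun e x => forall w, cbase w = x -> H w <= h -> P e w) M_compact.
- by move=> e e' x e0 ee' Pe' w wx wh; exact: Pmono e0 ee' (Pe' w wx wh).
- move=> x _; set i := chart_at x; have xi : dom i x := chart_at_dom x.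
  set q0 := phi i x; have qi : cod i q0 := phi_cod xi.
  have near_q : \forall q \near q0, cod i q by apply: open_nbhs_nbhs; split=> //; exact: cod_open.
  have [r /= r0 rP] := (nbhs_ballP _ _).1 near_q.
  have r20 : 0 < r / 2 by rewrite divr_gt0.
  have r2r := half_lt r0.
  pose K1 : set 'rV[R]_n := [set q | `|q - q0| <= r / 2].
  have K1i : K1 `<=` cod i.
    by move=> q qK; apply: rP; rewrite -ball_normE/= distrC; exact: le_lt_trans r2r.
  have cK1 : compact K1 by exact: ball_compact.
  have [N N_norm H_sup] : uniformly_superlinear H by case: H_tonelli.
  have [C CP] := sublevel_bound N_norm H_sup h cK1 K1i.
  pose A := (fun z : 'rV[R]_n * 'rV[R]_n => row_mx z.1 z.2) @`
    (K1 `*` [set p : 'rV[R]_n | `|p - 0| <= C]).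
  have cA : compact A.
    apply: continuous_compact; last by apply: compact_setX => //; exact: ball_compact.
    apply: continuous_subspaceT => z.
    by apply: continuous_row_mx; [exact: cvg_fst|exact: cvg_snd].
  have Ai y : A y -> bundle_cod i y.
    by move=> [[q p] /= [qK _] <-]; apply: bundle_cod_row; exact: K1i.
  have [||e e0 Pe] := @compact_uniform _ _ A
     (fun e y => H (cot_param i y) <= h -> P e (cot_param i y)) cA.
  + by move=> e e' y e0 ee' Pe' yh; exact: Pmono e0 ee' (Pe' yh).
  + move=> y /Ai yi; have [yh|/negP hy] := pselect (H (cot_param i y) <= h).
      have [e e0 Pe] := Ploc _ yh; exists e; first exact: e0.
      have nP : \forall y' \near y, P e (cot_param i y') := cot_param_continuous yi Pe.
      by apply: filterS nP => y' Py' _ _.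
    (* Near a point above the level [h] there is nothing to prove, so any constant does. *)
    rewrite -ltNge in hy; exists 1; first exact: ltr01.
    have cH := is_Ck_continuous (H_C2 i) yi.
    have ny : \forall y' \near y, h < H (cot_param i y') := cH [set r | h < r] (lt_nbhsr hy).
    by apply: filterS ny => y' hy' _; rewrite leNgt hy'.
  exists e => //.
  have near_i : \forall x' \near x, dom i x' by apply: open_nbhs_nbhs; split=> //; exact: dom_open.
  have near_r : \forall x' \near x, `|phi i x - phi i x'| <= r / 2.
    by have /cvgrPdist_le := phi_continuous xi; apply.
  apply: filterS (filterI near_i near_r) => x' [x'i x'r] _ w wx' wh.
  have wi : cot_dom i w by rewrite /cot_dom/= wx'.
  have [ci cK] := cot_chartK wi; rewrite -cK; apply: Pe; last by rewrite cK.
  have wK : K1 (lsubmx (cot_chart i w)).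
    by rewrite /K1/= (cot_chart_row i w) row_mxKl wx' distrC.
  exists (lsubmx (cot_chart i w), rsubmx (cot_chart i w)); last by rewrite /= hsubmxK.
  split; first exact: wK.
  by rewrite /= subr0; apply: (CP _ _ wK); rewrite hsubmxK cK.
by exists e => // w wh; exact: Pe.
Qed.

Lemma sublevel_bounded h (u : cotangent M -> R) : continuous u ->
  exists C, forall w, H w <= h -> `|u w| <= C.
Proof.
move=> cu; have [||e e0 ue] := @sublevel_uniform h (fun e w => `|u w| <= e^-1).
- move=> e e' w e0 ee' ue'; apply: le_trans ue' _.
  by rewrite lef_pV2 ?posrE//; exact: lt_le_trans ee'.
- move=> w _; exists (`|u w| + 1)^-1; first by rewrite invr_gt0 ltr_wpDl.
  have /cvgrPdist_le/(_ _ ltr01) := cu w.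
  apply: filterS => w' ww'; rewrite invrK -lerBlDl.
  by apply: le_trans ww'; rewrite distrC (le_trans _ (lerB_dist _ _)).
by exists e^-1.
Qed.

(** The chart is left existential: the quantity is the derivative of [u] along [X_G], and in the
    application it is recognized through a curve, whichever the chart. *)
Lemma sublevel_derivative_bounded h G (u : cotangent M -> R) : cot_Ck 2 G -> cot_Ck 1 u ->
  exists C, forall w, H w <= h -> exists2 i, cot_dom i w &
    `|dotv (grad (u \o cot_param i) (cot_chart i w)) (ham i G (cot_chart i w))| <= C.
Proof.
move=> GC uC.
pose P e w := exists2 i, cot_dom i w &
  `|dotv (grad (u \o cot_param i) (cot_chart i w)) (ham i G (cot_chart i w))| <= e^-1.
have [||e e0 ue] := @sublevel_uniform h P.
- move=> e e' w e0 ee' [i wi ue']; exists i => //; apply: le_trans ue' _.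
  by rewrite lef_pV2 ?posrE//; exact: lt_le_trans ee'.
- move=> w _; set i := chart_at (cbase w); have wi : cot_dom i w := chart_at_dom (cbase w).
  pose f w := dotv (grad (u \o cot_param i) (cot_chart i w)) (ham i G (cot_chart i w)).
  exists (`|f w| + 1)^-1; first by rewrite invr_gt0 ltr_wpDl.
  have [ci _] := cot_chartK wi.
  have cg : {for cot_chart i w, continuous (grad (u \o cot_param i))}.
    apply: continuous_rV => j.
    apply: (@eq_continuous_at _ _ ('D_(delta_mx 0 j) (u \o cot_param i))); last first.
      exact: (uC i).2.
    by move=> y; rewrite mxE.
  have cf : {for w, continuous f}.
    have cc := cot_chart_continuous wi.
    apply: continuous_dotv; first exact: continuous_comp cc cg.
    exact: continuous_comp cc (is_Ck_continuous (ham_C1 i GC) ci).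
  have near_f : \forall w' \near w, `|f w - f w'| <= 1.
    by have /cvgrPdist_le := cf; apply.
  apply: filterS (filterI (cot_dom_near wi) near_f) => w' [w'i ww']; exists i => //.
  rewrite invrK -/(f w') -lerBlDl.
  by apply: le_trans ww'; rewrite distrC (le_trans _ (lerB_dist _ _)).
by exists e^-1.
Qed.

End sublevel.

(** * Uniqueness of integral curves *)

Section uniqueness.
Context {R : realType} {n : nat} (M : smoothManifold R n).
Implicit Types (i j k : chart_ix M) (w : cotangent M) (G : cotangent M -> R).

(** The base points are equal because [M] is Hausdorff, and then a single chart contains both
    covectors. *)
Lemma cot_hausdorff : hausdorff_space (cotangent M).
Proof.
move=> w w' ww'; have bE : cbase w = cbase w'.
  apply: (@manifold_hausdorff _ _ M) => U W Uw Ww'.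
  have [w'' [/= Uw'' Ww'']] := ww' _ _ (cbase_continuous Uw) (cbase_continuous Ww').
  by exists (cbase w'').
set i := chart_at (cbase w); have wi : cot_dom i w := chart_at_dom (cbase w).
have w'i : cot_dom i w' by rewrite /cot_dom/= -bE.
apply: (cot_chart_inj wi w'i); apply: (@norm_hausdorff _ _) => U W Uw Ww'.
have [w'' [/= Uw'' Ww'']] := ww' _ _ (cot_chart_continuous wi Uw) (cot_chart_continuous w'i Ww').
by exists (cot_chart i w'').
Qed.

Lemma is_derive_shift_comp (V : normedModType R) (c : R -> V) (t s : R) d :
  is_derive (s + t) (1 : R) c d -> is_derive s (1 : R) (fun s => c (s + t)) d.
Proof.
move=> /is_derive_errorP cd; apply/is_derive_errorP => e e0.
by apply: filterS (cd e e0) => h; rewrite addrA.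
Qed.

Lemma ham_curve_shift G (c : R -> cotangent M) (t s : R) :
  ham_curve_at G c (s + t) -> ham_curve_at G (fun s => c (s + t)) s.
Proof.
move=> [cc hc]; split.
  apply: (@continuous_comp _ _ _ (fun s : R => s + t) c) => //.
  by apply: continuousD; [exact: cvg_id|exact: cst_continuous].
by move=> i ci; apply: (is_derive_shift_comp (c := cot_chart i \o c)); exact: hc.
Qed.

(** In a chart around the common value, Gronwall's estimate bounds the difference of the curves by
    twice its value at [t], which is 0. *)
Lemma ham_curve_eq_near G (c c' : R -> cotangent M) (t : R) : cot_Ck 2 G ->
  (\forall s \near t, ham_curve_at G c s /\ ham_curve_at G c' s) -> c t = c' t ->
  \forall s \near t, c s = c' s.
Proof.
move=> GC near_cc cc't; have [[cc hc] [cc' hc']] := nbhs_singleton near_cc.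
set i := chart_at (cbase (c t)); have ti : cot_dom i (c t) := chart_at_dom (cbase (c t)).
have [ci _] := cot_chartK ti; set a := cot_chart i (c t) in ci.
have [r /= r0 rP] := (nbhs_ballP _ _).1 (bundle_cod_near ci).
have r20 : 0 < r / 2 by rewrite divr_gt0.
have rP' y : `|y - a| <= r / 2 -> bundle_cod i y.
  move=> yr; apply: rP; rewrite -ball_normE/= distrC; exact: le_lt_trans yr (half_lt r0).
have [L L0 VL] := derivative_bound (ham_C1 i GC) rP'.
have near_c (b : R -> cotangent M) : {for t, continuous b} -> b t = c t ->
    \forall s \near t, cot_dom i (b s) /\ `|cot_chart i (b s) - a| <= r / 2.
  move=> cb bt; have bi : cot_dom i (b t) by rewrite bt.
  have n1 : \forall s \near t, cot_dom i (b s) := cb _ (cot_dom_near bi).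
  have n2 : \forall s \near t, `|cot_chart i (b t) - cot_chart i (b s)| <= r / 2.
    have /cvgrPdist_le := continuous_comp cb (cot_chart_continuous bi); apply; exact: r20.
  apply: filterS (filterI n1 n2) => s [bs br]; split; first exact: bs.
  by rewrite distrC /a -bt; exact: br.
have nc1 := near_c _ cc erefl; have nc2 := near_c _ cc' (esym cc't).
have [d /= d0 dP] := (nbhs_ballP _ _).1 (filterI near_cc (filterI nc1 nc2)).
pose d' := Num.min d (1 / (2 * L)).
have d'0 : 0 < d' by rewrite lt_min d0 divr_gt0// mulr_gt0.
have Ld' : L * d' <= 1 / 2.
  rewrite mulrC -ler_pdivlMr// ge_min; apply/orP; right.
  by rewrite le_eqVlt; apply/orP; left; apply/eqP; field; rewrite gt_eqF.
have sP (s : R) : `|s| < d' -> ball t d (s + t).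
  move=> sd; rewrite -ball_normE/= distrC addrK (lt_le_trans sd)// ge_min lexx//.
have E0 (s : R) : `|s| < d' -> c (s + t) = c' (s + t).
  move=> sd'; have [_ [[si _] [s'i _]]] := dP _ (sP s sd').
  apply: (cot_chart_inj si s'i); apply/subr0_eq/eqP; rewrite -normr_le0.
  pose u (s : R) := cot_chart i (c (s + t)) - cot_chart i (c' (s + t)).
  have u0 : u 0 = 0 by rewrite /u !add0r cc't subrr.
  have z0 : 2 * (`|u 0| + d' * 0) = 0 by rewrite u0 normr0 mulr0 addr0 mulr0.
  suff : `|u s| <= 2 * (`|u 0| + d' * 0) by rewrite z0; exact.
  apply: (gronwall_short (u := u)
    (du := fun s => ham i G (cot_chart i (c (s + t))) - ham i G (cot_chart i (c' (s + t))))
    (ltW L0) (lexx _) Ld' sd').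
  - move=> q /sP/dP[[[_ h1] [_ h2]] [[qi _] [q'i _]]].
    have D1 := is_derive_shift_comp (c := cot_chart i \o c) (h1 i qi).
    have D2 := is_derive_shift_comp (c := cot_chart i \o c') (h2 i q'i).
    exact: (is_deriveB D1 D2).
  - move=> q /sP/dP[_ [[_ qr] [_ q'r]]]; rewrite addr0.
    have X := C1_lipschitz (ham_C1 i GC) rP' (ltW L0) VL qr q'r.
    exact X.
apply: filterS (nbhsx_ballx t _ d'0) => s; rewrite -ball_normE/= distrC => sd.
by have := E0 _ sd; rewrite subrK.
Qed.

(** The set where the curves agree is open by [ham_curve_eq_near] and closed by [cot_hausdorff], in
    a connected interval. *)
Lemma ham_curve_unique G (c c' : R -> cotangent M) (d : R) : cot_Ck 2 G ->
  (forall t, `|t| < d -> ham_curve_at G c t /\ ham_curve_at G c' t) -> c 0 = c' 0 ->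
  forall t, `|t| < d -> c t = c' t.
Proof.
move=> GC cc' c0 t td.
pose I : set R := [set t | `|t| < d].
have nearI (s : R) : I s -> \forall s' \near s, I s'.
  exact: near_norm_lt.
have cI : connected I.
  apply/connected_intervalP => a b; rewrite /I/= !ltr_norml => /andP[a1 a2] /andP[b1 b2] e.
  by move=> /andP[ae eb]; rewrite ltr_norml (lt_le_trans a1 ae) (le_lt_trans eb b2).
pose B : set R := [set t | I t /\ c t = c' t].
have oB : open B.
  rewrite openE => s [sd cs]; apply: filterI (nearI s sd) _.
  apply: (ham_curve_eq_near GC) cs; apply: filterS (nearI s sd) => s'; exact: cc'.
have BE : B = I.
  apply: cI.
  - by exists 0; split=> //; rewrite /I/= normr0; exact: le_lt_trans td.
  - by exists B => //; apply/seteqP; split=> [s [sI cs]|s []].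
  exists (~` (I `\` B)); last first.
    apply/seteqP; split=> [s Bs|s [Is nB]]; first by split; [case: Bs|case].
    by apply: contrapT => nBs; apply: nB.
  apply: open_closedC; rewrite openE => s [Is nBs].
  have nc : c s != c' s by apply/eqP => cs; apply: nBs.
  have := cot_hausdorff; rewrite open_hausdorff => /(_ _ _ nc)[[U W] /= [Uc Wc'] [oU oW UW]].
  rewrite !inE in Uc Wc'; have [[cc _] [cc2 _]] := cc' s Is.
  have nU : \forall s' \near s, U (c s') := cc _ (open_nbhs_nbhs (conj oU Uc)).
  have nW : \forall s' \near s, W (c' s') := cc2 _ (open_nbhs_nbhs (conj oW Wc')).
  apply: filterS (filterI (nearI s Is) (filterI nU nW)) => s' [Is' [Us' Ws']].
  split=> // -[_ cs']; rewrite cs' in Us'.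
  by have : (U `&` W) (c' s') by []; rewrite (eqP UW).
by have [] : B t by rewrite BE.
Qed.

End uniqueness.

Section flow_boxes.
Context {R : realType} {n : nat} (M : smoothManifold R n).
Implicit Types (i j k : chart_ix M) (y a : 'rV[R]_(n + n)) (w : cotangent M).
Variable G : cotangent M -> R.
Hypothesis G_C2 : cot_Ck 2 G.

(* A ball of radius [r] in the chart [i] whose integral curves stay for time [d] in
   the ball of radius [2 r], where Gronwall's estimate applies. *)
Definition flow_box d i a (r L : R) : Prop :=
  [/\ 0 < r /\ (forall y, `|y - a| <= r *+ 2 -> bundle_cod i y),
      0 <= L /\ L * d <= 1 / 2,
      (forall y v, `|y - a| <= r *+ 2 -> `|'D_v (ham i G) y| <= L * `|v|) &
      forall y, `|y - a| < r -> exists g : R -> 'rV[R]_(n + n), g 0 = y /\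
        forall t, `|t| < d -> is_derive t (1 : R) g (ham i G (g t)) /\ `|g t - a| < r *+ 2].

Definition has_flow_box d w := exists i a r L,
  [/\ flow_box d i a r L, cot_dom i w & `|cot_chart i w - a| < r].

Lemma has_flow_boxW d d' w : 0 < d -> d <= d' -> has_flow_box d' w -> has_flow_box d w.
Proof.
move=> d0 dd' [i [a [r [L [[rP [L0 Ld] VL gP] wi wr]]]]]; exists i, a, r, L; split; [|exact: wi|exact: wr].
split; [exact: rP| |exact: VL|].
  by split; [exact: L0|apply: le_trans Ld; rewrite ler_wpM2l].
move=> y /gP[g [g0 gd]]; exists g; split; first exact: g0.
by move=> t td; apply: gd; exact: lt_le_trans dd'.
Qed.

(** One box, centered at [w], serves all nearby points, so the existence time is locally constant
    and [sublevel_uniform] applies to it. *)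
Lemma has_flow_box_near w : exists2 d, 0 < d & \forall w' \near w, has_flow_box d w'.
Proof.
set i := chart_at (cbase w); have wi : cot_dom i w := chart_at_dom (cbase w).
have [ci _] := cot_chartK wi; set a := cot_chart i w in ci.
have [r /= r0 rP] := (nbhs_ballP _ _).1 (bundle_cod_near ci).
(* A flow box needs the ball of twice its radius inside the chart. *)
have r30 : 0 < r / 3 by rewrite divr_gt0.
have rP' y : `|y - a| <= (r / 3) *+ 2 -> bundle_cod i y.
  move=> yr; apply: rP; rewrite -ball_normE/= distrC (le_lt_trans yr)//.
  by rewrite mulr2n; lra.
have [[d L] /= [d0 L0 Ld VL] gP] := local_flow (ham_C1 i G_C2) r30 rP'.
exists d => //.
have nr : \forall w' \near w, `|a - cot_chart i w'| < r / 3.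
  by have /cvgrPdist_lt := cot_chart_continuous wi; apply.
apply: filterS (filterI (cot_dom_near wi) nr) => w' [w'i w'r].
exists i, a, (r / 3), L; split; last by rewrite distrC.
  by split; [exact: conj r30 rP'|exact: conj L0 Ld|exact: VL|exact: gP].
exact: w'i.
Qed.

Lemma flow_box_curve d i a r L y (g : R -> 'rV[R]_(n + n)) (t : R) : flow_box d i a r L ->
  (forall t, `|t| < d -> is_derive t (1 : R) g (ham i G (g t)) /\ `|g t - a| < r *+ 2) ->
  `|t| < d -> ham_curve_at G (cot_param i \o g) t.
Proof.
move=> [[r0 rP] _ _ _] gd td.
have near_d := near_norm_lt td.
have gi (s : R) : `|s| < d -> bundle_cod i (g s).
  by move=> /gd[_ /ltW]; exact: rP.
have near_i : \forall s \near t, cot_dom i ((cot_param i \o g) s).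
  by apply: filterS near_d => s /gi/cot_paramK[].
apply: (chart_curve_at G_C2 near_i).
have E : \near t, g t = (cot_chart i \o (cot_param i \o g)) t.
  by apply: filterS near_d => s /gi/cot_paramK[].
have [dt _] := gd t td.
have [_ gK] := cot_paramK (gi t td).
have -> : ham i G (cot_chart i ((cot_param i \o g) t)) = ham i G (g t) by rewrite /= gK.
exact: near_eq_is_derive E dt.
Qed.

End flow_boxes.

Section sublevel_flow.
Context {R : realType} {n : nat} (M : smoothManifold R n).
Implicit Types (i j k : chart_ix M) (y a : 'rV[R]_(n + n)) (w : cotangent M).
Variables (H G : cotangent M -> R) (h d : R).
Hypothesis H_C2 : cot_Ck 2 H.
Hypothesis G_C2 : cot_Ck 2 G.
Hypothesis HG : forall i y, bundle_cod i y -> dotv (grad (H \o cot_param i) y) (ham i G y) = 0.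
Hypothesis d0 : 0 < d.
Hypothesis boxes : forall w, H w <= h -> has_flow_box G d w.

(* Junk when [`|t| >= d] or when no integral curve through [w] exists up to time [d]. *)
Definition flow (t : R) w : cotangent M :=
  xget (fun _ => w) [set c : R -> cotangent M | c 0 = w /\
    forall t, `|t| < d -> ham_curve_at G c t] t.

(** [flow] picks a curve by choice; uniqueness identifies it with the curve of any box containing
    [w], whose estimates then apply to it. *)
Lemma flow_box_flow i a r L w : flow_box G d i a r L -> cot_dom i w -> H w <= h ->
  `|cot_chart i w - a| < r ->
  [/\ flow 0 w = w, forall t, `|t| < d -> ham_curve_at G (flow ^~ w) t &
    exists2 g : R -> 'rV[R]_(n + n), g 0 = cot_chart i w &
      forall t, `|t| < d -> [/\ is_derive t (1 : R) g (ham i G (g t)), `|g t - a| < r *+ 2,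
        cot_dom i (flow t w) & cot_chart i (flow t w) = g t]].
Proof.
move=> box wi wh wr; have [[r0 rP] _ _ gP] := box.
have [g [g0 gd]] := gP _ wr.
have Hc (t : R) : `|t| < d -> ham_curve_at G (cot_param i \o g) t.
  by move=> td; exact: flow_box_curve box gd td.
have c0 : (cot_param i \o g) 0 = w by rewrite /= g0; have [_ ->] := cot_chartK wi.
set S := [set c : R -> cotangent M | c 0 = w /\ forall t, `|t| < d -> ham_curve_at G c t].
have [f0 fd] : S (flow ^~ w).
  exact: (@xgetPex _ (fun _ => w) S (ex_intro _ (cot_param i \o g) (conj c0 Hc))).
split; [exact: f0|exact: fd|exists g; first exact: g0].
move=> t td; have [dg rg] := gd t td.
have E : flow t w = (cot_param i \o g) t.
  apply: (ham_curve_unique G_C2 _ _ td); last exact: etrans f0 (esym c0).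
  by move=> s sd; split; [exact: fd|exact: Hc].
have [pi pK] := cot_paramK (rP _ (ltW rg)).
by rewrite E; split; [exact: dg|exact: rg|exact: pi|exact: pK].
Qed.

Lemma flow0 w : H w <= h -> flow 0 w = w.
Proof.
move=> wh; have [i [a [r [L [box wi wr]]]]] := boxes wh.
by have [] := flow_box_flow box wi wh wr.
Qed.

Lemma flow_curve w (t : R) : H w <= h -> `|t| < d -> ham_curve_at G (flow ^~ w) t.
Proof.
move=> wh; have [i [a [r [L [box wi wr]]]]] := boxes wh.
by have [_ + _] := flow_box_flow box wi wh wr; apply.
Qed.

Lemma flow_conserved w (t : R) : H w <= h -> `|t| < d -> H (flow t w) = H w.
Proof.
move=> wh td; rewrite -[in RHS](flow0 wh).
apply: (ham_curve_conserved (c := flow ^~ w) (fun i => is_CkS (H_C2 i)) HG _ td).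
by move=> s; exact: flow_curve.
Qed.

(** Halved times keep [s + t] within the existence time, and conservation of [H] keeps [flow t w] in
    the sublevel, where [flow] is meaningful. *)
Lemma flow_add w (s t : R) : H w <= h -> `|s| < d / 2 -> `|t| < d / 2 ->
  flow s (flow t w) = flow (s + t) w.
Proof.
move=> wh sd td; have d2 := half_lt d0.
have td' : `|t| < d by exact: lt_trans d2.
have th : H (flow t w) <= h by rewrite flow_conserved.
apply: (@ham_curve_unique _ _ _ G (flow ^~ (flow t w)) (fun s => flow (s + t) w) (d / 2) G_C2 _ _ _ sd).
  move=> q qd; split; first by apply: flow_curve th _; exact: lt_trans d2.
  apply: (ham_curve_shift (c := flow ^~ w)); apply: flow_curve wh _.
  by rewrite (le_lt_trans (ler_normD _ _))// (splitr d) ltrD.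
by rewrite add0r (flow0 th).
Qed.

Lemma flowK w (s : R) : H w <= h -> `|s| < d / 2 -> flow (- s) (flow s w) = w.
Proof. by move=> wh sd; rewrite flow_add ?normrN// addNr flow0. Qed.

Lemma near_flow_box (T : topologicalType) (c : T -> cotangent M) t0 i a r :
  {for t0, continuous c} -> cot_dom i (c t0) -> H (c t0) < h -> `|cot_chart i (c t0) - a| < r ->
  \forall t \near t0, cot_dom i (c t) /\ H (c t) < h /\ `|cot_chart i (c t) - a| < r.
Proof.
move=> cc ti th tr.
have near_h : \forall t \near t0, H (c t) < h.
  have cH := continuous_comp cc (@cot_Ck_continuous _ _ _ _ _ H_C2 (c t0)).
  exact: (cH [set q | q < h] (lt_nbhsl th)).
have near_i : \forall t \near t0, cot_dom i (c t) := cc _ (cot_dom_near ti).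
apply: filterI near_i (filterI near_h _).
have cn : {for t0, continuous (fun t => `|cot_chart i (c t) - a|)}.
  apply: (@continuous_comp _ _ _ (fun t => cot_chart i (c t) - a) (fun y => `|y|)).
    apply: continuousB; last exact: cst_continuous.
    exact: continuous_comp cc (cot_chart_continuous ti).
  exact: norm_continuous.
exact: (cn [set q | q < r] (lt_nbhsl tr)).
Qed.

(** Inside one box Gronwall's estimate makes the flow map 2-Lipschitz at [w]. *)
Lemma flow_continuous w (s : R) : H w < h -> `|s| < d -> {for w, continuous (flow s)}.
Proof.
move=> wh sd; have [i [a [r [L [box wi wr]]]]] := boxes (ltW wh).
have [[r0 rP] [L0 Ld] VL _] := box.
have cc := cot_chart_continuous wi.
have near_box := near_flow_box (c := id) (fun _ => id) wi wh wr.
have dist : \forall w' \near w,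
    `|cot_chart i (flow s w) - cot_chart i (flow s w')| <= 2 * `|cot_chart i w - cot_chart i w'|.
  apply: filterS near_box => w' [w'i [w'h w'r]].
  have [_ _ [g g0 gd]] := flow_box_flow box wi (ltW wh) wr.
  have [_ _ [g' g'0 g'd]] := flow_box_flow box w'i (ltW w'h) w'r.
  have [_ _ _ ->] := gd s sd; have [_ _ _ ->] := g'd s sd.
  pose u (t : R) := g t - g' t.
  have zE : 2 * (`|u 0| + d * 0) = 2 * `|cot_chart i w - cot_chart i w'|.
    by rewrite /u g0 g'0 mulr0 addr0.
  rewrite -zE; apply: (gronwall_short (u := u) (du := fun t => ham i G (g t) - ham i G (g' t))
    L0 (lexx _) Ld sd).
    move=> t td; have [D1 _ _ _] := gd t td; have [D2 _ _ _] := g'd t td.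
    exact: (is_deriveB D1 D2).
  move=> t td; rewrite addr0; have [_ r1 _ _] := gd t td; have [_ r2 _ _] := g'd t td.
  have X := C1_lipschitz (ham_C1 i G_C2) rP L0 VL (ltW r1) (ltW r2).
  exact X.
have ccs : {for w, continuous (fun w' => cot_chart i (flow s w'))}.
  apply: continuous_distP => e e0; have e20 : 0 < e / 2 by rewrite divr_gt0.
  have near_e : \forall w' \near w, `|cot_chart i w - cot_chart i w'| <= e / 2.
    by have /cvgrPdist_le := cc; apply.
  apply: filterS (filterI dist near_e) => w' [w'1 w'2]; apply: le_trans w'1 _.
  by rewrite mulrC -ler_pdivlMr.
have flow_i w' : cot_dom i w' -> H w' < h -> `|cot_chart i w' - a| < r -> cot_dom i (flow s w').
  by move=> w'i /ltW w'h w'r; have [_ _ [g _ /(_ s sd)[]]] := flow_box_flow box w'i w'h w'r.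
have [ci _] := cot_chartK (flow_i w wi wh wr).
apply: (@near_eq_continuous _ _ (cot_param i \o (fun w' => cot_chart i (flow s w')))).
  by apply: filterS near_box => w' [w'i [w'h w'r]]; have [] := cot_chartK (flow_i w' w'i w'h w'r).
by apply: continuous_comp ccs _; exact: cot_param_continuous.
Qed.

(** The box at [c t0] contains [c t] for all [t] near [t0], and [commuting_flow] is applied to the
    orbits it provides. *)
Lemma flow_commute (X : cotangent M -> R) (c : R -> cotangent M) (t0 s : R) : cot_Ck 2 X ->
  (forall i y, bundle_cod i y -> 'D_(ham i G y) (ham i X) y = 'D_(ham i X y) (ham i G) y) ->
  ham_curve_at X c t0 -> H (c t0) < h -> `|s| < d ->
  ham_curve_at X (fun t => flow s (c t)) t0.
Proof.
move=> XC XG Xc ch sd; set w := c t0 in ch.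
have [i [a [r [L [box wi wr]]]]] := boxes (ltW ch).
have [[r0 rP] [L0 Ld] VL _] := box; have [cc hc] := Xc.
have near_box := near_flow_box cc wi ch wr.
pose sigma (t s : R) := cot_chart i (flow s (c t)).
have box_t t : cot_dom i (c t) -> H (c t) < h -> `|cot_chart i (c t) - a| < r ->
    forall s, `|s| < d -> [/\ is_derive s (1 : R) (sigma t) (ham i G (sigma t s)),
      `|sigma t s - a| <= r *+ 2 & cot_dom i (flow s (c t))].
  move=> ti /ltW th tr q qd; have [_ fc [g _ gd]] := flow_box_flow box ti th tr.
  have [_ gr fi fE] := gd q qd.
  have [_ /(_ i fi) D] := fc q qd.
  by split; [exact: D|rewrite /sigma fE ltW|exact: fi].
have near_sigma : \forall t \near t0, forall s, `|s| < d ->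
    is_derive s (1 : R) (sigma t) (ham i G (sigma t s)) /\ `|sigma t s - a| <= r *+ 2.
  by apply: filterS near_box => t [ti [th tr]] q qd; have [] := box_t t ti th tr q qd.
have near_flow : \forall t \near t0, cot_dom i (flow s (c t)).
  by apply: filterS near_box => t [ti [th tr]]; have [] := box_t t ti th tr s sd.
have s0E : \near t0, (cot_chart i \o c) t0 = (sigma ^~ 0) t0.
  by apply: filterS near_box => t [_ [/ltW th _]]; rewrite /sigma flow0.
have D0 : is_derive t0 (1 : R) (sigma ^~ 0) (ham i X (sigma t0 0)).
  have -> : ham i X (sigma t0 0) = ham i X (cot_chart i (c t0)).
    by rewrite /sigma flow0// ltW.
  exact: near_eq_is_derive s0E (hc i wi).
have dX y : bundle_cod i y -> differentiable (ham i X) y by exact: ham_differentiable XC.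
have XGa y (yr : `|y - a| <= r *+ 2) := XG i y (rP y yr).
have CF := @commuting_flow R (n + n) (bundle_cod i) a (r *+ 2) (ham i X) (ham i G) L d
  sigma t0 dX (ham_C1 i G_C2) rP XGa L0 Ld VL near_sigma D0 s sd.
exact: (@chart_curve_at _ _ _ X (fun t => flow s (c t)) t0 i XC near_flow CF).
Qed.

End sublevel_flow.

(** * Invariant measures *)

Section invariant_integrals.
Context {R : realType} {disp : measure_display} {T : measurableType disp}.
Variable mu : probability T R.

Lemma ge0_integral_comp (phi : T -> T) (f : T -> \bar R) : measurable_fun setT phi ->
  measurable_fun setT f -> (forall x, 0 <= f x)%E ->
  (\int[pushforward mu phi]_x f x = \int[mu]_x f (phi x))%E.
Proof.
move=> mphi mf f0.
have E := @ge0_integral_pushforward _ _ T T R phi mphi mu setT f measurableT mf (fun x _ => f0 x).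
by rewrite preimage_setT in E.
Qed.

(** Treating positive and negative parts separately avoids any integrability assumption, since an
    action may be infinite. *)
Lemma integral_comp (phi : T -> T) (f : T -> \bar R) : measurable_fun setT phi ->
  measurable_fun setT f ->
  (\int[pushforward mu phi]_x f x = \int[mu]_x f (phi x))%E.
Proof.
move=> mphi mf; rewrite integralE [RHS]integralE.
congr (_ - _)%E.
  have mp : measurable_fun setT f^\+%E by exact: measurable_funepos.
  apply: etrans (ge0_integral_comp mphi mp (funepos_ge0 f)) _.
  by apply: eq_integral => x _; rewrite !funeposE.
have mn : measurable_fun setT f^\-%E by exact: measurable_funeneg.
apply: etrans (ge0_integral_comp mphi mn (funeneg_ge0 f)) _.
by apply: eq_integral => x _; rewrite !funenegE.
Qed.

Lemma bounded_integrable (O : set T) (f : T -> R) K : measurable O ->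
  measurable_fun setT f -> (forall x, O x -> `|f x| <= K) -> mu.-integrable O (EFin \o f).
Proof.
move=> mO mf fK; apply: measurable_bounded_integrable => //.
- by apply: le_lt_trans (probability_le1 mu mO) _; rewrite ltry.
- exact: measurable_funTS.
- exists K; split; first exact: num_real.
  by move=> K' KK' x Ox; apply: le_trans (fK x Ox) (ltW KK').
Qed.

(** On [O] both integrals are finite and equal; off [O] the functions coincide, so that the
    integrals agree even when infinite. *)
Lemma integral_eq_glue (O : set T) (f g : T -> R) K : measurable O ->
  measurable_fun setT f -> measurable_fun setT g -> (forall x, ~ O x -> f x = g x) ->
  (forall x, O x -> `|f x| <= K) -> (forall x, O x -> `|g x| <= K) ->
  \int[mu]_(x in O) f x = \int[mu]_(x in O) g x ->
  (\int[mu]_x (f x)%:E = \int[mu]_x (g x)%:E)%E.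
Proof.
move=> mO mf mg fg fK gK fgO.
have dO : [disjoint O & ~` O] by rewrite disj_set2E setICr eqxx.
have mE (u : T -> R) : measurable_fun setT u -> measurable_fun (O `|` ~` O) (EFin \o u).
  by move=> mu_; rewrite setUv; exact/measurable_EFinP.
rewrite -(setUv O).
rewrite (integral_setU mu mO (measurableC mO) (mE f mf) dO).
rewrite (integral_setU mu mO (measurableC mO) (mE g mg) dO).
congr (_ + _)%E; last by apply: eq_integral => x; rewrite inE => nx; rewrite /= (fg _ nx).
have If := bounded_integrable mO mf fK; have Ig := bounded_integrable mO mg gK.
rewrite -(fineK (integrable_fin_num mO If)) -(fineK (integrable_fin_num mO Ig)).
by congr (_%:E).
Qed.

Lemma Rintegral_invariant (O : set T) (phi : T -> T) (u : T -> R) K :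
  measurable O -> measurable_fun setT phi -> measurable_fun setT u ->
  (forall A, measurable A -> mu (phi @^-1` A) = mu A) ->
  (forall x, O (phi x) <-> O x) -> (forall x, O x -> `|u x| <= K) ->
  \int[mu]_(x in O) u (phi x) = \int[mu]_(x in O) u x.
Proof.
move=> mO mphi mu_ inv Ophi uK; rewrite /Rintegral; congr fine.
have OE : phi @^-1` O = O by apply/seteqP; split=> x /Ophi.
have mEu : measurable_fun setT (EFin \o u) by exact/measurable_EFinP.
have Iu : mu.-integrable (phi @^-1` O) ((EFin \o u) \o phi).
  rewrite /= OE; apply: (bounded_integrable (f := u \o phi) (K := K)) => //.
    exact: measurableT_comp.
  by move=> x Ox; apply: uK; exact/Ophi.
have := @integral_pushforward _ _ _ _ R phi mphi mu O (EFin \o u) mEu Iu mO.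
rewrite [X in _ = integral _ X _]OE => <-.
by apply: eq_measure_integral => A mA _; exact: inv.
Qed.

Lemma is_derive_Rintegral (O : set T) (f df : R -> T -> R) (d K C : R) :
  measurable O -> (forall t, `|t| < d -> measurable_fun setT (f t)) ->
  (forall t x, `|t| < d -> O x -> `|f t x| <= K) ->
  (forall t x, `|t| < d -> O x -> is_derive t (1 : R) (f ^~ x) (df t x)) ->
  (forall t x, `|t| < d -> O x -> `|df t x| <= C) ->
  forall t, `|t| < d -> is_derive t (1 : R) (fun t => \int[mu]_(x in O) f t x)
    (\int[mu]_(x in O) df t x).
Proof.
move=> mO mf fK dfx dfC t td.
have Iitv s : (`](- d), d[%classic : set R) s -> `|s| < d.
  by rewrite /= in_itv/= ltr_norml.
have It : (`](- d), d[%classic : set R) t by rewrite /= in_itv/= -ltr_norml.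
have intf s : (`](- d), d[%classic : set R) s -> mu.-integrable O (EFin \o f s).
  by move=> /Iitv sd; apply: bounded_integrable (mf s sd) (fun x => fK s x sd).
have derf s x : (`](- d), d[%classic : set R) s -> O x -> derivable (f ^~ x) s 1.
  by move=> /Iitv sd Ox; have [] := dfx s x sd Ox.
have d1E s x : `|s| < d -> O x -> partial1of2 f s x = df s x.
  by move=> sd Ox; rewrite partial1of2E; have [_ ->] := dfx s x sd Ox.
(* [C] may be negative when [O] is empty, whereas a dominating function must be nonnegative; hence
   [|C|]. *)
have Gub s x : (`](- d), d[%classic : set R) s -> O x -> `|partial1of2 f s x| <= `|C|.
  move=> /Iitv sd Ox; rewrite d1E//; apply: le_trans (dfC s x sd Ox) (ler_norm _).
have IG : mu.-integrable O (EFin \o (fun _ => `|C|)).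
  by apply: (bounded_integrable (K := `|C|)) => // x _; rewrite normr_id.
have D := @cvg_differentiation_under_integral R _ T mu f O mO t (- d) d It intf derf
  (fun _ => `|C|) (fun _ => normr_ge0 C) IG Gub.
have DE : \int[mu]_(x in O) partial1of2 f t x = \int[mu]_(x in O) df t x.
  by apply: eq_Rintegral => x; rewrite inE => Ox; exact: d1E.
rewrite DE in D; split.
  apply/cvg_ex; exists (\int[mu]_(x in O) df t x).
  by under eq_fun do rewrite scaler1.
by apply/cvg_lim => //; under eq_fun do rewrite scaler1.
Qed.

(* Both derivatives below are the same function [D]: the derivative in [s] of the
   integral of [u \o Theta s] is thus the derivative in [t] of the integral of
   [v \o Theta s \o Phi t], which does not depend on [t]. *)
Lemma Rintegral_flow_constant (O : set T) (Theta Phi : R -> T -> T) (u v : T -> R)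
    (D : R -> T -> R) (d K C : R) :
  0 < d -> measurable O -> measurable_fun setT u -> measurable_fun setT v ->
  (forall s, `|s| < d -> measurable_fun setT (Theta s)) ->
  (forall s, `|s| < d -> measurable_fun setT (Phi s)) ->
  (forall s x, `|s| < d -> O x -> O (Theta s x)) ->
  (forall s x, `|s| < d -> O (Phi s x) <-> O x) ->
  (forall s A, `|s| < d -> measurable A -> mu (Phi s @^-1` A) = mu A) ->
  (forall x, O x -> `|u x| <= K) -> (forall x, O x -> `|v x| <= K) ->
  (forall s x, `|s| < d -> O x -> `|D s x| <= C) ->
  (forall s x, `|s| < d -> O x -> is_derive s (1 : R) (fun s => u (Theta s x)) (D s x)) ->
  (forall s t x, `|s| < d -> `|t| < d -> O x ->
    is_derive t (1 : R) (fun t => v (Theta s (Phi t x))) (D s (Phi t x))) ->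
  (forall x, Phi 0 x = x) ->
  forall s, `|s| < d ->
  \int[mu]_(x in O) u (Theta s x) = \int[mu]_(x in O) u (Theta 0 x).
Proof.
move=> d0 mO mu_ mv mTheta mPhi OTheta OPhi inv uK vK DC du dv Phi0 s sd.
have I0 q : `|q| < d -> \int[mu]_(x in O) D q x = 0.
  move=> qd; have n0 : `|0 : R| < d by rewrite normr0.
  have mt t : `|t| < d -> measurable_fun setT (fun x => v (Theta q (Phi t x))).
    move=> td; apply: (measurableT_comp (f := v \o Theta q)); last exact: mPhi.
    by apply: measurableT_comp => //; exact: mTheta.
  have vt t x : `|t| < d -> O x -> `|v (Theta q (Phi t x))| <= K.
    by move=> td Ox; apply/vK/OTheta => //; exact/OPhi.
  have Dt t x : `|t| < d -> O x -> `|D q (Phi t x)| <= C.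
    by move=> td Ox; apply: DC => //; exact/OPhi.
  have [_ DE] := is_derive_Rintegral mO mt vt (fun t x td => dv q t x qd td) Dt n0.
  have Y : \forall t \near (0 : R), \int[mu]_(x in O) v (Theta q (Phi t x)) =
      \int[mu]_(x in O) v (Theta q x).
    apply: filterS (near_norm_lt n0) => t td.
    apply: (Rintegral_invariant (phi := Phi t) (u := v \o Theta q) (K := K)) => //.
    + exact: mPhi.
    + by apply: measurableT_comp => //; exact: mTheta.
    + by move=> A; exact: inv.
    + by move=> x; exact: OPhi.
    + by move=> x Ox; apply/vK/OTheta.
  have E0 := etrans (near_eq_derive (1 : R) Y) (derive_cst _ _ _).
  apply: etrans _ (etrans (esym DE) E0).
  by apply: eq_Rintegral => x _; rewrite Phi0.
have dI t : `|t| < d -> is_derive t (1 : R)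
    (fun s => \int[mu]_(x in O) u (Theta s x)) 0.
  move=> td; rewrite -(I0 t td).
  have mt q : `|q| < d -> measurable_fun setT (fun x => u (Theta q x)).
    by move=> qd; apply: measurableT_comp => //; exact: mTheta.
  exact: is_derive_Rintegral mO mt (fun q x qd Ox => uK _ (OTheta q x qd Ox)) du DC t td.
exact: (derive0_constant dI).
Qed.

End invariant_integrals.

(** * The action density and its symmetry in [H] and [F] *)

Section action_density.
Context {R : realType} {n : nat} (M : smoothManifold R n).
Implicit Types (i j k : chart_ix M) (y : 'rV[R]_(n + n)) (w : cotangent M) (G H F : cotangent M -> R).
Variable eta : M -> 'rV[R]_n.

(* For [G := H] this is the integrand of the action, up to the conserved quantity [H]. *)
Definition density G w : R := let i := chart_at (cbase w) in
  dotv (covec w - eta (cbase w)) (velocity G i (cot_chart i w)).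

Definition density_loc i G y : R :=
  dotv (rsubmx y - form_loc eta i (lsubmx y)) (velocity G i y).

Lemma density_chart i G w : cot_Ck 2 G -> cot_dom i w ->
  density G w = density_loc i G (cot_chart i w).
Proof.
move=> GC; case: w => x p xi; set k := chart_at x; have xk : dom k x := chart_at_dom x.
have [wik Tw] := cot_trans_chart (z := Cot x p) (xi : cot_dom i (Cot x p)) (xk : cot_dom k (Cot x p)).
rewrite /density /= -/k -Tw (velocity_cov GC wik).
have dT := trans_differentiable wik.
apply: etrans (esym (dotv_pullback _ _ dT)) _; rewrite /density_loc; apply: (congr1 (fun a => dotv a _)).
have E : lsubmx (cot_chart i (Cot x p)) = phi i x by rewrite /cot_chart row_mxKl.
rewrite E /form_loc (phiK xi) /cot_chart row_mxKr row_mxKr /=.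
by apply/rowP => b; rewrite !mxE dotvBl.
Qed.

Hypothesis eta_closed : closed_form eta.

Lemma is_Ck1_rsubmx m l (U : set 'rV[R]_(m + l)) : is_Ck 1 U rsubmx.
Proof.
split=> [y _|v]; first exact: differentiable_rsubmx.
rewrite (_ : (fun _ => _) = cst (rsubmx v)); first exact: (is_Ck_cst 0).
by apply/funext => y; exact: derive_rsubmx.
Qed.

Lemma form_lift_C1 i : is_Ck 1 (bundle_cod i) (form_loc eta i \o lsubmx).
Proof.
have cl : continuous (lsubmx : 'rV[R]_(n + n) -> 'rV[R]_n).
  by move=> y; exact/differentiable_continuous/differentiable_lsubmx.
exact: (is_Ck_lin cl (@cod_open _ _ M i) ((eta_closed i).1 1%N)).
Qed.

Lemma velocity_C1 i G : cot_Ck 2 G -> is_Ck 1 (bundle_cod i) (velocity G i).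
Proof.
move=> /(grad_C1 i) GC; have oU := @bundle_cod_open _ _ M i.
apply: is_Ck_mx => // j.
rewrite (_ : (fun _ => _) = fun y => grad (G \o cot_param i) y 0 (rshift n j)).
  exact: is_Ck_coord.
by apply/funext => y; rewrite mxE.
Qed.

Lemma covector_C1 i : is_Ck 1 (bundle_cod i) (fun y => rsubmx y - form_loc eta i (lsubmx y)).
Proof.
have oU := @bundle_cod_open _ _ M i.
apply: (is_CkD oU); first exact: is_Ck1_rsubmx.
exact: (is_CkN oU (form_lift_C1 i)).
Qed.

Lemma density_C1 G : cot_Ck 2 G -> cot_Ck 1 (density G).
Proof.
move=> GC i; have oU := @bundle_cod_open _ _ M i.
apply: (is_Ck_ext (f := density_loc i G) oU).
  by move=> y yi; have [pi cK] := cot_paramK yi; rewrite /comp (density_chart GC pi) cK.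
exact: (is_Ck_dotv oU (covector_C1 i) (velocity_C1 i GC)).
Qed.

Lemma derive_density i G y u : cot_Ck 2 G -> bundle_cod i y ->
  'D_u (density G \o cot_param i) y =
  dotv (rsubmx u - 'D_(lsubmx u) (form_loc eta i) (lsubmx y)) (velocity G i y) +
  dotv (rsubmx y - form_loc eta i (lsubmx y)) (rsubmx ('D_u (grad (G \o cot_param i)) y)).
Proof.
move=> GC yi; have oU := @bundle_cod_open _ _ M i.
have E : \forall y' \near y, (density G \o cot_param i) y' = density_loc i G y'.
  apply: filterS (bundle_cod_near yi) => y' y'i.
  by have [pi cK] := cot_paramK y'i; rewrite /comp (density_chart GC pi) cK.
apply: etrans (near_eq_derive u E) _.
have dc := is_Ck_differentiable (covector_C1 i) yi.
have dv := is_Ck_differentiable (velocity_C1 i GC) yi.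
apply: etrans (derive_dotv u dc dv) _.
apply: congr2; [apply: (congr1 (fun a => dotv a _))|apply: (congr1 (dotv _))].
  have dl : differentiable (form_loc eta i \o lsubmx) y := is_Ck_differentiable (form_lift_C1 i) yi.
  have dr := differentiable_rsubmx y.
  apply: etrans (deriveB (diff_derivable dr) (diff_derivable dl)) _; apply: congr2.
    exact: derive_rsubmx.
  apply: (congr1 -%R).
  apply: etrans (derive_comp u (differentiable_lsubmx y)
    (is_Ck_differentiable ((eta_closed i).1 1%N) yi)) _.
  by rewrite derive_lsubmx.
have dg := is_Ck_differentiable (grad_C1 i GC) yi.
apply: etrans (derive_comp u dg (differentiable_rsubmx _)) _; exact: derive_rsubmx.
Qed.

(** For [a] and [b] the gradients of [H] and [F], the first hypothesis is [{H, F} = 0]. With [p] and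
    [q] the derivatives of the form along the base components of [X_F] and [X_H], the second one is
    its closedness. *)
Lemma symplectic_swap m (a b : 'rV[R]_(m + m)) (p q : 'rV[R]_m) :
  dotv a (symplectic_dual b) = 0 ->
  dotv p (lsubmx (symplectic_dual a)) = dotv q (lsubmx (symplectic_dual b)) ->
  dotv (rsubmx (symplectic_dual b) - p) (rsubmx a) =
  dotv (rsubmx (symplectic_dual a) - q) (rsubmx b).
Proof.
rewrite /symplectic_dual dotv_row_mx !row_mxKl !row_mxKr dotvNr => /eqP.
rewrite subr_eq0 => /eqP ab pq.
by rewrite !dotvBl !dotvNl pq (dotvC _ (rsubmx a)) -ab.
Qed.

(** The two summands of [derive_density] match separately: the first ones by [symplectic_swap], the
    second ones as base components of the identity [ham_commute]. *)
Lemma derive_density_commute i H F y : cot_Ck 2 H -> cot_Ck 2 F -> integral_of_motion H F ->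
  bundle_cod i y -> 'D_(ham i F y) (density H \o cot_param i) y =
    'D_(ham i H y) (density F \o cot_param i) y.
Proof.
move=> HC FC HF yi.
apply: etrans (derive_density _ HC yi) (etrans _ (esym (derive_density _ FC yi))).
have C := ham_commute HC FC HF yi.
have {}C := etrans (esym (derive_ham _ HC yi)) (etrans C (derive_ham _ FC yi)).
have E := etrans (esym (row_mxKl _ _)) (etrans (congr1 lsubmx C) (row_mxKl _ _)).
apply: congr2; last exact: (congr1 (dotv _) E).
exact: symplectic_swap (poisson_chart HC FC HF yi) ((eta_closed i).2 _ yi _ _).
Qed.

(** The equality case of Fenchel's inequality at [p = dL/dv]. *)
Lemma lagrangian_density H z : tonelli H ->
  lagrangian H z - dotv (eta (tbase z)) (tvec z) =
  density H (legendre H z) - H (legendre H z).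
Proof.
move=> HT; case: z => x v; set k := chart_at x; have xk : dom k x := chart_at_dom x.
have zk : tan_dom k (Tan x v) := xk.
have [ck cK] := tan_chartK zk; have L := lagrangianE HT ck.
rewrite cK in L; rewrite L -(legendre_chart HT zk).
have lk : cot_dom k (legendre H (Tan x v)) := xk.
rewrite (cot_chartK lk).2 (tan_chart_at x v) row_mxKr.
have V := legendre_velocity HT zk; rewrite (tan_chart_at x v) row_mxKr in V.
rewrite (legendre_fiber HT) -/k in V *; rewrite /density /= -/k V dotvBl.
by rewrite addrAC.
Qed.

End action_density.

Section borel_measurability.
Context {R : realType} {n : nat} (M : smoothManifold R n).

Lemma open_measurableTM (U : set (tangent M)) : open U -> measurable (U : set (borelTM M)).
Proof. by move=> oU; apply: sub_sigma_algebra; exact/tan_openP. Qed.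

Lemma continuous_measurableTM (f : tangent M -> R) :
  continuous f -> measurable_fun setT (f : borelTM M -> R).
Proof.
move=> cf; apply: (measurability _ (RGenOInfty.measurableE R)).
move=> _ [_ [x ->] <-]; rewrite setTI preimage_itvoy; apply: open_measurableTM.
by apply: (@open_comp _ _ f [set y | x < y]) => [z _|]; [exact: cf|exact: open_gt].
Qed.

Lemma measurable_fun_openTM (f : borelTM M -> borelTM M) :
  (forall U : set (tangent M), open U -> measurable (f @^-1` U : set (borelTM M))) ->
  measurable_fun setT f.
Proof.
move=> fU; have X := @measurability _ _ (borelTM M) (borelTM M) setT f (@tan_open R n M) erefl.
apply: X.
by move=> _ [U oU <-]; rewrite setTI; apply: fU; exact/tan_openP.
Qed.

End borel_measurability.

(** * Borel symmetries of the tangent bundle and their effect on measures *)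

Section conjugated_flow.
Context {R : realType} {n : nat} (M : smoothManifold R n).
Variable H : cotangent M -> R.
Hypothesis H_tonelli : tonelli H.
Variable h : R.

Let H_C2 : cot_Ck 2 H. Proof. by case: H_tonelli. Qed.
Let H_continuous : continuous H := @cot_Ck_continuous _ _ M _ _ H_C2.

Definition energy (z : tangent M) : R := H (legendre H z).

Lemma energy_continuous : continuous energy.
Proof.
move=> z; apply: continuous_comp; first exact: (legendre_continuous H_tonelli).
exact: H_continuous.
Qed.

Lemma energy_open : open [set z | energy z < h].
Proof.
by apply: (@open_comp _ _ energy [set y | y < h]) => [z _|]; [exact: energy_continuous|exact: open_lt].
Qed.

Variables (G : cotangent M -> R) (d : R).
Hypothesis G_C2 : cot_Ck 2 G.
Hypothesis HG : forall i y, bundle_cod i y -> dotv (grad (H \o cot_param i) y) (ham i G y) = 0.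
Hypothesis d0 : 0 < d.
Hypothesis boxes : forall w, H w <= h -> has_flow_box G d w.

(** The map may jump across the level [h]. This is harmless: it preserves the energy, so its two
    pieces never mix. *)
Definition tan_flow (t : R) (z : tangent M) : tangent M :=
  if energy z < h then inv_legendre H (flow G d t (legendre H z)) else z.

Lemma tan_flow_legendre t z : energy z < h ->
  legendre H (tan_flow t z) = flow G d t (legendre H z).
Proof. by rewrite /tan_flow => ->; exact: inv_legendreK. Qed.

Lemma tan_flow_id t z : ~ energy z < h -> tan_flow t z = z.
Proof. by rewrite /tan_flow => /negP/negbTE ->. Qed.

Lemma tan_flow_energy t z : `|t| < d -> energy (tan_flow t z) = energy z.
Proof.
move=> td; have [zh|zh] := pselect (energy z < h); last by rewrite tan_flow_id.
rewrite /energy tan_flow_legendre//.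
exact: (flow_conserved H_C2 G_C2 HG boxes (ltW zh) td).
Qed.

Lemma tan_flow0 z : tan_flow 0 z = z.
Proof.
have [zh|zh] := pselect (energy z < h); last exact: tan_flow_id.
by rewrite /tan_flow zh (flow0 G_C2 boxes (ltW zh)) (legendreK H_tonelli).
Qed.

Lemma tan_flowK t z : `|t| < d / 2 -> tan_flow (- t) (tan_flow t z) = z.
Proof.
move=> td; have [zh|zh] := pselect (energy z < h); last by rewrite !tan_flow_id.
have td' := lt_trans td (half_lt d0).
have zh' : energy (tan_flow t z) < h by rewrite tan_flow_energy.
rewrite {1}/tan_flow zh' (tan_flow_legendre _ zh).
by rewrite (flowK H_C2 G_C2 HG d0 boxes (ltW zh) td) (legendreK H_tonelli).
Qed.

Lemma tan_flow_open t (U : set (tangent M)) : `|t| < d -> open U ->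
  open ([set z | energy z < h] `&` tan_flow t @^-1` U).
Proof.
move=> td oU; rewrite openE => z [zh Uz].
have near_h : \forall z' \near z, energy z' < h.
  by apply: open_nbhs_nbhs; split; [exact: energy_open|exact: zh].
have c : {for z, continuous (inv_legendre H \o (flow G d t \o legendre H))}.
  apply: continuous_comp; last exact: (inv_legendre_continuous H_tonelli).
  apply: continuous_comp; first exact: (legendre_continuous H_tonelli).
  exact: (flow_continuous H_C2 G_C2 boxes zh td).
have E : tan_flow t z = (inv_legendre H \o (flow G d t \o legendre H)) z.
  by rewrite /tan_flow zh.
rewrite /preimage /= E in Uz.
have near_U := c _ (open_nbhs_nbhs (conj oU Uz)).
apply: filterS2 near_h near_U => z' z'h Uz'; split; first exact: z'h.
by rewrite /preimage /= /tan_flow z'h.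
Qed.

Lemma tan_flow_measurable t : `|t| < d -> measurable_fun setT (tan_flow t : borelTM M -> borelTM M).
Proof.
move=> td; apply: measurable_fun_openTM => U oU.
set O := [set z | energy z < h].
rewrite (_ : _ @^-1` _ = (O `&` tan_flow t @^-1` U) `|` (~` O `&` U)).
  apply: measurableU; first by apply: open_measurableTM; exact: tan_flow_open.
  apply: measurableI; last exact: open_measurableTM.
  by apply: measurableC; apply: open_measurableTM; exact: energy_open.
apply/seteqP; split=> z /=.
  have [zh|zh] := pselect (energy z < h); first by left.
  by rewrite (tan_flow_id _ zh) => Uz; right.
by move=> [[]//|[zh Uz]]; rewrite (tan_flow_id _ zh).
Qed.

Lemma tan_flow_preimage t (A : set (borelTM M)) : `|t| < d -> measurable A ->
  measurable (tan_flow t @^-1` A : set (borelTM M)).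
Proof. by move=> td mA; rewrite -[_ @^-1` _]setTI; exact: tan_flow_measurable. Qed.

End conjugated_flow.

Section symmetric_measures.
Context {R : realType} {n : nat} (M : smoothManifold R n).
Hypothesis M_compact : compact [set: M].
Variables (H F : cotangent M -> R) (eta : M -> 'rV[R]_n) (h d : R).
Hypothesis H_tonelli : tonelli H.
Hypothesis F_C2 : cot_Ck 2 F.
Hypothesis F_integral : integral_of_motion H F.
Hypothesis eta_closed : closed_form eta.
Hypothesis d0 : 0 < d.
Hypothesis H_boxes : forall w, H w <= h -> has_flow_box H d w.
Hypothesis F_boxes : forall w, H w <= h -> has_flow_box F d w.

Let H_C2 : cot_Ck 2 H. Proof. by case: H_tonelli. Qed.

Let HF i y : bundle_cod i y -> dotv (grad (H \o cot_param i) y) (ham i F y) = 0 :=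
  @poisson_chart _ _ M H F H_C2 F_C2 F_integral i y.

Let HH i y : bundle_cod i y -> dotv (grad (H \o cot_param i) y) (ham i H y) = 0.
Proof.
move=> _; have := dotv_dualC (grad (H \o cot_param i) y) (grad (H \o cot_param i) y).
by rewrite -/(ham i H y); move: (dotv _ _) => x; lra.
Qed.

Notation O := [set z : tangent M | energy H z < h].
Notation flowF := (tan_flow H h F d).
Notation flowH := (tan_flow H h H d).

Let d2 : d / 2 < d := half_lt d0.

Let mO : measurable (O : set (borelTM M)) := open_measurableTM (@energy_open _ _ M H H_tonelli h).

Section euler_lagrange_flow.
Variable Phi : R -> tangent M -> tangent M.
Hypothesis Phi_flow : euler_lagrange_flow (lagrangian H) Phi.

Lemma flow_ham_curve z t : ham_curve_at H (legendre H \o (Phi ^~ z)) t.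
Proof. exact: ((euler_lagrange_ham H_tonelli _).1 (Phi_flow z).2 t). Qed.

Lemma flow_energy t z : energy H (Phi t z) = energy H z.
Proof.
have t1 : `|t| < `|t| + 1 by rewrite ltrDl.
rewrite -[in RHS](Phi_flow z).1.
exact: (ham_curve_conserved (fun i => is_CkS (H_C2 i)) HH (fun s _ => flow_ham_curve z s) t1).
Qed.

Lemma flow_tan_flow t z : energy H z < h -> `|t| < d -> Phi t z = flowH t z.
Proof.
move=> zh td; rewrite /tan_flow zh -[LHS](legendreK H_tonelli); apply: (congr1 (inv_legendre H)).
apply: (ham_curve_unique (c := legendre H \o (Phi ^~ z)) (c' := flow H d ^~ (legendre H z)) H_C2 _ _ td).
  move=> s sd; split; first exact: flow_ham_curve.
  exact: (flow_curve H_C2 H_boxes (ltW zh) sd).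
by rewrite /= (Phi_flow z).1 (flow0 H_C2 H_boxes (ltW zh)).
Qed.

(* [Phi t] need not be measurable, but it agrees with a Borel map on the sublevel. *)
Lemma tan_flow_invariant (mu : probability (borelTM M) R) t (A : set (borelTM M)) :
  (forall t (A : set (borelTM M)), measurable A -> mu (Phi t @^-1` A) = mu A) ->
  `|t| < d -> measurable A -> mu (flowH t @^-1` A) = mu A.
Proof.
move=> inv td mA.
have mfA := tan_flow_preimage H_tonelli H_C2 H_boxes td mA.
rewrite (measureDI mu mfA mO) (measureDI mu mA mO); congr (_ + _)%E.
  by congr (mu _); apply/seteqP; split=> z /= [Az zh]; move: Az; rewrite (tan_flow_id _ _ _ zh).
apply: etrans (inv t _ (measurableI _ _ mA mO)).
congr (mu _); apply/seteqP; split=> z /= [Az zh].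
  by rewrite flow_energy (flow_tan_flow zh td).
by move: zh Az; rewrite flow_energy => zh; rewrite (flow_tan_flow zh td).
Qed.

(** The energy is constant along an orbit of [Phi]. Either the whole orbit lies in the sublevel,
    where [flow_commute] applies, or it avoids it and [flowF] leaves it pointwise fixed. *)
Lemma conjugate_flow s : `|s| < d / 2 ->
  euler_lagrange_flow (lagrangian H) (fun t z => flowF s (Phi t (flowF (- s) z))).
Proof.
move=> sd z; have sd' := lt_trans sd d2; set z1 := flowF (- s) z; split.
  rewrite (Phi_flow z1).1 -{1}[s]opprK; apply: (tan_flowK H_tonelli F_C2 HF d0 F_boxes).
  by rewrite normrN.
apply/(euler_lagrange_ham H_tonelli) => t; have cH := flow_ham_curve z1.
have [zh|zh] := pselect (energy H z1 < h); last first.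
  rewrite (_ : _ \o _ = legendre H \o (Phi ^~ z1)); first exact: cH.
  by apply/funext => q /=; rewrite tan_flow_id// flow_energy.
rewrite (_ : _ \o _ = fun t => flow F d s ((legendre H \o (Phi ^~ z1)) t)); last first.
  by apply/funext => q; apply: (tan_flow_legendre H_tonelli F d s); rewrite flow_energy.
apply: (flow_commute H_C2 F_C2 F_boxes H_C2 _ (cH t) _ sd').
  by move=> i y yi; exact: (ham_commute H_C2 F_C2 F_integral yi).
by have := flow_energy t z1; rewrite /energy /= => ->.
Qed.

Lemma pushforward_invariant (mu : probability (borelTM M) R) (s t : R) (A : set (borelTM M)) :
  (forall t (A : set (borelTM M)), measurable A -> mu (Phi t @^-1` A) = mu A) ->
  `|s| < d / 2 -> measurable A ->
  pushforward mu (flowF s : borelTM M -> borelTM M)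
    ((fun z => flowF s (Phi t (flowF (- s) z))) @^-1` A) =
  pushforward mu (flowF s : borelTM M -> borelTM M) A.
Proof.
move=> inv sd mA; have sd' := lt_trans sd d2; rewrite /pushforward.
have mfA := tan_flow_preimage H_tonelli F_C2 F_boxes sd' mA.
apply: etrans (inv t _ mfA); congr (mu _); apply/seteqP; split=> z /=;
  by rewrite (tan_flowK H_tonelli F_C2 HF d0 F_boxes).
Qed.

Let u G (z : tangent M) : R := density eta G (legendre H z).

Let u_continuous G : cot_Ck 2 G -> continuous (u G).
Proof.
move=> GC z; apply: continuous_comp; first exact: (legendre_continuous H_tonelli).
exact: (@cot_Ck_continuous _ _ M _ _ (density_C1 eta_closed GC)).
Qed.

Let u_bounded G : cot_Ck 2 G -> exists K, forall z, energy H z < h -> `|u G z| <= K.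
Proof.
move=> GC; have c := @cot_Ck_continuous _ _ M _ _ (density_C1 eta_closed GC).
have [K uK] := sublevel_bounded M_compact H_tonelli h c.
by exists K => z zh; apply: uK; exact: ltW.
Qed.

Let derive_u s z i : `|s| < d -> energy H z < h -> cot_dom i (flow F d s (legendre H z)) ->
  let y := cot_chart i (flow F d s (legendre H z)) in
  is_derive s (1 : R) (fun s => u H (flowF s z))
    (dotv (grad (density eta H \o cot_param i) y) (ham i F y)).
Proof.
move=> sd zh wi y.
rewrite (_ : (fun _ => _) = density eta H \o (flow F d ^~ (legendre H z))); last first.
  by apply/funext => q; rewrite /u (tan_flow_legendre H_tonelli F d q zh).
have c := flow_curve F_C2 F_boxes (ltW zh) sd; have [ci _] := cot_chartK wi.
exact: (ham_curve_fun c wi (cot_Ck_differentiable (density_C1 eta_closed H_C2) ci)).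
Qed.

Lemma Rintegral_density (mu : probability (borelTM M) R) (s : R) :
  (forall t (A : set (borelTM M)), measurable A -> mu (Phi t @^-1` A) = mu A) ->
  `|s| < d ->
  \int[mu]_(z in (O : set (borelTM M))) u H (flowF s z) = \int[mu]_(z in (O : set (borelTM M))) u H z.
Proof.
move=> inv sd.
have [K1 uK1] := u_bounded H_C2; have [K2 uK2] := u_bounded F_C2.
have [C DC] := sublevel_derivative_bounded M_compact H_tonelli h F_C2 (density_C1 eta_closed H_C2).
(* The Borel flow [flowH] stands in for [Phi], and [Num.max K1 K2] bounds both densities on the
   sublevel. *)
have X := @Rintegral_flow_constant _ _ (borelTM M) mu O flowF flowH (u H) (u F)
  (fun s z => 'D_(1 : R) (fun s => u H (flowF s z)) s) d (Num.max K1 K2) C d0 mO.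
have E0 : \int[mu]_(z in (O : set (borelTM M))) u H (flowF 0 z) = \int[mu]_(z in (O : set (borelTM M))) u H z.
  by apply: eq_Rintegral => z _; rewrite (tan_flow0 H_tonelli F_C2 F_boxes).
apply: (etrans _ E0); apply: X sd.
- exact: continuous_measurableTM (u_continuous H_C2).
- exact: continuous_measurableTM (u_continuous F_C2).
- by move=> q qd; exact: (tan_flow_measurable H_tonelli F_C2 F_boxes qd).
- by move=> q qd; exact: (tan_flow_measurable H_tonelli H_C2 H_boxes qd).
- by move=> q z qd /=; rewrite (tan_flow_energy H_tonelli F_C2 HF F_boxes).
- move=> q z qd; have E := tan_flow_energy H_tonelli H_C2 HH H_boxes z qd.
  by split=> zh; [move: zh; rewrite /= E|rewrite /= E]; exact.
- by move=> q A qd mA; exact: tan_flow_invariant.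
- by move=> z zh; rewrite le_max uK1.
- by move=> z zh; rewrite le_max (uK2 z zh) orbT.
- move=> q z qd zh; set w := flow F d q (legendre H z).
  have wh : H w <= h by rewrite (flow_conserved H_C2 F_C2 HF F_boxes (ltW zh) qd); exact: ltW.
  have [i wi wC] := DC w wh; have [_ E] := derive_u qd zh wi.
  by rewrite -E in wC.
- move=> q z qd zh; set w := flow F d q (legendre H z).
  have wi : cot_dom (chart_at (cbase w)) w := chart_at_dom _.
  have [D1 D2] := derive_u qd zh wi.
  by split.
(* The image under the flow of [F] of an orbit of [H] is again an integral curve of [X_H]; along it
   the density of [F] varies as the density of [H] does along [X_F], by [derive_density_commute]. *)
- move=> q t z qd td zh; set c := fun t => flow H d t (legendre H z).
  have near_h : \forall t' \near t, energy H (flowH t' z) < h.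
    by apply: filterS (near_norm_lt td) => t' /(tan_flow_energy H_tonelli H_C2 HH H_boxes z) ->.
  have zh' := nbhs_singleton near_h.
  have Lc t' : legendre H (flowH t' z) = c t' := tan_flow_legendre H_tonelli H d t' zh.
  set w := flow F d q (c t); set i := chart_at (cbase w).
  have wi : cot_dom i w := chart_at_dom _; have [ci _] := cot_chartK wi.
  have wi' : cot_dom i (flow F d q (legendre H (flowH t z))) by rewrite Lc.
  have [_ E] := derive_u qd zh' wi'; rewrite E Lc -/w.
  have cc := flow_curve H_C2 H_boxes (ltW zh) td.
  have ch : H (c t) < h by rewrite -Lc.
  have XG j y (yj : bundle_cod j y) := ham_commute H_C2 F_C2 F_integral yj.
  have C' := flow_commute H_C2 F_C2 F_boxes H_C2 XG cc ch qd.
  have dF := cot_Ck_differentiable (density_C1 eta_closed F_C2) ci.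
  have dH := cot_Ck_differentiable (density_C1 eta_closed H_C2) ci.
  have D := ham_curve_fun C' wi dF.
  have V := etrans (dotv_grad _ dH) (etrans
    (derive_density_commute eta_closed H_C2 F_C2 F_integral ci) (esym (dotv_grad _ dF))).
  rewrite V; apply: near_eq_is_derive D; apply: filterS near_h => t' th'.
  by rewrite /u (tan_flow_legendre H_tonelli F d q th') Lc.
- exact: (tan_flow0 H_tonelli H_C2 H_boxes).
Qed.

(** The integrand is [u H] minus the energy. The energy is preserved pointwise, so only the integral
    of [u H] over the sublevel has to be compared. *)
Lemma action_pushforward (mu nu : probability (borelTM M) R) (s : R) :
  (forall t (A : set (borelTM M)), measurable A -> mu (Phi t @^-1` A) = mu A) ->
  `|s| < d -> nu = pushforward mu (flowF s : borelTM M -> borelTM M) :> (set _ -> _) ->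
  action (lagrangian H) eta nu = action (lagrangian H) eta mu.
Proof.
move=> inv sd nuE; pose f (z : tangent M) : R := u H z - energy H z.
have fE (m : probability (borelTM M) R) :
    action (lagrangian H) eta m = (\int[m]_(z in [set: borelTM M]) (f z)%:E)%E.
  by apply: eq_integral => z _; rewrite (lagrangian_density eta z H_tonelli).
rewrite !fE nuE.
have mflow : measurable_fun setT (flowF s : borelTM M -> borelTM M).
  exact: (tan_flow_measurable H_tonelli F_C2 F_boxes sd).
have muH : measurable_fun setT (u H : borelTM M -> R) := continuous_measurableTM (u_continuous H_C2).
have mE : measurable_fun setT (energy H : borelTM M -> R).
  exact: continuous_measurableTM (@energy_continuous _ _ M H H_tonelli).
have mf : measurable_fun setT (f : borelTM M -> R) by exact: measurable_funB.
have mEf : measurable_fun setT (EFin \o f : borelTM M -> \bar R) by exact/measurable_EFinP.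
apply: etrans (integral_comp mu mflow mEf) _.
have [K1 uK] := u_bounded H_C2.
have [K2 EK] : exists K, forall z, energy H z < h -> `|energy H z| <= K.
  have [K HK] := sublevel_bounded M_compact H_tonelli h (@cot_Ck_continuous _ _ M _ _ H_C2).
  by exists K => z zh; apply: HK; exact: ltW.
have En z := tan_flow_energy H_tonelli F_C2 HF F_boxes z sd.
have Oflow z : O z -> O (flowF s z) by rewrite /= En.
have fK z : O z -> `|f z| <= K1 + K2.
  by move=> zh; apply: le_trans (ler_normB _ _) _; exact: lerD (uK z zh) (EK z zh).
have mfs : measurable_fun setT (f \o flowF s : borelTM M -> R) := measurableT_comp mf mflow.
have out z : ~ O z -> (f \o flowF s) z = f z.
  by move=> /(tan_flow_id F d s) E; exact: (congr1 f E).
apply: (integral_eq_glue mO mfs mf out (fun z zh => fK _ (Oflow z zh)) fK).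
have mus : measurable_fun setT (u H \o flowF s : borelTM M -> R) := measurableT_comp muH mflow.
have I1 := bounded_integrable mu mO muH uK; have I2 := bounded_integrable mu mO mE EK.
have I3 := bounded_integrable mu mO mus (fun z zh => uK _ (Oflow z zh)).
have E1 := RintegralB mO I1 I2; have E2 := RintegralB mO I3 I2.
apply: etrans (etrans _ (etrans E2 _)) (esym E1).
  by apply: eq_Rintegral => z _; exact: (congr1 (fun e => u H (flowF s z) - e) (En z)).
exact: (congr1 (fun x => x - _) (Rintegral_density inv sd)).
Qed.

End euler_lagrange_flow.

Lemma mather_flow w s : mather_set H eta w -> H w < h -> `|s| < d / 2 ->
  mather_set H eta (flow F d s w).
Proof.
move=> [z [mu [[Phi Phi_flow inv] mu_min] zmu] <-] zh sd; have sd' := lt_trans sd d2.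
have mflow : measurable_fun setT (flowF s : borelTM M -> borelTM M).
  exact: (tan_flow_measurable H_tonelli F_C2 F_boxes sd').
pose X : {mfun borelTM M >-> borelTM M} := mfun_Sub (mem_set mflow).
pose nu : probability (borelTM M) R := distribution mu X.
have nuE : nu = pushforward mu (flowF s : borelTM M -> borelTM M) :> (set _ -> _) by [].
exists (flowF s z); last exact: (tan_flow_legendre H_tonelli F d s zh).
exists nu; first split.
- exists (fun t z => flowF s (Phi t (flowF (- s) z))); first exact: conjugate_flow.
  by move=> t A mA; rewrite nuE; exact: pushforward_invariant.
- by move=> nu' inv'; rewrite (action_pushforward Phi_flow inv sd' nuE); exact: mu_min.
(* Within the open sublevel the preimage of [U] is an open neighborhood of [z], hence has positive
   [mu]-measure. *)
move=> U oU Uz; rewrite nuE.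
have oV := tan_flow_open H_tonelli F_C2 F_boxes sd' ((tan_openP U).1 oU).
have V0 := zmu _ ((tan_openP _).2 oV) (conj zh Uz).
apply: lt_le_trans V0 _; apply: le_measure; rewrite ?inE.
- exact: open_measurableTM.
- apply: (tan_flow_preimage H_tonelli F_C2 F_boxes sd').
  by apply: open_measurableTM; exact/tan_openP.
- by move=> z' [].
Qed.

End symmetric_measures.

(** * Tangent vectors of the Mather set *)

Section tangent_curves.
Context {R : realType} {n : nat} (M : smoothManifold R n).

Lemma ham_curve_C1 F (c : R -> cotangent M) i (e : R) : cot_Ck 2 F ->
  (forall t, `|t| < e -> cot_dom i (c t) /\ ham_curve_at F c t) ->
  is_Ck 1 [set t : R | `|t| < e] (cot_chart i \o c).
Proof.
move=> FC ce; have D t : `|t| < e -> is_derive t (1 : R) (cot_chart i \o c) (ham i F (cot_chart i (c t))).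
  by move=> /ce[ti [_]]; exact.
have dc t : `|t| < e -> differentiable (cot_chart i \o c) t.
  by move=> /D[/derivable1_diffP].
split=> [t te|v t te]; first exact: dc.
apply: (@near_eq_continuous _ _ (fun t => v *: ham i F (cot_chart i (c t)))).
  apply: filterS (near_norm_lt te) => t' t'e; have [_ E] := D t' t'e.
  have vE : v = v *: (1 : R) by exact/esym/mulr1.
  rewrite [in RHS]vE; apply: etrans (congr1 _ (esym E)) (esym _).
  exact: deriveZv (dc t' t'e).
apply: cvgZr; have [ti _] := ce t te; have [ci _] := cot_chartK ti.
apply: (@continuous_comp _ _ _ (cot_chart i \o c) (ham i F)).
  exact: is_derive_continuous (D t te).
exact/differentiable_continuous/(ham_differentiable FC ci).
Qed.

Lemma mather_tangent (H F : cotangent M -> R) (eta : M -> 'rV[R]_n) (z : cotangent M) :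
  compact [set: M] -> tonelli H -> cot_Ck 2 F -> integral_of_motion H F -> closed_form eta ->
  mather_set H eta z -> generalized_tangent (mather_set H eta) z (ham_field F z).
Proof.
move=> M_compact HT FC HF eta_closed hz; have HC : cot_Ck 2 H by case: HT.
(* Any level above [H z] would do: [z] must lie in the open sublevel, where the flow of [F] is
   continuous. *)
pose h := H z + 1; have zh : H z < h by rewrite ltrDl.
have boxes G : cot_Ck 2 G -> exists2 d, 0 < d & forall w, H w <= h -> has_flow_box G d w.
  move=> GC; apply: (sublevel_uniform M_compact HT) => [e e' w e0 ee'|w _].
    exact: has_flow_boxW.
  exact: has_flow_box_near.
have [d1 d10 Hb] := boxes H HC; have [d2 d20 Fb] := boxes F FC.
pose d := Num.min d1 d2; have d0 : 0 < d by rewrite lt_min d10.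
have dd1 : d <= d1 by rewrite ge_min lexx.
have dd2 : d <= d2 by rewrite ge_min lexx orbT.
have Hboxes w (wh : H w <= h) := has_flow_boxW d0 dd1 (Hb w wh).
have Fboxes w (wh : H w <= h) := has_flow_boxW d0 dd2 (Fb w wh).
set i := chart_at (cbase z); have zi : cot_dom i z := chart_at_dom _.
have g0 : flow F d 0 z = z := flow0 FC Fboxes (ltW zh).
have curve t : `|t| < d -> ham_curve_at F (flow F d ^~ z) t.
  by move=> td; exact: (flow_curve FC Fboxes (ltW zh) td).
have n0 : `|0 : R| < d by rewrite normr0.
have near_i : \forall t \near (0 : R), cot_dom i (flow F d t z).
  by apply: (curve 0 n0).1; rewrite g0; exact: cot_dom_near.
have [r r0 ri] := (nbhs_ballP _ _).1 near_i.
(* [d / 2] is the time allowed by [mather_flow]; [r] keeps the curve in the chart at [z]. *)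
pose e := Num.min (d / 2) r.
have e0 : 0 < e by rewrite lt_min divr_gt0.
have ed (t : R) : `|t| < e -> `|t| < d / 2 by rewrite lt_min => /andP[].
have ed' (t : R) : `|t| < e -> `|t| < d.
  by move=> /ed td; exact: lt_trans td (half_lt d0).
have ei t : `|t| < e -> cot_dom i (flow F d t z).
  by rewrite lt_min => /andP[_ tr]; apply: ri; rewrite -ball_normE /= sub0r normrN.
exists (flow F d ^~ z), e; split; [exact: e0|exact: g0| | |].
- move=> t te; split; last exact: ei.
  exact: (mather_flow M_compact HT FC HF eta_closed d0 Hboxes Fboxes hz zh (ed t te)).
- by apply: ham_curve_C1 FC _ => t te; split; [exact: ei|exact: curve (ed' t te)].
- have [_ hc] := curve 0 n0; have wi : cot_dom i (flow F d 0 z) by rewrite g0.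
  have [_ E] := hc i wi.
  apply: (etrans E); rewrite g0 /ham_field /cot_diff -/i; exact: erefl.
Qed.

Lemma set_rank_ge m k (A : set 'rV[R]_m) (X : 'M[R]_(k, m)) :
  row_free X -> (forall i, A (row i X)) -> (k <= set_rank A)%N.
Proof.
move=> freeX AX; have km : (k < m.+1)%N by rewrite ltnS -(eqP freeX) rank_leq_col.
apply: (@leq_bigmax_cond _ _ (fun r : 'I_m.+1 => nat_of_ord r) (Ordinal km)).
by apply/asboolP; exists X.
Qed.

(** The symplectic dual exchanges two blocks up to sign, so a vanishing combination of dual rows is
    one of the original rows. *)
Lemma symplectic_dual_free m k (A : 'M[R]_(k, m + m)) :
  row_free A -> row_free (row_mx (rsubmx A) (- lsubmx A)).
Proof.
move=> freeA; apply: inj_row_free => v.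
rewrite mul_mx_row -[0 in RHS](row_mx0) => /eq_row_mx[vr]; rewrite mulmxN => /eqP.
rewrite oppr_eq0 => /eqP vl.
by apply: (row_free_inj freeA); rewrite -[A]hsubmxK mul_mx_row vr vl row_mx0 mul0mx.
Qed.

End tangent_curves.

Theorem proposition2p4 (R : realType) (n k : nat) (M : smoothManifold R n)
    (M_compact : compact [set: M]) (M_connected : connected [set: M])
    (H : cotangent M -> R) (H_tonelli : tonelli H)
    (F : 'I_k -> cotangent M -> R)
    (F_C2 : forall i, cot_Ck 2 (F i))
    (F_integral : forall i, integral_of_motion H (F i))
    (F_independent : independent_functions F)
    (c : deRham_H1 M) (eta : M -> 'rV[R]_n) (eta_c : H1_class c eta)
    (z : cotangent M) (hz : mather_set H eta z) :
  (k <= set_rank (generalized_tangent (mather_set H eta) z))%N.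
Proof.
have eta_closed : closed_form eta.
  by move: eta_c; have [eta0 _ ->] := H1_classP c; case.
(* The rows of this matrix are the Hamiltonian fields of the [F i] at [z]. *)
apply: (set_rank_ge (symplectic_dual_free (F_independent z))) => i.
have := mather_tangent M_compact H_tonelli (F_C2 i) (F_integral i) eta_closed hz.
congr generalized_tangent; apply/rowP => j.
by rewrite !mxE; case: splitP => q _; rewrite !mxE.
Qed.
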